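(* The following decision problem is in co-NP: given a finite set $S$ of judgements and a judgement $\gamma$ of affine Lawvere logic $\mathbb{AL}$, decide whether $S\models\gamma$.
   Context: Fix a countable set $\mathrm{Prop}$ of propositional letters. Formulas of $\mathbb{AL}$ are generated by $\phi ::= p \mid \bot \mid \mathbf{1} \mid \phi\otimes\phi \mid \phi\multimap\phi \mid r*\phi$ with $r\in[0,\infty)$ (derived connectives such as $\lnot\phi:=\phi\multimap\bot$, $\phi\land\psi:=\phi\otimes(\phi\multimap\psi)$, $\phi\lor\psi:=((\psi\multimap\phi)\multimap\phi)\land((\phi\multimap\psi)\multimap\psi)$ are abbreviations). A model is $\mathcal{M}:\mathrm{Prop}\to[0,\infty]$, extended by $\mathcal{M}(\bot)=\infty$, $\mathcal{M}(\mathbf{1})=1$, $\mathcal{M}(r*\phi)=r\mathcal{M}(\phi)$ (with $0\cdot\infty=0$), $\mathcal{M}(\phi\otimes\psi)=\mathcal{M}(\phi)+\mathcal{M}(\psi)$, $\mathcal{M}(\phi\multimap\psi)=\mathcal{M}(\psi)\dot{-}\mathcal{M}(\phi)$ where $a\dot{-}b=0$ if $a\le b$, $a-b$ if $a>b$, $a\ne\infty$, and $\infty$ if $a=\infty$, $b\ne\infty$. A judgement $\phi_1,\dots,\phi_n\vdash\psi$ (finite, possibly empty list of antecedents) is satisfied by $\mathcal{M}$ iff $\sum_i\mathcal{M}(\phi_i)\ge\mathcal{M}(\psi)$. $S\models\gamma$ iff every model satisfying all judgements of $S$ satisfies $\gamma$. Input size: the size of a formula is the number of connectives and propositional-letter occurrences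 plus the total number of bits in the binary representations of the scalar coefficients $r$; the size of an input is the sum of the sizes of its formulas. Scalar coefficients in inputs are rational numbers given in binary. *)

(* Defs.v *)
From Corelib Require Import BinNums.
From HB Require Import structures.
From mathcomp Require Import all_boot all_order all_algebra.
From mathcomp Require Import zify.
From mathcomp Require Import mathcomp_extra boolp classical_sets.
From mathcomp Require Import interval_inference reals constructive_ereal.

Set Implicit Arguments.
Unset Strict Implicit.
Unset Printing Implicit Defensive.

Import Order.TTheory GRing.Theory Num.Theory.

Local Open Scope ring_scope.
Local Open Scope classical_set_scope.

(** * Affine Lawvere logic *)

(* The scalars are a parameter: nonnegative reals in the logic itself, binary
   fractions in the inputs of the decision problem. The countable set of
   propositional letters is [nat]. *)
Inductive form (K : Type) : Type :=
| Var of nat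
| Bot
| One
| Tensor of form K & form K
| Limp of form K & form K
| Scale of K & form K.

Arguments Var {K}.
Arguments Bot {K}.
Arguments One {K}.

Fixpoint map_form (K L : Type) (f : K -> L) (phi : form K) : form L :=
  match phi with
  | Var p => Var p
  | Bot => Bot
  | One => One
  | Tensor a b => Tensor (map_form f a) (map_form f b)
  | Limp a b => Limp (map_form f a) (map_form f b)
  | Scale r a => Scale (f r) (map_form f a)
  end.

Record judgement (K : Type) : Type := Judgement {
  antecedents : seq (form K);
  succedent : form K
}.

Definition map_judgement (K L : Type) (f : K -> L) (j : judgement K) :
    judgement L :=
  Judgement (map (map_form f) (antecedents j)) (map_form f (succedent j)).

Section Semantics.
Variable R : realType.
Local Open Scope ereal_scope.

Definition tsub (a b : \bar R) : \bar R :=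
  if a <= b then 0 else if a == +oo then +oo else a - b.

Record model : Type := Model {
  valuation :> nat -> \bar R;
  valuation_ge0 : forall p, 0 <= valuation p
}.

(* In [\bar R] one has [0 * +oo = 0]. *)
Fixpoint eval (M : model) (phi : form {nonneg R}) : \bar R :=
  match phi with
  | Var p => M p
  | Bot => +oo
  | One => 1
  | Tensor a b => eval M a + eval M b
  | Limp a b => tsub (eval M b) (eval M a)
  | Scale r a => (r%:num)%:E * eval M a
  end.

Definition satisfies (M : model) (j : judgement {nonneg R}) : Prop :=
  eval M (succedent j) <= \sum_(phi <- antecedents j) eval M phi.

Definition entails (S : seq (judgement {nonneg R}))
    (gamma : judgement {nonneg R}) : Prop :=
  forall M : model,
    (forall j, List.In j S -> satisfies M j) -> satisfies M gamma.

End Semantics.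

(** * Inputs of the decision problem *)

(* A nonnegative rational given by binary numerator and denominator, not
   necessarily in lowest terms. *)
Record frac : Type := Frac { fnum : N; fden : positive }.

Definition frac_val (R : realType) (q : frac) : {nonneg R} :=
  ((nat_of_bin (fnum q))%:R / (nat_of_bin (Npos (fden q)))%:R)%:nng.

Record instance : Type := Instance {
  premises : seq (judgement frac);
  conclusion : judgement frac
}.

Definition valid_instance (R : realType) (x : instance) : Prop :=
  entails (map (map_judgement (frac_val R)) (premises x))
          (map_judgement (frac_val R) (conclusion x)).

(** * Encoding of inputs as words over a finite alphabet *)

Inductive token : Type :=
| TVar | TBot | TOne | TTensor | TLimp | TScale
| TSlash | TComma | TVdash | TSemi | TBit of bool.

Definition token_code (t : token) : 'I_10 + bool :=
  match t with
  | TVar => inl (inord 0) | TBot => inl (inord 1) | TOne => inl (inord 2)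
  | TTensor => inl (inord 3) | TLimp => inl (inord 4)
  | TScale => inl (inord 5) | TSlash => inl (inord 6)
  | TComma => inl (inord 7) | TVdash => inl (inord 8)
  | TSemi => inl (inord 9) | TBit b => inr b
  end.

Definition token_decode (c : 'I_10 + bool) : token :=
  match c with
  | inl i => nth TSemi [:: TVar; TBot; TOne; TTensor; TLimp; TScale;
                           TSlash; TComma; TVdash; TSemi] i
  | inr b => TBit b
  end.

Lemma token_codeK : cancel token_code token_decode.
Proof. by case=> //=; rewrite inordK. Qed.

HB.instance Definition _ := Equality.copy token (can_type token_codeK).
HB.instance Definition _ := Choice.copy token (can_type token_codeK).
HB.instance Definition _ := Countable.copy token (can_type token_codeK).
HB.instance Definition _ : isFinite token := CanIsFinite token_codeK.

(* Binary notation, most significant bit first; zero is the one-bit word 0. *)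
Fixpoint bits_pos (p : positive) : seq bool :=
  match p with
  | xH => [:: true]
  | xO q => rcons (bits_pos q) false
  | xI q => rcons (bits_pos q) true
  end.

Definition bits_N (n : N) : seq bool :=
  match n with N0 => [:: false] | Npos p => bits_pos p end.

Definition enc_bits (s : seq bool) : seq token := map TBit s.

(* Polish (prefix) notation. *)
Fixpoint enc_form (phi : form frac) : seq token :=
  match phi with
  | Var p => TVar :: enc_bits (bits_N (bin_of_nat p))
  | Bot => [:: TBot]
  | One => [:: TOne]
  | Tensor a b => TTensor :: enc_form a ++ enc_form b
  | Limp a b => TLimp :: enc_form a ++ enc_form b
  | Scale r a => TScale :: enc_bits (bits_N (fnum r)) ++
                 TSlash :: enc_bits (bits_pos (fden r)) ++ enc_form a
  end.

Definition enc_judgement (j : judgement frac) : seq token :=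
  flatten [seq rcons (enc_form phi) TComma | phi <- antecedents j] ++
  TVdash :: enc_form (succedent j).

Definition encode (x : instance) : seq token :=
  flatten [seq rcons (enc_judgement j) TSemi | j <- premises x] ++
  enc_judgement (conclusion x).

(* The size in which a letter occurrence counts 1. Up to a constant
   factor, the length of [encode] exceeds it only by the bits of the letter
   indices; see [size_encode_bounds]. *)
Fixpoint form_size (phi : form frac) : nat :=
  match phi with
  | Var _ | Bot | One => 1
  | Tensor a b | Limp a b => (form_size a + form_size b).+1%N
  | Scale r a =>
      (size (bits_N (fnum r)) + size (bits_pos (fden r)) + form_size a).+1%N
  end.

Fixpoint letter_bits (phi : form frac) : nat :=
  match phi with
  | Var p => size (bits_N (bin_of_nat p))
  | Bot | One => 0
  | Tensor a b | Limp a b => (letter_bits a + letter_bits b)%N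
  | Scale _ a => letter_bits a
  end.

Definition judgement_forms (j : judgement frac) : seq (form frac) :=
  rcons (antecedents j) (succedent j).

Definition instance_forms (x : instance) : seq (form frac) :=
  flatten (map judgement_forms (rcons (premises x) (conclusion x))).

Definition instance_size (x : instance) : nat :=
  sumn (map form_size (instance_forms x)).

Definition instance_letter_bits (x : instance) : nat :=
  sumn (map letter_bits (instance_forms x)).

Lemma form_size_gt0 phi : (0 < form_size phi)%N.
Proof. by case: phi. Qed.

Lemma size_enc_form phi :
  (form_size phi <= size (enc_form phi) <=
     2 * form_size phi + letter_bits phi)%N.
Proof.
elim: phi => [p|||a IHa b IHb|a IHa b IHb|r a IHa] //=;
  rewrite /= ?size_map ?size_cat /= ?size_cat ?size_map; lia.
Qed.

Lemma size_enc_judgement j :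
  let fs := judgement_forms j in
  (sumn (map form_size fs) <= size (enc_judgement j) <=
     3 * sumn (map form_size fs) + sumn (map letter_bits fs))%N.
Proof.
rewrite /judgement_forms /enc_judgement; case: j => s psi /=.
have := size_enc_form psi; have := form_size_gt0 psi.
rewrite !map_rcons !sumn_rcons size_cat /=.
elim: s => [|phi s IHs] //= h1 h2; first by lia.
have := size_enc_form phi; have := form_size_gt0 phi.
by move: (IHs h1 h2); rewrite size_cat size_rcons; lia.
Qed.

Lemma size_encode_bounds x :
  (instance_size x <= size (encode x) <=
     4 * instance_size x + instance_letter_bits x)%N.
Proof.
rewrite /instance_size /instance_letter_bits /instance_forms /encode.
case: x => S gamma /=; elim: S => [|j S IHS] /=.
  by have := size_enc_judgement gamma; rewrite cats0; lia.
have := size_enc_judgement j; rewrite /=.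
have : (0 < sumn (map form_size (judgement_forms j)))%N.
  rewrite /judgement_forms map_rcons sumn_rcons.
  by have := form_size_gt0 (succedent j); lia.
move: IHS; move: (enc_judgement gamma) (enc_judgement j) => wg wj.
by rewrite !map_cat !sumn_cat !size_cat size_rcons; lia.
Qed.

(** * Turing machines, P, NP and co-NP *)

(* The scanned cell, the cells to its left (nearest first) and the cells to its
   right; all cells not listed are blank ([None]). *)
Record tape (A : Type) : Type := Tape {
  left_cells : seq (option A);
  scanned : option A;
  right_cells : seq (option A)
}.

Inductive move : Type := MoveL | MoveN | MoveR.

Definition write_move (A : Type) (a : option A) (m : move) (t : tape A) :
    tape A :=
  let: Tape l _ r := t in
  match m with
  | MoveN => Tape l a r
  | MoveL => Tape (behead l) (head None l) (a :: r)
  | MoveR => Tape (a :: l) (head None r) (behead r)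
  end.

Definition blank_tape (A : Type) : tape A := Tape [::] None [::].

Definition word_tape (A : Type) (w : seq A) : tape A :=
  Tape [::] (ohead w) (map some (behead w)).

(* Deterministic Turing machines with input alphabet [Sigma] and [ntm.+1] tapes
   infinite in both directions. The tape alphabet is the disjoint union of
   [Sigma], auxiliary symbols and the blank. [verdict q] is [None] when [q] is
   not a halting state, and [Some b] when the machine halts in [q], accepting
   iff [b]. *)
Record TM (Sigma : finType) : Type := MkTM {
  ntm : nat;
  aux : finType;
  state : finType;
  start : state;
  verdict : state -> option bool;
  delta : state -> {ffun 'I_ntm.+1 -> option (Sigma + aux)%type} ->
          state * {ffun 'I_ntm.+1 -> option (Sigma + aux)%type * move}
}.

Section Run.
Variables (Sigma : finType) (M : TM Sigma).

Record config : Type := Config {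
  cstate : state M;
  ctapes : {ffun 'I_(ntm M).+1 -> tape (Sigma + aux M)%type}
}.

Definition init (w : seq Sigma) : config :=
  Config (start M)
    [ffun i => if i == ord0 then word_tape (map inl w) else blank_tape _].

(* Halting configurations are fixed. *)
Definition step (c : config) : config :=
  if verdict (cstate c) is Some _ then c else
  let: (q, act) := delta (cstate c) [ffun i => scanned (ctapes c i)] in
  Config q [ffun i => write_move (act i).1 (act i).2 (ctapes c i)].

Definition outcome (n : nat) (w : seq Sigma) : option bool :=
  verdict (cstate (iter n step (init w))).

End Run.

Definition poly_bound (c k n : nat) : nat := (c * n ^ k + c)%N.

Definition language (Sigma : finType) : Type := set (seq Sigma).

Definition decides_in_time (Sigma : finType) (M : TM Sigma)
    (L : language Sigma) (T : nat -> nat) : Prop :=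
  forall w, exists b : bool,
    outcome M (T (size w)) w = Some b /\ (b <-> L w).

Definition inP (Sigma : finType) (L : language Sigma) : Prop :=
  exists (M : TM Sigma) (c k : nat), decides_in_time M L (poly_bound c k).

(* The word w#y, with [None] as the separator #. *)
Definition pair_word (Sigma Delta : finType) (w : seq Sigma) (y : seq Delta) :
    seq (option (Sigma + Delta)%type) :=
  map (some \o inl) w ++ None :: map (some \o inr) y.

Definition pair_language (Sigma Delta : finType)
    (V : seq Sigma -> seq Delta -> Prop) :
    language (option (Sigma + Delta)%type) :=
  [set u | exists w y, u = pair_word w y /\ V w y].

(* Certificates are words over some finite alphabet [Delta]. *)
Definition inNP (Sigma : finType) (L : language Sigma) : Prop :=
  exists (Delta : finType) (V : seq Sigma -> seq Delta -> Prop)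
         (c k : nat),
    inP (pair_language V) /\
    forall w, L w <-> exists y, (size y <= poly_bound c k (size w))%N /\ V w y.

Definition in_coNP (Sigma : finType) (L : language Sigma) : Prop :=
  inNP (~` L).

Definition AL_consequence (R : realType) : language token :=
  [set w | exists x : instance, w = encode x /\ valid_instance R x].

(* Main.v *)
(* A refutation is a model that satisfies the premises but not the conclusion.
   After fixing which subformulas are infinite and which branch each truncated
   difference takes, the values of the subformulas solve a homogeneous linear
   system with short coefficients; a vertex and Cramer's rule turn a real
   solution into one in integers with polynomially many bits, up to a common
   denominator, which becomes the value of the unit.

   The certificate lists one row of binary registers for every suffix of the
   input word. Row [t] tells how the suffix of length [t] parses (so that words
   that encode nothing are recognised too) and what its leading formula is
   worth, and points to the row of the suffix that remains after that formula.
   With these pointers, all conditions compare consecutive rows, or arbitrary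
   pairs of rows, by a finite automaton that reads both rows in parallel, which
   a four-tape machine checks in quadratic time. *)
From Corelib Require Import BinNums.
From HB Require Import structures.
From mathcomp Require Import all_boot all_order all_algebra reals.
From mathcomp Require Import zify ring lra.
From mathcomp Require Import boolp interval_inference constructive_ereal.
Require Import Defs.

Set Implicit Arguments.
Unset Strict Implicit.
Unset Printing Implicit Defensive.

Import Order.TTheory GRing.Theory Num.Theory.

(** * A Turing machine comparing all pairs of rows *)

(** Two limits of finite automata shape the encoding. They cannot multiply two registers, so a
    coefficient acts only through additions of a doubled multiplicand, one per digit. They also see
    no rows beyond the pair at hand, so what a row must know about the suffix behind its leading
    formula is copied into primed registers and justified against every other row. The complement of
    the language contains all words that encode no instance. The register [r_good] is therefore
    forced to be the verdict of the parse, and values are constrained only where it is 1. A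
    certificate can thus neither escape the value conditions for a genuine instance nor be burdened
    with them for a malformed word. In the linear system no strict inequality between two
    coordinates is needed. Strictness matters only as positivity of a truncated difference, which is
    a coordinate itself, and homogeneity turns positive into at least 1. Infinite values enter the
    system as 0 through [fine] and are told apart only by their code. *)

Inductive ctl (Q : Type) : Type :=
| Start | CopyW | CopyY | SkipC
| AdjRow of bool & bool
| RewA | RewC of bool | SkipA
| Row | Run of option bool & Q | RewRow
| Halt of bool.

Arguments Start {Q}.
Arguments CopyW {Q}.
Arguments CopyY {Q}.
Arguments SkipC {Q}.
Arguments AdjRow {Q}.
Arguments RewA {Q}.
Arguments RewC {Q}.
Arguments SkipA {Q}.
Arguments Row {Q}.
Arguments RewRow {Q}.
Arguments Halt {Q}.

Definition ctl_code (Q : Type) (c : ctl Q) :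
    'I_11 * bool * bool + option bool * Q :=
  match c with
  | Start => inl (inord 0, true, true)
  | CopyW => inl (inord 1, true, true)
  | CopyY => inl (inord 2, true, true)
  | SkipC => inl (inord 3, true, true)
  | AdjRow f e => inl (inord 4, f, e)
  | RewA => inl (inord 5, true, true)
  | RewC b => inl (inord 6, b, true)
  | SkipA => inl (inord 7, true, true)
  | Row => inl (inord 8, true, true)
  | RewRow => inl (inord 9, true, true)
  | Halt b => inl (inord 10, b, true)
  | Run m q => inr (m, q)
  end.

Definition ctl_decode (Q : Type) (x : 'I_11 * bool * bool + option bool * Q) :
    ctl Q :=
  match x with
  | inl (i, f, e) =>
      nth Start [:: Start; CopyW; CopyY; SkipC; AdjRow f e; RewA; RewC f;
                    SkipA; Row; RewRow; Halt f] i
  | inr (m, q) => Run m q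
  end.

Lemma ctl_codeK (Q : Type) : cancel (@ctl_code Q) (@ctl_decode Q).
Proof. by case=> //= *; rewrite inordK. Qed.

HB.instance Definition _ (Q : finType) :=
  Equality.copy (ctl Q) (can_type (@ctl_codeK Q)).
HB.instance Definition _ (Q : finType) :=
  Choice.copy (ctl Q) (can_type (@ctl_codeK Q)).
HB.instance Definition _ (Q : finType) :=
  Countable.copy (ctl Q) (can_type (@ctl_codeK Q)).
HB.instance Definition _ (Q : finType) : isFinite (ctl Q) :=
  CanIsFinite (@ctl_codeK Q).

Lemma step_halted (Sigma : finType) (M : TM Sigma) (c : config M) b :
  verdict (cstate c) = Some b -> step c = c.
Proof. by rewrite /step => ->. Qed.

Section RowMachine.
Variables (Sigma B Q : finType).
Variables (q0 : bool -> option Sigma -> Q) (q1 : Q) (dl : Q -> B -> B -> Q).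
Variable acc : pred Q.

Let input : finType := option (Sigma + option B)%type.
Let cell := option (input + void)%type.
Let ftape := tape (input + void)%type.

Definition row_cell (d : option B) : cell := Some (inl (Some (inr d))).
Definition word_cell (a : Sigma) : cell := Some (inl (Some (inl a))).
Definition cell_word (x : cell) : option Sigma :=
  if x is Some (inl (Some (inl a))) then Some a else None.

Definition run_next (m : option bool) : ctl Q :=
  if m is Some e then AdjRow false e else RewRow.
Definition run_move (m : option bool) : move :=
  if m is Some _ then MoveR else MoveL.

(* Tape 0 holds the input [w#y]. Copying leftwards leaves the reversals of [y] on
   tapes 1 and 2 and of [w] on tape 3, with the heads at their left ends. The
   machine then runs the automaton on all pairs of consecutive rows, started in
   a state that depends on the next letter of tape 3, and finally on every row
   of tape 1 against every row of tape 2. *)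
Definition row_delta (q : ctl Q) (x0 x1 x2 x3 : cell) :
    ctl Q * seq (cell * move) :=
  let stay q' := (q', [:: (x0, MoveN); (x1, MoveN); (x2, MoveN); (x3, MoveN)]) in
  let mv q' m1 m2 m3 := (q', [:: (x0, MoveN); (x1, m1); (x2, m2); (x3, m3)]) in
  match q with
  | Start => mv CopyW MoveL MoveL MoveN
  | CopyW =>
      match x0 with
      | Some (inl (Some (inl a))) =>
          (CopyW, [:: (x0, MoveR); (x1, MoveN); (x2, MoveN); (x0, MoveL)])
      | Some (inl None) =>
          (CopyY, [:: (x0, MoveR); (x1, MoveN); (x2, MoveN); (x3, MoveN)])
      | _ => stay (Halt false)
      end
  | CopyY =>
      match x0 with
      | Some (inl (Some (inr d))) =>
          (CopyY, [:: (x0, MoveR); (x0, MoveL); (x0, MoveL); (x3, MoveN)])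
      | None => mv SkipC MoveR MoveR MoveR
      | _ => stay (Halt false)
      end
  | SkipC =>
      match x2 with
      | Some (inl (Some (inr (Some _)))) => mv SkipC MoveN MoveR MoveN
      | Some (inl (Some (inr None))) => mv (AdjRow true false) MoveN MoveR MoveN
      | _ => stay (Halt false)
      end
  | AdjRow f e =>
      if x2 is None then
        if e then mv RewA MoveL MoveN MoveN else stay (Halt false)
      else mv (Run (Some (cell_word x3 == None)) (q0 f (cell_word x3)))
              MoveN MoveN MoveR
  | RewA =>
      if x1 is None then mv (RewC false) MoveR MoveL MoveN
      else mv RewA MoveL MoveN MoveN
  | RewC b =>
      if x2 is None then mv (if b then SkipA else Row) MoveN MoveR MoveN
      else mv (RewC b) MoveN MoveL MoveN
  | SkipA =>
      match x1 with
      | Some (inl (Some (inr None))) => mv Row MoveR MoveN MoveN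
      | _ => mv SkipA MoveR MoveN MoveN
      end
  | Row =>
      if x1 is None then stay (Halt true)
      else if x2 is None then mv (RewC true) MoveN MoveL MoveN
      else stay (Run None q1)
  | Run m q =>
      match x1, x2 with
      | Some (inl (Some (inr (Some a)))), Some (inl (Some (inr (Some c)))) =>
          mv (Run m (dl q a c)) MoveR MoveR MoveN
      | Some (inl (Some (inr None))), Some (inl (Some (inr None))) =>
          if acc q then mv (run_next m) (run_move m) MoveR MoveN
          else stay (Halt false)
      | _, _ => stay (Halt false)
      end
  | RewRow =>
      match x1 with
      | Some (inl (Some (inr (Some _)))) => mv RewRow MoveL MoveN MoveN
      | _ => mv Row MoveR MoveN MoveN
      end
  | Halt b => stay (Halt b)
  end.

Definition row_TM : TM input :=
  @MkTM input 3 void (ctl Q) Start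
    (fun q => if q is Halt b then Some b else None)
    (fun q x =>
       let: (q', s) := row_delta q (x (inord 0)) (x (inord 1)) (x (inord 2))
                                 (x (inord 3)) in
       (q', [ffun i : 'I_4 => nth (None, MoveN) s i])).

Definition cfg (q : ctl Q) (t0 t1 t2 t3 : ftape) : config row_TM :=
  @Config _ row_TM q [ffun i : 'I_4 => nth t0 [:: t0; t1; t2; t3] i].

Let wm (a : cell * move) (t : ftape) : ftape := write_move a.1 a.2 t.

Lemma step_cfg q t0 t1 t2 t3 :
  (if q is Halt _ then false else true) ->
  step (cfg q t0 t1 t2 t3) =
  let: (q', s) := row_delta q (scanned t0) (scanned t1) (scanned t2)
                            (scanned t3) in
  cfg q' (wm (nth (None, MoveN) s 0) t0) (wm (nth (None, MoveN) s 1) t1)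
         (wm (nth (None, MoveN) s 2) t2) (wm (nth (None, MoveN) s 3) t3).
Proof.
move=> hq; rewrite /step /=.
have -> : (if q is Halt b then Some b else None) = None by case: (q) hq.
rewrite !ffunE !inordK //=.
case: (row_delta _ _ _ _ _) => q' s.
congr Config; apply/ffunP => i; rewrite !ffunE /=.
by case: i => [[|[|[|[|i]]]] hi].
Qed.

Definition reach (n : nat) (c c' : config row_TM) :=
  exists2 k, k <= n & iter k (@step _ row_TM) c = c'.

Definition halts (n : nat) (c : config row_TM) (b : bool) :=
  exists2 k, k <= n & verdict (cstate (iter k (@step _ row_TM) c)) = Some b.

(** Gives a pass that either goes on or rejects a single time bound for both outcomes. *)
Definition proceeds (n : nat) (c : config row_TM) (ok : bool) c' :=
  if ok then reach n c c' else halts n c false.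

Lemma reach0 n c : reach n c c.
Proof. by exists 0. Qed.

Lemma reach_trans n m c1 c2 c3 :
  reach n c1 c2 -> reach m c2 c3 -> reach (n + m) c1 c3.
Proof.
move=> [k kn <-] [l lm <-]; exists (l + k); first by lia.
by rewrite iterD.
Qed.

Lemma reach_halts n m c1 c2 b :
  reach n c1 c2 -> halts m c2 b -> halts (n + m) c1 b.
Proof.
move=> [k kn <-] [l lm h]; exists (l + k); first by lia.
by rewrite iterD.
Qed.

Lemma reach_proceeds n m c1 c2 ok c3 :
  reach n c1 c2 -> proceeds m c2 ok c3 -> proceeds (n + m) c1 ok c3.
Proof. by case: ok => /=; [exact: reach_trans | exact: reach_halts]. Qed.

Lemma reach_step n c c' : reach n (step c) c' -> reach n.+1 c c'.
Proof. by move=> [k kn <-]; exists k.+1 => //; rewrite iterSr. Qed.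

Lemma halts_step n c b : halts n (step c) b -> halts n.+1 c b.
Proof. by move=> [k kn h]; exists k.+1 => //; rewrite iterSr. Qed.

Lemma proceeds_step n c ok c' : proceeds n (step c) ok c' -> proceeds n.+1 c ok c'.
Proof. by case: ok; [exact: reach_step | exact: halts_step]. Qed.

Lemma halts_cfg n b t0 t1 t2 t3 : halts n (cfg (Halt b) t0 t1 t2 t3) b.
Proof. by exists 0. Qed.

Lemma reach_le n m c c' : n <= m -> reach n c c' -> reach m c c'.
Proof. by move=> nm [k kn <-]; exists k => //; apply: leq_trans nm. Qed.

Lemma halts_le n m c b : n <= m -> halts n c b -> halts m c b.
Proof. by move=> nm [k kn h]; exists k => //; apply: leq_trans nm. Qed.

Lemma proceeds_le n m c ok c' : n <= m -> proceeds n c ok c' -> proceeds m c ok c'.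
Proof. by case: ok => /=; [exact: reach_le | exact: halts_le]. Qed.

Lemma halts_outcome n m u b :
  halts n (init row_TM u) b -> n <= m -> outcome row_TM m u = Some b.
Proof.
move=> [k kn hk] nm; rewrite /outcome.
have {nm} km : k <= m by apply: leq_trans nm.
rewrite -(subnK km) iterD; elim: (m - k) => [|j IHj]; first exact: hk.
by rewrite iterS (step_halted IHj).
Qed.

(* The head scans the first cell of [r]; [l] lists the cells to its left,
   nearest first. *)
Definition ztape (l r : seq cell) : ftape := Tape l (head None r) (behead r).

Lemma wmN (t : ftape) : wm (scanned t, MoveN) t = t.
Proof. by case: t. Qed.

Definition pair_ok (q : Q) (r s : seq B) : bool :=
  (size r == size s) &&
  acc (foldl (fun q (ac : B * B) => dl q ac.1 ac.2) q (zip r s)).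

Definition enc_row (r : seq B) : seq (option B) := rcons (map some r) None.
Definition enc_rows (rs : seq (seq B)) : seq (option B) := flatten (map enc_row rs).

Notation cells := (map row_cell).

Ltac tm := (apply: reach_step || apply: proceeds_step || apply: halts_step);
  rewrite step_cfg //= ?wmN.

Let Mk : cell := row_cell None.

Arguments enc_row : simpl never.

Lemma enc_row_cons x r : enc_row (x :: r) = Some x :: enc_row r.
Proof. by []. Qed.

(** The content [c] of tape 2 need not split into rows: the second row is discovered by the run,
    which also rejects when the two terminators are not met together. Hence the failing case
    excludes every possible first row of [c], and the other case exhibits it. *)
Lemma run_row m q t0 t3 la lc r ra (c : seq (option B)) :
  let A := ztape la (cells (enc_row r) ++ ra) in
  let C := ztape lc (cells c ++ [:: None]) in
  halts (size r).+1 (cfg (Run m q) t0 A C t3) false /\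
    (forall s c', c = enc_row s ++ c' -> ~~ pair_ok q r s) \/
  exists s c', [/\ c = enc_row s ++ c', pair_ok q r s &
    reach (size r).+1 (cfg (Run m q) t0 A C t3)
    (cfg (run_next m) t0
         (wm (Mk, run_move m) (ztape (rev (cells (map some r)) ++ la) (Mk :: ra)))
         (ztape (rev (cells (enc_row s)) ++ lc) (cells c' ++ [:: None])) t3)].
Proof.
elim: r q la lc c => [|x r IHr] q la lc c A C; rewrite {}/A {}/C.
  case: c => [|[y|] c].
  - left; split=> [|[|y s] c'] //; tm; exact: halts_cfg.
  - left; split=> [|[|z s] c'] //; tm; exact: halts_cfg.
  case: (boolP (acc q)) => hq.
    right; exists [::], c; split=> //.
    by tm; rewrite hq /= ?wmN; exact: reach0.
  left; split=> [|[|y s] c'] //; tm.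
  by rewrite (negbTE hq) /= !wmN; exact: halts_cfg.
rewrite enc_row_cons.
case: c => [|[y|] c].
- left; split=> [|[|z s] c'] //; tm; exact: halts_cfg.
- have [[h hn]|[s [c' [-> hp h]]]] := IHr (dl q x y) (row_cell (Some x) :: la)
    (row_cell (Some y) :: lc) c.
    left; split; first by tm; exact: h.
    by case=> [|z s] c' //; rewrite enc_row_cons => -[<- /hn].
  right; exists (y :: s), c'; split=> //.
  tm; rewrite ?enc_row_cons ?map_cons !rev_cons !(@cat_rcons cell).
  exact: h.
- left; split=> [|[|z s] c'] //; tm; exact: halts_cfg.
Qed.

(* [v] is the input not yet consumed, [e] whether its end has been seen. *)
Fixpoint adj_ok f e (r : seq B) (rs : seq (seq B)) (v : seq Sigma) : bool :=
  if rs is s :: rs' then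
    pair_ok (q0 f (ohead v)) r s && adj_ok false (ohead v == None) s rs' (behead v)
  else e.

Definition wtape l (v : seq Sigma) : ftape := ztape l (map word_cell v).

Lemma enc_rows_cons r rs : enc_rows (r :: rs) = enc_row r ++ enc_rows rs.
Proof. by []. Qed.

Lemma size_enc_row r : size (enc_row r) = (size r).+1.
Proof. by rewrite size_rcons size_map. Qed.

Lemma rev_enc_row r : rev (cells (enc_row r)) = Mk :: rev (cells (map some r)).
Proof. by rewrite /enc_row map_rcons rev_rcons. Qed.

Lemma enc_row_partial s c pt : enc_row s ++ c = map some pt -> False.
Proof. by elim: s pt => [|x s IHs] [|y pt] //= -[_ /IHs]. Qed.

Lemma enc_row_inj r s c c' : enc_row r ++ c = enc_row s ++ c' -> r = s /\ c = c'.
Proof.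
elim: r s => [|x r IHr] [|y s] //=; first by case.
by case=> -> /IHr[-> ->].
Qed.

Lemma step_adj_row f e t0 tA lc x R lw v :
  step (cfg (AdjRow f e) t0 tA (ztape lc (row_cell x :: R)) (wtape lw v)) =
  cfg (Run (Some (ohead v == None)) (q0 f (ohead v))) t0 tA
      (ztape lc (row_cell x :: R))
      (wtape (head None (map word_cell v) :: lw) (behead v)).
Proof.
rewrite step_cfg //=.
have -> : cell_word (head None (map word_cell v)) = ohead v by case: v.
by rewrite !wmN; case: v.
Qed.

(** Tape 2 is one row ahead of tape 1. A row costs one step to choose the state and its length with
    terminator to run, which is at most twice its length on the tape. An unterminated tail [pt] is
    rejected because no complete row can be read from it. *)
Lemma adj_rows f e t0 la lc lw r rs v pt :
  let A := ztape la (cells (enc_rows (r :: rs) ++ map some pt) ++ [:: None]) in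
  let C := ztape lc (cells (enc_rows rs ++ map some pt) ++ [:: None]) in
  let W := wtape lw v in
  let n := (2 * size (enc_rows (r :: rs)))%N in
  (adj_ok f e r rs v && nilp pt = false /\
     halts n (cfg (AdjRow f e) t0 A C W) false) \/
  (adj_ok f e r rs v && nilp pt /\ exists f' W' rs1 rl,
    r :: rs = rcons rs1 rl /\
   reach n (cfg (AdjRow f e) t0 A C W)
     (cfg (AdjRow f' true) t0
        (ztape (rev (cells (enc_rows rs1)) ++ la) (cells (enc_row rl) ++ [:: None]))
        (ztape (rev (cells (enc_rows rs)) ++ lc) [:: None]) W')).
Proof.
rewrite /=.
elim: rs f e la lc lw r v => [|s rs IHrs] f e la lc lw r v.
  have [->|pt0] := eqVneq pt [::].
    case: e.
      right; split=> //; exists f, (wtape lw v), [::], r; split=> //.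
      by rewrite /enc_rows /= !cats0; apply: (@reach_le 0) => //; exact: reach0.
    left; split=> //.
    have -> : (2 * size (enc_rows [:: r]) = (2 * size r).+2)%N.
      by rewrite enc_rows_cons size_cat size_enc_row /=; lia.
    by tm; exact: halts_cfg.
  left; split; first by rewrite /nilp size_eq0 (negbTE pt0) andbF.
  apply: (@halts_le (size r).+2).
    by rewrite enc_rows_cons size_cat size_enc_row; lia.
  case: pt pt0 => // p pt _.
  apply: halts_step; rewrite step_adj_row enc_rows_cons !map_cat -!catA.
  have [[h _]|[s [c' []]]] := run_row (Some (ohead v == None)) (q0 f (ohead v)) t0
     (wtape (head None (map word_cell v) :: lw) (behead v)) la lc r
     (cells (map some (p :: pt)) ++ [:: None]) (map some (p :: pt)).
    exact: h.
  by move/esym/enc_row_partial.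
have hn : (2 * size (enc_rows (r :: s :: rs)) =
    (size r).+2 + size r + 2 * size (enc_rows (s :: rs)))%N.
  by rewrite enc_rows_cons size_cat size_enc_row; lia.
have step1 : step (cfg (AdjRow f e) t0
     (ztape la (cells (enc_rows (r :: s :: rs) ++ map some pt) ++ [:: None]))
     (ztape lc (cells (enc_rows (s :: rs) ++ map some pt) ++ [:: None])) (wtape lw v)) = 
  cfg (Run (Some (ohead v == None)) (q0 f (ohead v))) t0 
   (ztape la (cells (enc_row r) ++
              (cells (enc_rows (s :: rs) ++ map some pt) ++ [:: None])))
   (ztape lc (cells (enc_rows (s :: rs) ++ map some pt) ++ [:: None]))
   (wtape (head None (map word_cell v) :: lw) (behead v)).
  have -> : cells (enc_rows (r :: s :: rs) ++ map some pt) ++ [:: None] =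
      cells (enc_row r) ++ (cells (enc_rows (s :: rs) ++ map some pt) ++ [:: None]).
    by rewrite enc_rows_cons -catA map_cat -catA.
  have [x [R ->]] : exists x R,
      cells (enc_rows (s :: rs) ++ map some pt) ++ [:: None] = row_cell x :: R.
    by case: (s) => [|y s0]; eexists; eexists.
  exact: step_adj_row.
have [[h hno]|[s' [c' [eqc hp h]]]] := run_row (Some (ohead v == None)) (q0 f (ohead v)) t0
     (wtape (head None (map word_cell v) :: lw) (behead v)) la lc r
     (cells (enc_rows (s :: rs) ++ map some pt) ++ [:: None])
     (enc_rows (s :: rs) ++ map some pt).
  left; split.
    rewrite /= (negbTE (hno s (enc_rows rs ++ map some pt) _)) //.
    by rewrite enc_rows_cons catA.
  apply: (@halts_le (size r).+2); first by lia.
  by apply: halts_step; rewrite step1.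
have [es ec] : s' = s /\ c' = enc_rows rs ++ map some pt.
  by apply: (@enc_row_inj _ _ c'); rewrite -eqc enc_rows_cons catA.
subst s' c'.
have {}h : reach (size r).+2 (cfg (AdjRow f e) t0
     (ztape la (cells (enc_rows (r :: s :: rs) ++ map some pt) ++ [:: None]))
     (ztape lc (cells (enc_rows (s :: rs) ++ map some pt) ++ [:: None])) (wtape lw v))
   (cfg (AdjRow false (ohead v == None)) t0
     (ztape (rev (cells (enc_row r)) ++ la)
            (cells (enc_rows (s :: rs) ++ map some pt) ++ [:: None]))
     (ztape (rev (cells (enc_row s)) ++ lc)
            (cells (enc_rows rs ++ map some pt) ++ [:: None]))
     (wtape (head None (map word_cell v) :: lw) (behead v))).
  apply: reach_step; rewrite step1; move: h.
  by rewrite (rev_enc_row r).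
have [[hf h']|[ht [f' [W' [rs1 [rl [erl h']]]]]]] := IHrs false (ohead v == None)
  (rev (cells (enc_row r)) ++ la) (rev (cells (enc_row s)) ++ lc)
  (head None (map word_cell v) :: lw) s (behead v).
  left; split; first by rewrite /= hp.
  apply: (@halts_le ((size r).+2 + 2 * size (enc_rows (s :: rs)))); first by lia.
  exact: reach_halts h h'.
right; split; first by rewrite /= hp.
exists f', W', (r :: rs1), rl; split; first by rewrite erl.
apply: (@reach_le ((size r).+2 + 2 * size (enc_rows (s :: rs)))); first by lia.
apply: reach_trans h _; move: h'.
by rewrite !enc_rows_cons !map_cat !rev_cat -!catA.
Qed.

Lemma rewind_A t0 t2 t3 c x R :
  reach (size c).+1
    (cfg RewA t0 (wm (x, MoveL) (ztape (rev (cells c) ++ [:: None]) (x :: R))) t2 t3)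
    (cfg (RewC false) t0 (ztape [:: None] (cells c ++ x :: R))
         (wm (scanned t2, MoveL) t2) t3).
Proof.
elim/last_ind: c x R => [|c y IHc] x R.
  by tm; exact: reach0.
rewrite size_rcons map_rcons rev_rcons cat_rcons.
by tm; exact: IHc.
Qed.

Lemma rewind_C b t0 t1 t3 c x R :
  reach (size c).+1
    (cfg (RewC b) t0 t1 (wm (x, MoveL) (ztape (rev (cells c) ++ [:: None]) (x :: R))) t3)
    (cfg (if b then SkipA else Row) t0 t1 (ztape [:: None] (cells c ++ x :: R)) t3).
Proof.
elim/last_ind: c x R => [|c y IHc] x R.
  by tm; exact: reach0.
rewrite size_rcons map_rcons rev_rcons cat_rcons.
by tm; exact: IHc.
Qed.

(** The rewinding pass recognises the start of a row only by the cell before it: the terminator of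
    the previous row, or the blank before the first row. *)
Definition row_boundary (l : seq cell) : bool :=
  if l is x :: _ then (x == None) || (x == Mk) else false.

Lemma rewind_row t0 t2 t3 la r x R : row_boundary la ->
  reach (size r).+1
    (cfg RewRow t0 (wm (x, MoveL) (ztape (rev (cells (map some r)) ++ la) (x :: R))) t2 t3)
    (cfg Row t0 (ztape la (cells (map some r) ++ x :: R)) t2 t3).
Proof.
case: la => //= y la hy; elim/last_ind: r x R => [|r z IHr] x R.
  by move: hy => /orP[] /eqP->; tm; exact: reach0.
rewrite size_rcons !map_rcons rev_rcons cat_rcons.
by tm; exact: IHr.
Qed.

Lemma skip_row t0 t2 t3 la r R :
  reach (size r).+1
    (cfg SkipA t0 (ztape la (cells (enc_row r) ++ R)) t2 t3)
    (cfg Row t0 (ztape (rev (cells (enc_row r)) ++ la) R) t2 t3).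
Proof.
elim: r la => [|x r IHr] la; first by tm; exact: reach0.
have := IHr (row_cell (Some x) :: la); rewrite -(@cat_rcons cell) -rev_cons => h.
by tm; exact: h.
Qed.

Lemma row_against_rows t0 t3 la lc r R ss : row_boundary la ->
  proceeds (4 * size (enc_rows ss) + size r + 2)
    (cfg Row t0 (ztape la (cells (enc_row r) ++ R))
         (ztape lc (cells (enc_rows ss) ++ [:: None])) t3)
    (all (pair_ok q1 r) ss)
    (cfg Row t0 (ztape la (cells (enc_row r) ++ R))
         (ztape (rev (cells (enc_rows ss)) ++ lc) [:: None]) t3).
Proof.
move=> hla; elim: ss lc => [|s ss IHss] lc.
  by apply: (@reach_le 0) => //; exact: reach0.
have step1 : step (cfg Row t0 (ztape la (cells (enc_row r) ++ R))
         (ztape lc (cells (enc_rows (s :: ss)) ++ [:: None])) t3) =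
   cfg (Run None q1) t0 (ztape la (cells (enc_row r) ++ R))
         (ztape lc (cells (enc_rows (s :: ss)) ++ [:: None])) t3.
  by case: (r) => [|x r']; case: (s) => [|y s']; rewrite step_cfg //= !wmN.
have [[h hno]|[s' [c' [eqc hp h]]]] :=
   run_row None q1 t0 t3 la lc r R (enc_rows (s :: ss)).
  have /negbTE hps := hno s (enc_rows ss) (enc_rows_cons s ss).
  rewrite /= hps; apply: (@halts_le (size r).+2); first by lia.
  by apply: halts_step; rewrite step1.
have [es ec] : s' = s /\ c' = enc_rows ss.
  by apply: (@enc_row_inj _ _ c'); rewrite -eqc enc_rows_cons.
subst s' c'.
(* Rows that pass have equal length, so the run and the rewinding of [r] can be charged to [s]. Only
   a failing run, which happens at most once, is paid by the summand [size r + 2]. *)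
have hrs : size r = size s by case/andP: hp => /eqP.
rewrite [all _ _]/= hp.
apply: (@proceeds_le ((size r).+2 + (size r).+1 + (4 * size (enc_rows ss) + size r + 2))).
  by rewrite enc_rows_cons size_cat size_enc_row; lia.
apply: (@reach_proceeds _ _ _ (cfg Row t0 (ztape la (cells (enc_row r) ++ R))
     (ztape (rev (cells (enc_row s)) ++ lc) (cells (enc_rows ss) ++ [:: None])) t3)).
  apply: reach_trans; first by apply: reach_step; rewrite step1; exact: h.
  have := rewind_row t0
    (ztape (rev (cells (enc_row s)) ++ lc) (cells (enc_rows ss) ++ [:: None]))
    t3 r Mk R hla.
  by rewrite [enc_row r]/enc_row map_rcons cat_rcons.
have := IHss (rev (cells (enc_row s)) ++ lc).
by rewrite enc_rows_cons map_cat rev_cat -catA.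
Qed.

Lemma all_pairs t0 t3 la rows rs : row_boundary la ->
  halts (size (enc_rows rs) * (5 * size (enc_rows rows) + 7) + 1)
    (cfg Row t0 (ztape la (cells (enc_rows rs) ++ [:: None]))
         (ztape [:: None] (cells (enc_rows rows) ++ [:: None])) t3)
    (all (fun r => all (pair_ok q1 r) rows) rs).
Proof.
elim: rs la => [|r rs IHrs] la hla.
  by tm; exact: halts_cfg.
set L := size (enc_rows rows).
have := row_against_rows t0 t3 [:: None] r (cells (enc_rows rs) ++ [:: None]) rows hla.
have -> : cells (enc_rows (r :: rs)) ++ [:: None] =
    cells (enc_row r) ++ cells (enc_rows rs) ++ [:: None].
  by rewrite enc_rows_cons map_cat -catA.
rewrite [all _ (r :: rs)]/=; case: (all _ rows) => /= h; last first.
  by apply: halts_le h; rewrite enc_rows_cons size_cat size_enc_row -/L; nia.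
apply: (@halts_le (4 * L + size r + 2 + L.+2 + (size r).+1 +
    (size (enc_rows rs) * (5 * L + 7) + 1))).
  by rewrite enc_rows_cons size_cat size_enc_row -/L; nia.
apply: reach_halts (IHrs (rev (cells (enc_row r)) ++ la) _); last first.
  by rewrite rev_enc_row /= ?eqxx ?orbT.
apply: reach_trans (skip_row _ _ _ _ _ _).
apply: reach_trans h _.
apply: reach_step.
have -> : step (cfg Row t0
     (ztape la (cells (enc_row r) ++ cells (enc_rows rs) ++ [:: None]))
   (ztape (rev (cells (enc_rows rows)) ++ [:: None]) [:: None]) t3) =
   cfg (RewC true) t0 (ztape la (cells (enc_row r) ++ cells (enc_rows rs) ++ [:: None]))
     (wm (None, MoveL) (ztape (rev (cells (enc_rows rows)) ++ [:: None]) [:: None])) t3.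
  by case: (r) => [|x r']; rewrite step_cfg //= !wmN.
exact: rewind_C.
Qed.

Definition row_check (v : seq Sigma) (rows : seq (seq B)) : bool :=
  if rows is r :: rs then
    adj_ok true false r rs v && all (fun r => all (pair_ok q1 r) rows) rows
  else false.

(** The machine must also halt on certificates that are not lists of rows. This normal form,
    complete rows and an unterminated tail, covers all of them. *)
Lemma enc_rowsP (c : seq (option B)) :
  exists rows pt, c = enc_rows rows ++ map some pt.
Proof.
elim: c => [|x c [rows [pt ->]]]; first by exists [::], [::].
case: x => [x|]; last by exists ([::] :: rows), pt.
case: rows => [|r rows]; first by exists [::], (x :: pt).
by exists ((x :: r) :: rows), pt.
Qed.

Lemma enc_rows_inj rows rows' pt :
  enc_rows rows ++ map some pt = enc_rows rows' -> rows = rows' /\ pt = [::].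
Proof.
elim: rows rows' => [|r rows IHrows] [|r' rows'].
- by case: pt.
- by rewrite enc_rows_cons => /esym/enc_row_partial.
- by case: r.
- by rewrite !enc_rows_cons -catA => /enc_row_inj[-> /IHrows[-> ->]].
Qed.

Lemma skip_first t0 t1 t3 lc r R :
  reach (size r).+1
    (cfg SkipC t0 t1 (ztape lc (cells (enc_row r) ++ R)) t3)
    (cfg (AdjRow true false) t0 t1 (ztape (rev (cells (enc_row r)) ++ lc) R) t3).
Proof.
elim: r lc => [|x r IHr] lc; first by tm; exact: reach0.
have := IHr (row_cell (Some x) :: lc); rewrite -(@cat_rcons cell) -rev_cons => h.
by tm; exact: h.
Qed.

Lemma skip_partial t0 t1 t3 lc pt :
  halts (size pt).+1
    (cfg SkipC t0 t1 (ztape lc (cells (map some pt) ++ [:: None])) t3) false.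
Proof.
elim: pt lc => [|x pt IHpt] lc; first by tm; exact: halts_cfg.
by tm; exact: IHpt.
Qed.

Lemma check_rows t0 v c :
  exists2 b : bool,
    halts (5 * size c * size c + 20 * size c + 20)
      (cfg SkipC t0 (ztape [:: None] (cells c ++ [:: None]))
         (ztape [:: None] (cells c ++ [:: None])) (wtape [:: None] v)) b &
    b <-> exists2 rows, c = enc_rows rows & row_check v rows.
Proof.
have [[|r rs] [pt ec]] := enc_rowsP c; subst c.
  exists false.
    rewrite /= size_map; apply: halts_le (skip_partial _ _ _ _ _); lia.
  split=> // -[[|r rows] //] /esym; rewrite enc_rows_cons.
  by move/enc_row_partial.
set c := enc_rows (r :: rs) ++ _.
have szc : size c = size (enc_rows (r :: rs)) + size pt.
  by rewrite size_cat size_map.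
have szr : size (enc_rows (r :: rs)) = (size r).+1 + size (enc_rows rs).
  by rewrite enc_rows_cons size_cat size_enc_row.
have h1 : reach (size r).+1
  (cfg SkipC t0 (ztape [:: None] (cells c ++ [:: None]))
         (ztape [:: None] (cells c ++ [:: None])) (wtape [:: None] v))
  (cfg (AdjRow true false) t0 (ztape [:: None] (cells c ++ [:: None]))
         (ztape (rev (cells (enc_row r)) ++ [:: None])
            (cells (enc_rows rs ++ map some pt) ++ [:: None])) (wtape [:: None] v)).
  have := skip_first t0 (ztape [:: None] (cells c ++ [:: None])) (wtape [:: None] v)
    [:: None] r (cells (enc_rows rs ++ map some pt) ++ [:: None]).
  by rewrite catA -map_cat catA -enc_rows_cons.
have [[hok h2]|[hok [f' [W' [rs1 [rl [erl h2]]]]]]] :=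
  adj_rows true false t0 [:: None] (rev (cells (enc_row r)) ++ [:: None])
    [:: None] r rs v pt.
  exists false.
    apply: halts_le (reach_halts h1 h2); rewrite szc szr; nia.
  split=> // -[rows /enc_rows_inj[<- pt0]].
  by move: hok; rewrite pt0 andbT => /= ->.
have {hok} [hok /nilP pt0] := andP hok.
exists (all (fun r0 => all (pair_ok q1 r0) (r :: rs)) (r :: rs)); last first.
  split=> [hall|[rows /enc_rows_inj[<- _]]].
    by exists (r :: rs); [rewrite /c pt0 cats0 | rewrite /row_check hok].
  by case/andP.
have ec : c = enc_rows (r :: rs) by rewrite /c pt0 cats0.
have h3 : reach (size (enc_rows rs1)).+2
   (cfg (AdjRow f' true) t0
        (ztape (rev (cells (enc_rows rs1)) ++ [:: None])
               (cells (enc_row rl) ++ [:: None]))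
        (ztape (rev (cells (enc_rows rs)) ++ rev (cells (enc_row r)) ++ [:: None])
               [:: None]) W')
   (cfg (RewC false) t0 (ztape [:: None] (cells c ++ [:: None]))
     (wm (None, MoveL) (ztape (rev (cells c) ++ [:: None]) [:: None])) W').
  have [x [R eR]] : exists x R, cells (enc_row rl) ++ [:: None] = x :: R.
    by case: (rl) => [|y s]; eexists; eexists.
  have -> : cells c ++ [:: None] = cells (enc_rows rs1) ++ x :: R.
    rewrite -eR ec erl /enc_rows map_rcons flatten_rcons map_cat -catA.
    by [].  
  have -> : rev (cells c) ++ [:: None] =
      rev (cells (enc_rows rs)) ++ rev (cells (enc_row r)) ++ [:: None].
    by rewrite ec enc_rows_cons map_cat rev_cat -catA.
  rewrite eR; apply: reach_step; rewrite step_cfg //= !wmN.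
  exact: rewind_A.
have h4 := rewind_C false t0 (ztape [:: None] (cells c ++ [:: None])) W' c None [::].
have h5 := @all_pairs t0 W' [:: None] (r :: rs) (r :: rs) isT.
rewrite -ec in h5.
have szrs1 : size (enc_rows rs1) <= size c.
  by rewrite ec erl /enc_rows map_rcons flatten_rcons size_cat leq_addr.
apply: halts_le
  (reach_halts h1 (reach_halts h2 (reach_halts h3 (reach_halts h4 h5)))).
rewrite ec in szrs1 *; rewrite ec in szc; nia.
Qed.

Let incell (x : input) : cell := Some (inl x).

Lemma copy_word t1 t2 u l0 v :
  (exists w y l1, u = map (some \o inl) w ++ None :: y /\
    reach (size w).+1
      (cfg CopyW (ztape l0 (map incell u)) t1 t2 (ztape [::] (None :: map word_cell v)))
      (cfg CopyY (ztape l1 (map incell y)) t1 t2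
         (ztape [::] (None :: map word_cell (rev w ++ v))))) \/
  (forall w y, u <> map (some \o inl) w ++ None :: y) /\
    halts (size u).+1
      (cfg CopyW (ztape l0 (map incell u)) t1 t2 (ztape [::] (None :: map word_cell v)))
      false.
Proof.
elim: u l0 v => [|x u IHu] l0 v.
  right; split; first by case.
  by tm; exact: halts_cfg.
case: x => [[a|d]|].
- have [[w [y [l1 [-> h]]]]|[hn h]] := IHu (incell (Some (inl a)) :: l0) (a :: v).
    left; exists (a :: w), y, l1; split=> //.
    by rewrite rev_cons cat_rcons; tm; exact: h.
  right; split; first by case=> [|b w] y // [_ /hn].
  by tm; exact: h.
- right; split; first by case.
  by tm; exact: halts_cfg.
- left; exists [::], u, (incell None :: l0); split=> //.
  by tm; exact: reach0.
Qed.

Lemma copy_rows t3 u l0 z :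
  let T z := ztape [::] (None :: cells z ++ [:: None]) in
  (exists y t0, u = map (some \o inr) y /\
    reach (size y).+1
      (cfg CopyY (ztape l0 (map incell u)) (T z) (T z) t3)
      (cfg SkipC t0 (ztape [:: None] (cells (rev y ++ z) ++ [:: None]))
         (ztape [:: None] (cells (rev y ++ z) ++ [:: None]))
         (wm (scanned t3, MoveR) t3))) \/
  (forall y, u <> map (some \o inr) y) /\
    halts (size u).+1 (cfg CopyY (ztape l0 (map incell u)) (T z) (T z) t3) false.
Proof.
move=> T; rewrite {}/T; elim: u l0 z => [|x u IHu] l0 z.
  left; exists [::], (wm (None, MoveN) (ztape l0 [::])); split=> //.
  by tm; exact: reach0.
case: x => [[a|d]|].
- right; split; first by case.
  by tm; exact: halts_cfg.
- have [[y [t0 [-> h]]]|[hn h]] := IHu (incell (Some (inr d)) :: l0) (d :: z).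
    left; exists (d :: y), t0; split=> //.
    by rewrite rev_cons cat_rcons; tm; exact: h.
  right; split; first by case=> [|b y] // [_ /hn].
  by tm; exact: h.
- right; split; first by case.
  by tm; exact: halts_cfg.
Qed.

Lemma pair_word_inj (w w' : seq Sigma) (y y' : seq (option B)) :
  pair_word w y = pair_word w' y' -> w = w' /\ y = y'.
Proof.
rewrite /pair_word; elim: w w' => [|a w IHw] [|a' w'] //=.
  by case=> /inj_map -> // d d' [].
by case=> -> /IHw[-> ->].
Qed.

(** Both words appear reversed because the machine copies them leftwards. For [w] this is the wanted
    order: the letter at index [i] of [rev w] extends the suffix of length [i] to the next one. *)
Definition row_verifier (w : seq Sigma) (y : seq (option B)) : Prop :=
  exists2 rows, rev y = enc_rows rows & row_check (rev w) rows.

Theorem row_verifier_inP : inP (pair_language row_verifier).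
Proof.
(* After copying, a certificate of length [l] takes at most [5 * l * l + 20 * l + 20] steps; the
   constant 60 generously absorbs this and the two copying passes. *)
exists row_TM, 60, 2 => u.
pose T := ztape [::] [:: None; None].
have h0 : step (init row_TM u) =
    cfg CopyW (ztape [::] (map incell u)) T T (ztape [::] [:: None]).
  have -> : init row_TM u = cfg Start (ztape [::] (map incell u))
      (blank_tape _) (blank_tape _) (blank_tape _).
    congr Config; apply/ffunP => i; rewrite !ffunE.
    case: i => [[|[|[|[|i]]]] hi] //=.
    by case: (u) => [|x u0] //=; congr Tape; rewrite -map_comp. 
  by rewrite step_cfg //= !wmN.
have [[w [u' [l1 [eu h1]]]]|[hn h1]] := copy_word T T u [::] [::]; last first.
  exists false; split.
    apply: (@halts_outcome (size u).+2); first by apply: halts_step; rewrite h0.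
    by rewrite /poly_bound; nia.
  by split=> // -[w [y [ew _]]]; case: (hn w (map (some \o inr) y)).
have szu : size u = (size w).+1 + size u'.
  by rewrite eu size_cat size_map /=; lia.
have [[y [t0 [ey h2]]]|[hn h2]] :=
   copy_rows (ztape [::] (None :: map word_cell (rev w ++ [::])))
   u' l1 [::]; last first.
  exists false; split.
    apply: (@halts_outcome ((size w).+1 + (size u').+1).+1).
      by apply: halts_step; rewrite h0; apply: reach_halts h1 h2.
    by rewrite /poly_bound; nia.
  split=> // -[w' [y' [ew _]]].
  have : pair_word w' y' = map (some \o inl) w ++ None :: u' by rewrite -ew -eu.
  rewrite /pair_word; elim: (w') (w) => [|a w1 IHw] [|a' w2] //=.
    by case=> /esym/hn.
  by case=> _ /IHw.
have [b h3 hb] := check_rows t0 (rev w) (rev y).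
have szy : size u' = size y by rewrite ey size_map.
exists b; split.
  set l := size (rev y) in h3.
  apply: (@halts_outcome
    ((size w).+1 + ((size y).+1 + (5 * l * l + 20 * l + 20))).+1).
    apply: halts_step; rewrite h0; apply: (reach_halts h1 (reach_halts h2 _)).
    by rewrite !cats0.
  by rewrite /poly_bound /l size_rev; nia.
split=> [/hb[rows e1 e2]|[w' [y' [e]]]].
  by exists w, y; split; [rewrite eu ey | exists rows].
have [<- <-] : w = w' /\ y = y' by apply: pair_word_inj; rewrite -e eu ey.
by case=> rows e1 e2; apply/hb; exists rows.
Qed.

End RowMachine.

(** * Regular conditions on rows of binary registers *)

Definition label : Type := nat -> nat.

Section Regular.
Variable K : nat.
Notation letter := (K.-tuple bool).

(* Least significant bit first. *)
Fixpoint row_val (r : seq letter) (k : nat) : nat :=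
  if r is b :: r' then (nth false b k + 2 * row_val r' k)%N else 0.

Lemma row_val_cons b r : row_val (b :: r) = fun k => (nth false b k + 2 * row_val r k)%N.
Proof. by []. Qed.

Definition run_dfa (Q : Type) (d : Q -> letter -> letter -> Q) (i : Q)
    (rs : seq (letter * letter)) : Q :=
  foldl (fun q ac => d q ac.1 ac.2) i rs.

Definition recognizes (Q : finType) (d : Q -> letter -> letter -> Q) (a : pred Q)
    (i : Q) (P : label -> label -> bool) : Prop :=
  forall r s : seq letter, size r = size s ->
    P (row_val r) (row_val s) = a (run_dfa d i (zip r s)).

Definition regular (P : label -> label -> bool) : Prop :=
  exists (Q : finType) (d : Q -> letter -> letter -> Q) (a : pred Q) (i : Q),
    recognizes d a i P.

Lemma regular_ext P P' : regular P -> (forall x y, P x y = P' x y) -> regular P'.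
Proof.
move=> [Q [d [a [i h]]]] e; exists Q, d, a, i => r s rs.
by rewrite -e; exact: h.
Qed.

Lemma regular_const b : regular (fun _ _ => b).
Proof. by exists unit, (fun _ _ _ => tt), (fun _ => b), tt => r s _. Qed.

Lemma regularN P : regular P -> regular (fun x y => ~~ P x y).
Proof.
move=> [Q [d [a [i h]]]]; exists Q, d, (fun q => ~~ a q), i => r s rs.
by rewrite h.
Qed.

Lemma regularI P P' : regular P -> regular P' -> regular (fun x y => P x y && P' x y).
Proof.
move=> [Q [d [a [i h]]]] [Q' [d' [a' [i' h']]]].
exists (Q * Q')%type, (fun q x y => (d q.1 x y, d' q.2 x y)),
  (fun q => a q.1 && a' q.2), (i, i') => r s rs.
rewrite h // h' //.
suff -> : run_dfa (fun q x y => (d q.1 x y, d' q.2 x y)) (i, i') (zip r s) =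
   (run_dfa d i (zip r s), run_dfa d' i' (zip r s)) by [].
by elim: (zip r s) i i' {h h'} => [|z zs IHz] i i' //=; rewrite -IHz.
Qed.

Lemma regularU P P' : regular P -> regular P' -> regular (fun x y => P x y || P' x y).
Proof.
move=> /regularN h /regularN h'; apply: regular_ext (regularN (regularI h h')) _.
by move=> x y; rewrite negb_and !negbK.
Qed.

Lemma regular_implb P P' :
  regular P -> regular P' -> regular (fun x y => P x y ==> P' x y).
Proof.
move=> /regularN h h'; apply: regular_ext (regularU h h') _.
by move=> x y; rewrite implybE.
Qed.

(** Terms whose binary digits are computed position by position without carry; these can be fed to
    the automata for addition and comparison. *)
Definition bit_term (f : label -> label -> nat) : Prop :=
  exists g : letter -> letter -> bool,
    f (row_val [::]) (row_val [::]) = 0%N /\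
    forall a c r s, f (row_val (a :: r)) (row_val (c :: s)) =
                    (g a c + 2 * f (row_val r) (row_val s))%N.

Lemma bit_term0 : bit_term (fun _ _ => 0%N).
Proof. by exists (fun _ _ => false). Qed.

Lemma bit_terml k : bit_term (fun x _ => x k).
Proof. by exists (fun a _ => nth false a k). Qed.

Lemma bit_termr k : bit_term (fun _ y => y k).
Proof. by exists (fun _ c => nth false c k). Qed.

(** Schoolbook addition from the least significant bit: the state holds the carries of both sides,
    which start as the constants [c] and [d]. At each position the parities must agree and the
    halves are carried on. *)
Lemma regular_linear f g h c d : bit_term f -> bit_term g -> bit_term h ->
  regular (fun x y => f x y + g x y + c == h x y + d)%N.
Proof.
move=> [f' [f0 fE]] [g' [g0 gE]] [h' [h0 hE]].
(* The map from [u] to the half of at most [u + 2] preserves [u <= c + 2], and the one from [v] to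
   the half of at most [v + 1] preserves [v <= d + 1], so the carries stay in these finite
   ranges. *)
pose Q : finType := option ('I_c.+3 * 'I_d.+2)%type.
pose dl (q : Q) x y : Q :=
  if q is Some (u, v) then
    let U := (f' x y + g' x y + u)%N in let V := (h' x y + v)%N in
    if odd U == odd V then Some (inord U./2, inord V./2) else None
  else None.
pose a (q : Q) := if q is Some (u, v) then u == v :> nat else false.
have none zs : a (run_dfa dl None zs) = false by elim: zs.
exists Q, dl, a, (Some (inord c, inord d)).
suff main r s (u : 'I_c.+3) (v : 'I_d.+2) : size r = size s ->
   (f (row_val r) (row_val s) + g (row_val r) (row_val s) + u ==
    h (row_val r) (row_val s) + v)%N = a (run_dfa dl (Some (u, v)) (zip r s)).
  by move=> r s rs; rewrite -main // !inordK //; lia.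
elim: r s u v => [|x r IHr] [|y s] u v //= => [_|[rs]].
  by rewrite f0 g0 h0.
rewrite fE gE hE [LHS](_ : _ = (if odd (f' x y + g' x y + u)%N == odd (h' x y + v)%N then
  (f (row_val r) (row_val s) + g (row_val r) (row_val s) + (f' x y + g' x y + u)./2 ==
    h (row_val r) (row_val s) + (h' x y + v)./2)%N else false)); last first.
  by case: ifP => hodd; lia.
case: ifP => // hodd.
rewrite -IHr // !inordK //; have := ltn_ord u; have := ltn_ord v;
  by case: (f' x y); case: (g' x y); case: (h' x y) => /=; lia.
Qed.

(** The state is the result of comparing the digits read so far; as later digits are more
    significant, a difference there overrides it and equality keeps it. *)
Lemma regular_le f g : bit_term f -> bit_term g ->
  regular (fun x y => f x y <= g x y)%N.
Proof.
move=> [f' [f0 fE]] [g' [g0 gE]].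
exists bool, (fun q x y => (f' x y < g' x y)%N || (f' x y == g' x y) && q), id, true.
suff main r s b : size r = size s ->
   (f (row_val r) (row_val s) + ~~ b <= g (row_val r) (row_val s))%N =
   run_dfa (fun q x y => (f' x y < g' x y)%N || (f' x y == g' x y) && q) b (zip r s).
  by move=> r s rs; rewrite -main // addn0.
elim: r s b => [|x r IHr] [|y s] b //= => [_|[rs]].
  by rewrite f0 g0; case: b.
rewrite fE gE -IHr //.
by case: (f' x y); case: (g' x y); case: b => /=; lia.
Qed.

Lemma regular_eq f g : bit_term f -> bit_term g -> regular (fun x y => f x y == g x y).
Proof.
move=> hf hg; apply: regular_ext (regular_linear 0 0 hf bit_term0 hg) _.
by move=> x y; rewrite !addn0.
Qed.

Lemma regular_eqc f c : bit_term f -> regular (fun x y => f x y == c).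
Proof.
move=> hf; apply: regular_ext (regular_linear 0 c hf bit_term0 bit_term0) _.
by move=> x y; rewrite !addn0 add0n.
Qed.

Lemma regular_mem f (cs : seq nat) : bit_term f -> regular (fun x y => f x y \in cs).
Proof.
move=> hf; elim: cs => [|c cs IHcs]; first exact: regular_const.
apply: regular_ext (regularU (regular_eqc c hf) IHcs) _.
by move=> x y; rewrite inE.
Qed.

Lemma regular_bool_eq P P' :
  regular P -> regular P' -> regular (fun x y => P x y == P' x y).
Proof.
move=> h h'; apply: regular_ext
  (regularU (regularI h h') (regularI (regularN h) (regularN h'))) _.
by move=> x y; case: (P x y); case: (P' x y).
Qed.

(** The machine has one transition function and one acceptance predicate for all its tests. The
    disjoint union of the automata provides them, and the test is selected by the initial state. *)
Lemma regular_family (T : finType) (P : T -> label -> label -> bool) :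
  (forall t, regular (P t)) ->
  exists (Q : finType) (d : Q -> letter -> letter -> Q) (a : pred Q) (i : T -> Q),
    forall t, recognizes d a (i t) (P t).
Proof.
pose dfa := {Q : finType & ((Q -> letter -> letter -> Q) * pred Q * Q)%type}.
move=> reg.
have /choice[D hD] : forall t, exists D : dfa,
    recognizes (projT2 D).1.1 (projT2 D).1.2 (projT2 D).2 (P t).
  by move=> t; have [Q [d [a [i h]]]] := reg t; exists (existT _ Q (d, a, i)).
pose Q : finType := {t : T & projT1 (D t)}.
pose dl (q : Q) x y : Q :=
  Tagged (fun t => projT1 (D t)) ((projT2 (D (tag q))).1.1 (tagged q) x y).
pose a (q : Q) := (projT2 (D (tag q))).1.2 (tagged q).
exists Q, dl, a, (fun t => Tagged (fun t => projT1 (D t)) (projT2 (D t)).2) => t r s rs.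
rewrite hD //; move: (projT2 (D t)).2.
by elim: (zip r s) => [|z zs IHz] q //=; rewrite IHz.
Qed.

Fixpoint row_of (N : nat) (x : label) : seq letter :=
  if N is N'.+1 then
    [tuple odd (x k) | k < K] :: row_of N' (fun k => (x k)./2)
  else [::].

Lemma size_row_of N x : size (row_of N x) = N.
Proof. by elim: N x => [|N IHN] x //=; rewrite IHN. Qed.

Lemma row_ofK N (x : label) :
  (forall k, x k < 2 ^ N)%N -> (forall k, K <= k -> x k = 0)%N ->
  row_val (row_of N x) = x.
Proof.
move=> xN xK; apply/funext => k; elim: N x xN xK k => [|N IHN] x xN xK k.
  by have := xN k; rewrite expn0 ltnS leqn0 => /eqP ->.
have h j : ((x j)./2 < 2 ^ N)%N by have := xN j; rewrite expnS; lia.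
rewrite [row_of _ _]/= row_val_cons IHN //; last by move=> j /xK ->.
have [kK|kK] := ltnP k K; last by rewrite nth_default ?size_tuple // xK.
by rewrite -[k]/(nat_of_ord (Ordinal kK)) -tnth_nth tnth_mktuple mul2n odd_double_half.
Qed.

End Regular.

(** * The check of the machine in terms of row indices *)

Section AdjIndex.
Variables (Sigma B Q : finType) (q0 : bool -> option Sigma -> Q) (q1 : Q).
Variables (dl : Q -> B -> B -> Q) (acc : pred Q).

Lemma onth_behead (T : Type) (v : seq T) i : onth (behead v) i = onth v i.+1.
Proof. by case: v; case: i. Qed.

(** The flag [e] is overwritten at each comparison, so it survives only if no row follows. Otherwise
    acceptance requires that the last comparison already finds the input exhausted, which is
    [size v < size rs]. *)
Lemma adj_okP f e r rs v :
  reflect ((forall i, i < size rs ->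
       pair_ok dl acc (q0 (f && (i == 0%N)) (onth v i)) (nth r (r :: rs) i) (nth r rs i))
     /\ (if nilp rs then e else size v < size rs)%N)
    (adj_ok q0 dl acc f e r rs v).
Proof.
elim: rs f e r v => [|s rs IHrs] f e r v.
  by apply: (iffP idP) => [h|[_ h]] //; split.
apply: (iffP andP) => [[h1 /IHrs[h2 h3]]|[h1 h2]].
  split; last by case: rs v h3 {IHrs h1 h2} => [|s' rs] [|y v].
  case=> [|i] hi; first by rewrite andbT; case: v h1 {h2 h3}.
  have := h2 i hi; rewrite onth_behead andbF.
  rewrite (set_nth_default r) //; first by rewrite [nth s rs i](set_nth_default r).
  exact: ltnW.
split; first by have := h1 0 isT; rewrite andbT; case: (v).
apply/IHrs; split; last by case: (rs) (v) h2 => [|s' rs'] [|y v'].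
move=> i hi; have := h1 i.+1 hi; rewrite onth_behead andbF.
rewrite [nth s (s :: rs) i](set_nth_default r) //; last exact: ltnW.
by rewrite [nth s rs i](set_nth_default r).
Qed.

Lemma row_checkP v rows :
  reflect [/\ ((size v).+1 < size rows)%N,
      forall i, i.+1 < size rows ->
       pair_ok dl acc (q0 (i == 0%N) (onth v i)) (nth [::] rows i) (nth [::] rows i.+1) &
      forall i j, i < size rows -> j < size rows ->
       pair_ok dl acc q1 (nth [::] rows i) (nth [::] rows j)]
    (row_check q0 q1 dl acc v rows).
Proof.
case: rows => [|r rs]; first by apply: (iffP idP) => // -[].
apply: (iffP andP) => [[/adj_okP[h1 h2] /allP h3]|[h1 h2 h3]].
  split=> [|i hi|i j hi hj].
  - by case: rs h2 {h1 h3}.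
  - have := h1 i hi; rewrite (set_nth_default [::]) //; last exact: ltnW.
    by rewrite [nth r rs i](set_nth_default [::]).
  - by apply: (allP (h3 _ (mem_nth _ hi))); rewrite mem_nth.
split; last first.
  apply/allP => s /(nthP [::])[i hi <-].
  by apply/allP => t /(nthP [::])[j hj <-]; exact: h3.
apply/adj_okP; split; last by case: (rs) h1.
move=> i hi; have := h2 i hi; rewrite (set_nth_default r) //; last exact: ltnW.
by rewrite [nth [::] (r :: rs) i.+1](set_nth_default r).
Qed.

End AdjIndex.

(** * From regular conditions on rows to membership in NP *)

Section LabelCriterion.
Variables (Sigma : finType) (K : nat).
Variables (Padj : bool -> option Sigma -> label -> label -> bool).
Variables (Pall : label -> label -> bool).

Definition labelled (w : seq Sigma) (m : nat) (x : nat -> label) : Prop :=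
  (forall i, i.+1 < m -> Padj (i == 0%N) (onth (rev w) i) (x i) (x i.+1)) /\
  (forall i j, i < m -> j < m -> Pall (x i) (x j)).

(** The machine verifies that the input ends before the rows do, but not where the rows stop.
    Soundness is therefore required for every admissible number [m] of rows, while completeness may
    use the smallest one, [(size w).+2]. *)
Theorem labelled_inNP (L : language Sigma) (c k : nat) :
  (forall f a, regular K (Padj f a)) -> regular K Pall ->
  (forall w m x, (size w).+1 < m -> labelled w m x -> L w) ->
  (forall w, L w -> exists2 x : nat -> label, labelled w (size w).+2 x &
     forall i, (i < (size w).+2)%N ->
       (forall j, x i j < 2 ^ (c * (size w).+2 ^ k))%N /\
       (forall j, K <= j -> x i j = 0)%N) ->
  inNP L.
Proof.
move=> regadj regall sound complete.
pose T : finType := option (bool * option Sigma)%type.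
pose P (t : T) := if t is Some (f, a) then Padj f a else Pall.
have [|Q [d [acc [i hrec]]]] := @regular_family K T P; first by case=> [[f a]|] /=.
exists (option (K.-tuple bool)).
exists (row_verifier (fun f a => i (Some (f, a))) (i None) d acc).
(* There are [(size w).+2] rows of [c * (size w).+2 ^ k] letters and a terminator. For nonempty [w]
   the base [(size w).+2] is at most three times [size w], whence the power of 3; the additive
   constant of [poly_bound] takes care of the empty word. *)
exists (c.+1 * 3 ^ k.+1)%N, k.+1; split; first exact: row_verifier_inP.
have pairE t r s : pair_ok d acc (i t) r s =
    (size r == size s) && P t (row_val r) (row_val s).
  by rewrite /pair_ok; case: eqP => //= rs; rewrite hrec.
move=> w; split=> [/complete[x [hadj hall] hx]|[y [_ [rows _]]]].
  set N := (c * (size w).+2 ^ k)%N in hx.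
  pose row j := row_of K N (x j).
  have rowK j : j < (size w).+2 -> row_val (row j) = x j.
    by move=> /hx[h1 h2]; rewrite row_ofK.
  pose rows := [seq row j | j <- iota 0 (size w).+2].
  have nthrow j : j < (size w).+2 -> nth [::] rows j = row j.
    by move=> hj; rewrite (nth_map 0) ?size_iota // nth_iota.
  have srow : size rows = (size w).+2 by rewrite size_map size_iota.
  exists (rev (enc_rows rows)); split.
    rewrite size_rev /enc_rows size_flatten /shape -!map_comp sumnE big_map.
    rewrite (eq_bigr (fun _ => N.+1)); last first.
      by move=> j _; rewrite /= size_enc_row size_row_of.
    rewrite big_const_seq count_predT size_iota iter_addn_0 /poly_bound.
    have h3 : ((size w).+2 ^ k.+1 <= 3 ^ k.+1 * ((size w) ^ k.+1).+1)%N.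
      case: (size w) => [|n]; first by rewrite exp0n // muln1 leq_exp2r.
      rewrite mulnS -expnMn; apply: leq_trans (leq_addl _ _).
      by rewrite leq_exp2r //; lia.
    have h4 : (N.+1 * (size w).+2 <= c.+1 * (size w).+2 ^ k.+1)%N.
      by rewrite expnSr mulnA leq_mul2r /= /N mulSn -add1n leq_add2r expn_gt0.
    by apply: leq_trans h4 _; rewrite addnC -mulnS -mulnA leq_mul2l h3 orbT.
  exists rows; first by rewrite revK.
  apply/row_checkP; rewrite srow size_rev; split=> // [j hj|j l hj hl].
    rewrite pairE !nthrow //; last exact: ltnW.
    by rewrite !size_row_of eqxx !rowK /= ?hadj //; exact: ltnW.
  by rewrite pairE !nthrow // !size_row_of eqxx !rowK //=; exact: hall.
move=> /row_checkP[h1 h2 h3].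
apply: (sound w (size rows) (fun j => row_val (nth [::] rows j))).
  by rewrite -(size_rev w).
split=> [j hj|j l hj hl].
  by have := h2 j hj; rewrite pairE => /andP[].
by have := h3 j l hj hl; rewrite pairE => /andP[].
Qed.

End LabelCriterion.

(** * Small integer solutions *)

Section IntegerPoints.
Local Open Scope ring_scope.

(** * Vertices of polyhedra *)

Section Vertex.
Variables (R : realFieldType) (n m : nat) (G : 'M[R]_(n, m)) (b : 'rV[R]_m).

Definition feasible (x : 'rV[R]_n) : Prop := forall j, b 0 j <= (x *m G) 0 j.

(** Columns of slack constraints are zeroed instead of removed, which keeps the dimensions fixed.
    The kernel consists of the directions along which all tight constraints stay tight. *)
Definition tight (x : 'rV[R]_n) : 'M[R]_(n, m) :=
  \matrix_(i, j) if (x *m G) 0 j == b 0 j then G i j else 0.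

Lemma mul_tight (x v : 'rV[R]_n) j :
  (v *m tight x) 0 j = if (x *m G) 0 j == b 0 j then (v *m G) 0 j else 0.
Proof.
rewrite !mxE; case: ifP => e.
  by apply: eq_bigr => i _; rewrite !mxE e.
by rewrite big1 // => i _; rewrite !mxE e mulr0.
Qed.

(** The ratio test of the simplex method: moving along a kernel direction [v] until the first slack
    constraint becomes tight keeps the tight ones tight, and [v] itself drops out of the kernel. *)
Lemma tight_step (x : 'rV[R]_n) : row_free G -> feasible x -> ~~ row_free (tight x) ->
  exists2 x', feasible x' & (\rank (kermx (tight x')) < \rank (kermx (tight x)))%N.
Proof.
move=> freeG fx; rewrite -kermx_eq0 => ker0.
have [v v0 vT] : exists2 v : 'rV_n, v != 0 & v *m tight x = 0.
  exists (nz_row (kermx (tight x))); first by rewrite nz_row_eq0.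
  by apply/sub_kermxP; exact: nz_row_sub.
have tight0 (u : 'rV_n) j : u *m tight x = 0 -> (x *m G) 0 j = b 0 j -> (u *m G) 0 j = 0.
  by move=> uT xj; have := mul_tight x u j; rewrite uT xj eqxx mxE.
(* Since [G] is row free, [v *m G] is nonzero, so [v] or its opposite decreases some constraint. The
   ray then leaves the polyhedron and the minimum ratio exists. *)
have [{v0} v {}vT [j0 vj0]] :
    exists2 v : 'rV_n, v *m tight x = 0 & exists j, (v *m G) 0 j < 0.
  have : v *m G != 0 by rewrite mulmx_free_eq0.
  move/rV0Pn => [j]; rewrite neq_lt => /orP[vj|vj]; first by exists v; [|exists j].
  by exists (- v); [rewrite mulNmx vT oppr0 | exists j; rewrite mulNmx mxE oppr_lt0].
pose P := [pred j | (v *m G) 0 j < 0].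
pose t j := ((x *m G) 0 j - b 0 j) / - (v *m G) 0 j.
have [k Pk tk] := @arg_minP _ _ _ j0 P t vj0.
have {j0 vj0 Pk} vk : (v *m G) 0 k < 0 := Pk.
have tk0 : 0 <= t k.
  by rewrite divr_ge0 ?subr_ge0 ?oppr_ge0 ?fx // ltW.
pose x' := x + t k *: v.
have x'E j : (x' *m G) 0 j = (x *m G) 0 j + t k * (v *m G) 0 j.
  by rewrite mulmxDl -scalemxAl !mxE.
exists x'.
  move=> j; rewrite x'E; have := fx j.
  have [vj|vj _] := leP 0 ((v *m G) 0 j); first by have := mulr_ge0 tk0 vj; lra.
  have := tk j vj; rewrite {2}/t ler_pdivlMr ?oppr_gt0 // => h; lra.
have x'k : (x' *m G) 0 k = b 0 k.
  by rewrite x'E /t; field; rewrite lt_eqF.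
apply: rank_ltmx; rewrite /ltmx; apply/andP; split.
  apply/rV_subP => u /sub_kermxP uT; apply/sub_kermxP/rowP => j.
  rewrite mul_tight [RHS]mxE; case: eqP => // xj.
  have := mul_tight x' u j; rewrite uT mxE x'E xj (tight0 v) //.
  by rewrite mulr0 addr0 eqxx.
apply/negP => /rV_subP /(_ v); rewrite (introT sub_kermxP vT) => /(_ isT).
move/sub_kermxP/rowP/(_ k); rewrite mul_tight x'k eqxx [X in _ = X -> _]mxE => e.
by rewrite e ltxx in vk.
Qed.

Lemma vertex (x : 'rV[R]_n) : row_free G -> feasible x ->
  exists x' (f : 'I_n -> 'I_m), [/\ feasible x', injective f,
    rowsub f G^T \in unitmx & forall i, (x' *m G) 0 (f i) = b 0 (f i)].
Proof.
move=> freeG; have [k] := ubnP (\rank (kermx (tight x))).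
elim: k x => // k IHk x rk fx.
have [free|nfree] := boolP (row_free (tight x)); last first.
  have [x' fx' lt] := tight_step freeG fx nfree.
  by apply: IHk fx'; apply: leq_trans lt _.
have full : row_full (tight x)^T by rewrite /row_full mxrank_tr.
pose f := fullrankfun full.
have unitT : rowsub f (tight x)^T \in unitmx := fullrowsub_unit full.
have tf i : (x *m G) 0 (f i) = b 0 (f i).
  (* A slack constraint would be a zero row of the invertible matrix [rowsub f (tight x)^T]. *)
  apply/eqP/negPn/negP => ne.
  have : row i (rowsub f (tight x)^T) = 0.
    by apply/rowP => j; do 3 rewrite mxE; rewrite mxE (negbTE ne) [RHS]mxE.
  move/(congr1 (mulmx^~ (invmx (rowsub f (tight x)^T)))).
  rewrite -row_mul mulmxV // mul0mx => /rowP /(_ i); rewrite !mxE eqxx.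
  by move/eqP; rewrite oner_eq0.
exists x, f; split=> //; first exact: fullrankfun_inj.
rewrite (_ : rowsub f G^T = rowsub f (tight x)^T) //.
apply/matrixP => i j; rewrite [LHS]mxE [LHS]mxE.
by do 3 rewrite [RHS]mxE; rewrite tf eqxx.
Qed.

End Vertex.

(** By Laplace expansion along the first row, as passing to a minor can only decrease the sums of
    absolute values in the remaining rows. *)
Lemma det_le_prod_row (n : nat) (A : 'M[int]_n) :
  `|\det A| <= \prod_i \sum_j `|A i j|.
Proof.
elim: n A => [|n IHn] A; first by rewrite det_mx00 big_ord0 normr1.
rewrite (expand_det_row _ ord0) [leRHS]big_ord_recl mulr_suml.
apply: le_trans (ler_norm_sum _ _ _) _; apply: ler_sum => j _.
rewrite normrM ler_wpM2l //.
rewrite /cofactor normrM normrX normrN1 expr1n mul1r.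
apply: le_trans (IHn _) _; apply: ler_prod => i _; rewrite sumr_ge0 //=.
rewrite [leRHS](bigD1_ord j) //= ler_wpDl //.
by apply: ler_sum => k _; rewrite !mxE.
Qed.

(** Cramer's rule without division: expanding along the replaced column yields the cofactors of
    [A]. *)
Lemma adj_mul_det (n : nat) (A : 'M[int]_n) (c : 'cV[int]_n) i :
  (\adj A *m c) i 0 = \det (\matrix_(k, j) if j == i then c k 0 else A k j).
Proof.
rewrite (expand_det_col _ i) mxE; apply: eq_bigr => k _.
rewrite !mxE eqxx mulrC; congr (_ * _).
rewrite /cofactor; congr (_ * \det _); apply/matrixP => r s.
by rewrite !mxE eq_sym (negbTE (neq_lift _ _)).
Qed.

(** A vertex multiplied by the absolute value of the determinant of its tight system is integral,
    and its coordinates are, up to sign, determinants whose rows come from [G] and the right side.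
    The summand 1 in each factor pays for the entry of the right side. *)
Lemma integer_point_mx (R : realFieldType) (n m : nat) (G : 'M[int]_(n, m))
    (b : 'I_m -> bool) (x : 'rV[R]_n) :
  row_free (map_mx intr G : 'M[R]_(n, m)) ->
  feasible (map_mx intr G) (\row_j (b j)%:R) x ->
  exists p : 'rV[int]_n, (forall j, (b j)%:R <= (p *m G) 0 j) /\
    forall i, `|p 0 i| <= \prod_j (1 + \sum_k `|G k j|).
Proof.
move=> free /(vertex free)[{}x [f [fx injf unitA tf]]].
pose A : 'M[int]_n := rowsub f G^T.
pose c : 'cV[int]_n := \col_i (b (f i))%:R.
have mapA : map_mx intr A = rowsub f (map_mx intr G : 'M[R]_(n, m))^T.
  by apply/matrixP => i j; rewrite !mxE.
have detA0 : \det A != 0.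
  by rewrite unitmxE -mapA det_map_mx unitfE intr_eq0 in unitA.
have xc : (map_mx intr A : 'M[R]_n) *m x^T = map_mx intr c.
  apply/colP => i; rewrite mapA !mxE rmorph_nat; have := tf i; rewrite !mxE => <-.
  by apply: eq_bigr => k _; rewrite !mxE mulrC.
pose p0 : 'cV[int]_n := \adj A *m c.
have p0x : map_mx intr p0 = (\det A)%:~R *: x^T :> 'cV[R]_n.
  rewrite map_mxM -xc mulmxA -map_mxM mul_adj_mx.
  by rewrite map_scalar_mx mul_scalar_mx.
(* The vector [p0] is [\det A] times the vertex; the sign makes the multiplier positive, so that
   inequalities are kept. *)
pose s : int := Num.sg (\det A).
exists (s *: p0^T); split.
  move=> j; rewrite -(ler_int R).
  have -> : ((s *: p0^T *m G) 0 j)%:~R =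
      (`|\det A|)%:~R * (x *m map_mx intr G) 0 j :> R.
    have : map_mx intr (s *: p0^T *m G) =
        (`|\det A|)%:~R *: (x *m map_mx intr G) :> 'rV[R]_m.
      rewrite map_mxM map_mxZ -map_trmx p0x linearZ /= trmxK scalerA -intrM -normrEsg.
      by rewrite -scalemxAl.
    by move/rowP/(_ j); rewrite [LHS]mxE [RHS]mxE.
  (* As the right sides are 0 or 1, enlarging the point by a factor of at least 1 keeps it
     feasible. *)
  have D1 : 1 <= (`|\det A|)%:~R :> R.
    by rewrite (ler_int R 1) -gtz0_ge1 normr_gt0.
  have := fx j; rewrite mxE; case: (b j) => /= h.
    by rewrite rmorph1; apply: (le_trans h); rewrite ler_peMl // (le_trans _ h).
  by rewrite mulr_ge0 // (le_trans ler01).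
move=> i; rewrite mxE normrM normr_sg detA0 mul1r mxE adj_mul_det.
apply: le_trans (det_le_prod_row _) _.
apply: (@le_trans _ _ (\prod_(k < n) (1 + \sum_l `|G l (f k)|))).
  apply: ler_prod => k _; rewrite sumr_ge0 //=.
  rewrite (bigD1 i) //= mxE eqxx; apply: lerD.
    by rewrite mxE; case: (b _).
  rewrite [leRHS](bigD1 i) //= ler_wpDl //.
  by apply: ler_sum => l /negbTE li; rewrite !mxE li.
(* The determinant only involves columns in the image of [f]; the factors of all other columns are
   at least 1. *)
have F1 j : 1 <= 1 + \sum_l `|G l j| by rewrite lerDl sumr_ge0.
rewrite [leRHS](bigID (mem (f @: [set: 'I_n]))) /=.
rewrite big_imset /=; last by move=> ? ? _ _ /injf.
rewrite [X in _ <= X * _](eq_bigl predT) => [|k]; last by rewrite inE.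
apply: ler_peMr; last by elim/big_ind: _ => // u v; exact: mulr_ege1.
by apply: prodr_ge0 => k _; apply: le_trans (F1 _).
Qed.

(** The sign conditions on the coordinates join the system as an identity block. This makes the
    matrix row free, so that a vertex exists, and costs a factor 2 per coordinate. *)
Lemma integer_point (R : realFieldType) (D C : finType) (a : C -> D -> int)
    (b : C -> bool) (x : D -> R) :
  (forall d, 0 <= x d) ->
  (forall c, (b c)%:R <= \sum_d (a c d)%:~R * x d) ->
  exists p : D -> nat, (forall c, (b c)%:R <= \sum_d a c d * (p d)%:Z) /\
    forall d, (p d <= 2 ^ #|D| * \prod_c (1 + \sum_d `|a c d|))%N.
Proof.
move=> x0 hx.
pose coef (j : C + D) (d : D) : int :=
  match j with inl c => a c d | inr d' => (d == d')%:R end.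
pose rhs (j : C + D) : bool := if j is inl c then b c else false.
pose G : 'M[int]_(#|D|, #|{: C + D}|) := \matrix_(i, j) coef (enum_val j) (enum_val i).
have sumE (S : pzRingType) (y : D -> S) j :
    \sum_(i < #|D|) y (enum_val i) * (G i j)%:~R = \sum_d y d * (coef (enum_val j) d)%:~R.
  rewrite (reindex (@enum_val D predT)) /=; last first.
    by apply: onW_bij; exact: enum_val_bij.
  by apply: eq_bigr => i _; rewrite mxE.
pose xv : 'rV[R]_#|D| := \row_i x (enum_val i).
have xvE j : (xv *m map_mx intr G) 0 j = \sum_d x d * (coef (enum_val j) d)%:~R.
  by rewrite -sumE mxE; apply: eq_bigr => i _; rewrite !mxE.
have delta (S : pzRingType) (y : D -> S) d : \sum_d' y d' * (coef (inr d) d')%:~R = y d.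
  rewrite (bigD1 d) //= eqxx rmorph1 mulr1 big1 ?addr0 // => d' /negbTE e.
  by rewrite e rmorph0 mulr0.
have free : row_free (map_mx intr G : 'M[R]_(_, _)).
  apply/row_freeP; exists (\matrix_(j, i) (enum_val j == inr (enum_val i))%:R).
  apply/matrixP => i i'; rewrite !mxE (bigD1 (enum_rank (inr (enum_val i')))) //=.
  rewrite !mxE enum_rankK eqxx mulr1 big1 ?addr0 => [|j /eqP e].
    by rewrite /coef rmorph_nat (inj_eq enum_val_inj).
  rewrite !mxE; case: eqP => [ej|]; last by rewrite mulr0.
  by case: e; rewrite -ej enum_valK.
have feas : feasible (map_mx intr G : 'M[R]_(_, _)) (\row_j (rhs (enum_val j))%:R) xv.
  move=> j; rewrite xvE mxE; case: (enum_val j) => [c|d] /=.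
    by under eq_bigr do rewrite mulrC; exact: hx.
  by rewrite delta.
have [p [hp bp]] := integer_point_mx free feas.
pose y d := p 0 (enum_rank d).
have pE j : (p *m G) 0 j = \sum_d y d * coef (enum_val j) d.
  rewrite mxE; under [RHS]eq_bigr do rewrite -[coef _ _]intz.
  rewrite -sumE; apply: eq_bigr => i _.
  by rewrite intz /y enum_valK.
have y0 d : 0 <= y d.
  have := hp (enum_rank (inr d)); rewrite pE enum_rankK /=.
  by under eq_bigr do rewrite -[_%:R]intz; rewrite (delta _ y).
exists (fun d => `|y d|%N); split=> [c|d].
  have := hp (enum_rank (inl c)); rewrite pE enum_rankK /=.
  by under eq_bigr do rewrite mulrC -[y _]gez0_abs //.
rewrite -lez_nat abszE; apply: le_trans (bp _) _.
have -> : \prod_j (1 + \sum_k `|G k j|) =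
    \prod_(j : C + D) (1 + \sum_d `|coef j d|).
  rewrite [RHS](reindex (@enum_val (C + D)%type predT)) /=; last first.
    by apply: onW_bij; exact: enum_val_bij.
  apply: eq_bigr => j _; congr (1 + _).
  rewrite [RHS](reindex (@enum_val D predT)) /=; last first.
    by apply: onW_bij; exact: enum_val_bij.
  by apply: eq_bigr => i _; rewrite mxE.
rewrite big_sumType /= mulrC.
have -> : \prod_(i : D) (1 + \sum_d `|coef (inr i) d|) = (2 ^ #|D|)%N%:Z.
  rewrite -natz natrX -prodr_const; apply: eq_bigr => d' _.
  have /= := delta int (fun=> 1) d'; under eq_bigr do rewrite mul1r intz.
  by under [X in 1 + X]eq_bigr do rewrite normr_nat; move=> ->.
rewrite PoszM ler_wpM2l // -natz natr_prod.
rewrite (eq_bigr (fun i => (1 + \sum_d `|a i d|)%N%:R)) // => c _.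
rewrite natrD natr_sum; congr (_ + _); apply: eq_bigr => d' _.
by rewrite natz abszE.
Qed.

Lemma sum_delta (S : pzRingType) (D : finType) (y : D -> S) (u : D) (k : int) :
  \sum_d (k * (d == u)%:R)%:~R * y d = k%:~R * y u.
Proof.
rewrite (bigD1 u) //= eqxx mulr1 big1 ?addr0 // => d /negbTE ->.
by rewrite mulr0 rmorph0 mul0r.
Qed.

Lemma sum_delta_abs (D : finType) (u : D) (k : int) :
  (\sum_d `|(k * (d == u)%:R)%R| = `|k|)%N.
Proof.
rewrite (bigD1 u) //= eqxx mulr1 big1 ?addn0 // => d /negbTE ->.
by rewrite mulr0.
Qed.

(* All sums, inequalities and strict inequalities with 0 that hold between the
   coordinates of [x], together with the listed proportions, form a homogeneous
   system; scaling [x] makes the positive coordinates at least 1. *)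
Lemma integer_copy (R : realFieldType) (D M : finType) (x : D -> R) (l : nat)
    (mu : M -> nat * D * (nat * D)) :
  (forall d, 0 <= x d) ->
  (forall k, (mu k).1.1%:R * x (mu k).1.2 = (mu k).2.1%:R * x (mu k).2.2) ->
  (forall k, (mu k).1.1 <= 2 ^ l /\ (mu k).2.1 <= 2 ^ l)%N ->
  exists p : D -> nat,
    [/\ forall u v w, x u + x v = x w -> (p u + p v = p w)%N,
        forall u v, x u <= x v -> (p u <= p v)%N,
        forall u, 0 < x u -> (0 < p u)%N,
        forall k, ((mu k).1.1 * p (mu k).1.2 = (mu k).2.1 * p (mu k).2.2)%N &
        forall u, (p u <= 2 ^ (9 * #|D| ^ 3 + 2 * #|M| * (l + 2)))%N].
Proof.
move=> x0 hmu hl.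
(* An equation is split into two inequalities by the sign [s]. A relation that fails for [x]
   contributes a zero row, so the number of constraints depends on [D] and [M] only. *)
pose C : finType := ((D * D * D * bool) + ((D * D) + (D + M * bool)))%type.
pose e (k : int) (u d : D) : int := k * (d == u)%:R.
pose a (c : C) (d : D) : int :=
  match c with
  | inl (u, v, w, s) =>
      if x u + x v == x w then
        e ((-1) ^+ s) u d + e ((-1) ^+ s) v d + e (- (-1) ^+ s) w d else 0
  | inr (inl (u, v)) => if x u <= x v then e (-1) u d + e 1 v d else 0
  | inr (inr (inl u)) => if 0 < x u then e 1 u d else 0
  | inr (inr (inr (k, s))) =>
      e ((-1) ^+ s * (mu k).1.1%:Z) (mu k).1.2 d +
      e (- (-1) ^+ s * (mu k).2.1%:Z) (mu k).2.2 d
  end.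
pose b (c : C) : bool := if c is inr (inr (inl u)) then 0 < x u else false.
have aE (S : comPzRingType) (y : D -> S) (c : C) : \sum_d (a c d)%:~R * y d =
  match c with
  | inl (u, v, w, s) => if x u + x v == x w then (-1) ^+ s * (y u + y v - y w) else 0
  | inr (inl (u, v)) => if x u <= x v then y v - y u else 0
  | inr (inr (inl u)) => if 0 < x u then y u else 0
  | inr (inr (inr (k, s))) =>
      (-1) ^+ s * ((mu k).1.1%:R * y (mu k).1.2 - (mu k).2.1%:R * y (mu k).2.2)
  end.
  have sumD (k k' : int) u v : \sum_d (e k u d + e k' v d)%:~R * y d =
      k%:~R * y u + k'%:~R * y v.
    under eq_bigr do rewrite rmorphD /= mulrDl.
    by rewrite big_split /= !sum_delta.
  have sum0 : \sum_d (0 : int)%:~R * y d = 0.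
    by rewrite big1 // => d _; rewrite rmorph0 mul0r.
  case: c => [[[[u v] w] s]|[[u v]|[u|[k s]]]] /=.
  - case: ifP => _ //; under eq_bigr do rewrite rmorphD /= mulrDl.
    rewrite big_split /= sumD sum_delta rmorphN /= rmorphXn rmorphN1.
    by ring.
  - by case: ifP => _ //; rewrite sumD rmorphN1 rmorph1; ring.
  - by case: ifP => _ //; rewrite sum_delta rmorph1 mul1r.
  - rewrite sumD !rmorphM /= rmorphN /= rmorphXn rmorphN1 -!pmulrn.
    by ring.
have aB c : (1 + \sum_d `|a c d| <=
    if c is inr (inr (inr (k, s))) then 2 ^ (l + 2) else 4)%N.
  have sum2 k k' u v : (\sum_d `|(e k u d + e k' v d)%R| <= `|k| + `|k'|)%N.
    rewrite -(sum_delta_abs u k) -(sum_delta_abs v k') -big_split /=.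
    by apply: leq_sum => d _; rewrite /e; lia.
  have sum0 : (\sum_(d : D) `|0%R : int| = 0)%N by rewrite big1.
  case: c => [[[[u v] w] s]|[[u v]|[u|[k s]]]] /=.
  - case: (x u + x v == x w); last by rewrite sum0.
    apply: (@leq_trans (1 + (2 + 1))) => //; rewrite leq_add2l.
    have hw : (\sum_d `|e (- (-1) ^+ s) w d| = 1)%N.
      by rewrite sum_delta_abs; case: s.
    apply: (@leq_trans (\sum_d (`|(e ((-1) ^+ s) u d + e ((-1) ^+ s) v d)%R| +
        `|e (- (-1) ^+ s) w d|))%N).
      apply: leq_sum => d _.
      by move: (e _ u d) (e _ v d) (e _ w d) => i j k; lia.
    rewrite big_split /= hw leq_add2r; apply: leq_trans (sum2 _ _ _ _) _.
    by rewrite abszX exp1n.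
  - case: (x u <= x v); last by rewrite sum0.
    by have := sum2 (-1) 1 u v; lia.
  - case: (0 < x u); last by rewrite sum0.
    by rewrite sum_delta_abs.
  - have := sum2 ((-1) ^+ s * (mu k).1.1%:Z) (- (-1) ^+ s * (mu k).2.1%:Z)
      (mu k).1.2 (mu k).2.2.
    have [h1 h2] := hl k; rewrite !abszM abszN abszX /= exp1n !mul1n.
    have := expn_gt0 2 l; rewrite addn2 !expnS.
    move: (2 ^ l)%N h1 h2 => q; lia.
(* The sum of the inverses serves all positive coordinates at once: its summand for [u] alone gives
   [1 <= la * x u]. *)
pose la : R := \sum_(u | 0 < x u) (x u)^-1.
have la0 : 0 <= la by apply: sumr_ge0 => u /ltW xu; rewrite invr_ge0.
have [|c|p [hp bp]] := @integer_point R D C a b (fun d => la * x d).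
- by move=> d; rewrite mulr_ge0.
- rewrite aE; case: c => [[[[u v] w] s]|[[u v]|[u|[k s]]]] /=.
  + by case: eqP => // h; rewrite -h; lra.
  + by case: ifP => // h; rewrite subr_ge0 ler_wpM2l.
  + case: ifP => // h; rewrite /la (bigD1 u) //= mulrDl mulVf ?gt_eqF //.
    by rewrite lerDl mulr_ge0 // sumr_ge0 // => i /andP[/ltW xi _]; rewrite invr_ge0.
  + by rewrite mulrCA hmu [la * _]mulrC mulrA; lra.
have {}hp c : (b c)%:R <= \sum_d (a c d)%:~R * (p d)%:Z.
  by under eq_bigr do rewrite intz; exact: hp.
exists p; split.
- move=> u v w h.
  have := hp (inl (u, v, w, false)); have := hp (inl (u, v, w, true)).
  rewrite !aE /= h eqxx; lia.
- by move=> u v h; have := hp (inr (inl (u, v))); rewrite aE /= h; lia.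
- by move=> u h; have := hp (inr (inr (inl u))); rewrite aE /= h; lia.
- move=> k; have := hp (inr (inr (inr (k, false)))).
  have := hp (inr (inr (inr (k, true)))); rewrite !aE /= !natz; lia.
move=> u; apply: leq_trans (bp u) _.
pose B (c : C) : nat := if c is inr (inr (inr (k, s))) then (2 ^ (l + 2))%N else 4%N.
apply: (@leq_trans (2 ^ #|D| * \prod_c B c)%N).
  by rewrite leq_mul2l; apply/orP; right; apply: leq_prod => c _; exact: aB.
have -> : (\prod_c B c = 4 ^ (#|D| * #|D| * #|D| * 2 + #|D| * #|D| + #|D|) *
    (2 ^ (l + 2)) ^ (#|M| * 2))%N.
  rewrite !big_sumType /= (eq_bigr (fun=> 4%N)) => [|[[[? ?] ?] ?] _] //.
  rewrite [X in (_ * (X * _))%N](eq_bigr (fun=> 4%N)) => [|[? ?] _] //.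
  rewrite [X in (_ * (_ * (_ * X)))%N](eq_bigr (fun=> 2 ^ (l + 2))%N) => [|[? ?] _] //.
  by rewrite !prod_nat_const !card_prod card_bool !expnD !mulnA.
(* With [N = #|D|] the exponent is [N] from the sign conditions and [2 * (2 * N ^ 3 + N ^ 2 + N)]
   from the factors 4. As [N] is positive, this is at most [(1 + 4 + 2 + 2) * N ^ 3], the constant 9
   of the statement. *)
have D0 : (0 < #|D|)%N by apply/card_gt0P; exists u.
rewrite -(@expnM 2 2) -expnM -!expnD leq_exp2l // !expnS expn0 muln1.
rewrite addnA leq_add //; last by rewrite mulnC leq_mul2r mulnC leqnn orbT.
by move: #|D| D0 => N; nia.
Qed.

End IntegerPoints.

(** * Parsing *)

Definition formula_head (c : token) : bool :=
  match c with
  | TVar | TBot | TOne | TTensor | TLimp | TScale => true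
  | _ => false
  end.

Definition starts (P : pred token) (s : seq token) : bool :=
  if s is c :: _ then P c else false.

Definition is_bit (c : token) : bool := if c is TBit _ then true else false.

Notation starts_bit := (starts is_bit).
Notation starts_formula := (starts formula_head).

Fixpoint bit_run (s : seq token) : seq bool :=
  if s is TBit b :: s' then b :: bit_run s' else [::].

Fixpoint after_run (s : seq token) : seq token :=
  if s is TBit _ :: s' then after_run s' else s.

Lemma bit_run_cat s : s = enc_bits (bit_run s) ++ after_run s.
Proof. by elim: s => [|[] //= b s {1}->]. Qed.

Lemma after_run_nobit s : ~~ starts_bit (after_run s).
Proof. by elim: s => [|[]]. Qed.

Lemma after_run_id s : ~~ starts_bit s -> after_run s = s.
Proof. by case: s => [|[]]. Qed.

Lemma bit_run_nil s : ~~ starts_bit s -> bit_run s = [::].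
Proof. by case: s => [|[]]. Qed.

Lemma bit_run_enc bs r : ~~ starts_bit r -> bit_run (enc_bits bs ++ r) = bs.
Proof. by move=> hr; elim: bs => [|b bs IH] /=; [exact: bit_run_nil | rewrite IH]. Qed.

Lemma after_run_enc bs r : ~~ starts_bit r -> after_run (enc_bits bs ++ r) = r.
Proof. by move=> hr; elim: bs => [|b bs IH] /=; [exact: after_run_id | rewrite IH]. Qed.

(* Most significant bit first. *)
Definition bits_val (bs : seq bool) : nat := foldl (fun v (b : bool) => 2 * v + b)%N 0 bs.

Lemma bits_val_rcons bs b : bits_val (rcons bs b) = (2 * bits_val bs + b)%N.
Proof. by rewrite /bits_val foldl_rcons. Qed.

Lemma bits_val_cons b bs : bits_val (b :: bs) = (b * 2 ^ size bs + bits_val bs)%N.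
Proof.
elim/last_ind: bs => [|bs c IH]; first by rewrite /bits_val /= muln1 addn0.
by rewrite -rcons_cons !bits_val_rcons IH size_rcons expnS; lia.
Qed.

Lemma bits_val_lt bs : (bits_val bs < 2 ^ size bs)%N.
Proof.
elim/last_ind: bs => [|bs b IH] //.
by rewrite bits_val_rcons size_rcons expnS; case: b; lia.
Qed.

Lemma bits_val_pos p : bits_val (bits_pos p) = nat_of_bin (Npos p).
Proof.
elim: p => [p IH|p IH|] //=; rewrite bits_val_rcons IH /= natTrecE -muln2; lia.
Qed.

Lemma bits_val_N n : bits_val (bits_N n) = nat_of_bin n.
Proof. by case: n => [|p] //=; exact: bits_val_pos. Qed.

Lemma head_bits_pos p : head false (bits_pos p) = true.
Proof. by elim: p => [p|p|] //=; case: (bits_pos p). Qed.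

Lemma head_bits_posP bs : head false bs -> exists p, bits_pos p = bs.
Proof.
elim/last_ind: bs => [|bs b IH] //.
case: bs IH => [|c bs] IH /=; first by case: b => // _; exists xH.
move=> /IH[p hp]; case: b; [exists (xI p) | exists (xO p)]; by rewrite /= hp.
Qed.

Lemma bits_pos_inj : injective bits_pos.
Proof.
have nonnil p : bits_pos p <> [::] by move=> e; have := head_bits_pos p; rewrite e.
have rc p b : [:: true] = rcons (bits_pos p) b -> False.
  by have := nonnil p; case: (bits_pos p) => //= c [].
elim=> [p IH|p IH|] [q|q|] //=; rewrite ?(rcons_inj, I) //.
- by move/rcons_inj => [/IH ->].
- by move/rcons_inj => [].
- by move/esym/rc.
- by move/rcons_inj => [].
- by move/rcons_inj => [/IH ->].
- by move/esym/rc.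
- by move/rc.
- by move/rc.
Qed.

(** The numerals that occur in encodings: no leading zeros, except for zero itself. *)
Definition valid_N (bs : seq bool) : bool := head false bs || (bs == [:: false]).

Lemma valid_bits_N n : valid_N (bits_N n).
Proof. by case: n => // p; rewrite /valid_N /= head_bits_pos. Qed.

Lemma valid_NP bs : valid_N bs -> exists n, bits_N n = bs.
Proof.
case/orP => [/head_bits_posP[p <-]|/eqP->]; [by exists (Npos p) | by exists N0].
Qed.

Lemma bits_N_inj : injective bits_N.
Proof.
move=> [|p] [|q] //= e.
- by have := head_bits_pos q; rewrite -e.
- by have := head_bits_pos p; rewrite e.
- by rewrite (bits_pos_inj e).
Qed.

(** Lets a single token decide whether a coefficient vanishes, as needed for [0 * +oo = 0]. *)
Lemma bits_N_neq0 n : head false (bits_N n) = (nat_of_bin n != 0)%N.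
Proof.
case: n => [|p] //=; rewrite head_bits_pos; apply/esym.
by elim: p => [p IH|p IH|] //=; rewrite natTrecE // double_eq0.
Qed.

(** The condition on [r] makes the index of a final letter a maximal run of digits; without it such
    an index could be cut short and parsing would be ambiguous. *)
Definition parses (s : seq token) (phi : form frac) (r : seq token) : Prop :=
  s = enc_form phi ++ r /\ ~~ starts_bit r.

Lemma starts_enc_form phi r : starts_formula (enc_form phi ++ r).
Proof. by case: phi. Qed.

Lemma formula_nobit s : starts_formula s -> ~~ starts_bit s.
Proof. by case: s => [|[]]. Qed.

Lemma parses_formula s phi r : parses s phi r -> starts_formula s.
Proof. by case=> -> _; exact: starts_enc_form. Qed.

Lemma parses_size s phi r : parses s phi r -> (size r < size s)%N.
Proof.
case=> -> _; rewrite size_cat; have /andP[h _] := size_enc_form phi.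
by have := form_size_gt0 phi; lia.
Qed.

Lemma run_split s bs r : ~~ starts_bit r ->
  s = enc_bits bs ++ r <-> bit_run s = bs /\ after_run s = r.
Proof.
move=> hr; split=> [->|[<- <-]]; last exact: bit_run_cat.
by rewrite bit_run_enc // after_run_enc.
Qed.

Lemma parses_Var s phi r : parses (TVar :: s) phi r <->
  exists p, [/\ phi = Var p, bit_run s = bits_N (bin_of_nat p) & after_run s = r].
Proof.
split=> [[]|[p [-> h1 h2]]].
  case: phi => //= p [e] hr; exists p.
  by have [h _] := run_split s (bits_N (bin_of_nat p)) hr; case: (h e).
have hr : ~~ starts_bit r by rewrite -h2 after_run_nobit.
by split=> //; rewrite /= -h1 -h2 -bit_run_cat.
Qed.

Lemma parses_Bot s phi r :
  parses (TBot :: s) phi r <-> [/\ phi = Bot, s = r & ~~ starts_bit r].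
Proof. by split=> [[]|[-> -> ?]] //; case: phi => //= -[]. Qed.

Lemma parses_One s phi r :
  parses (TOne :: s) phi r <-> [/\ phi = One, s = r & ~~ starts_bit r].
Proof. by split=> [[]|[-> -> ?]] //; case: phi => //= -[]. Qed.

Lemma parses_Tensor s phi r : parses (TTensor :: s) phi r <->
  exists a b r1, [/\ phi = Tensor a b, parses s a r1 & parses r1 b r].
Proof.
split=> [[]|[a [b [r1 [-> [-> _] [-> hr]]]]]]; last by split; rewrite //= -catA.
case: phi => //= a b [e] hr; exists a, b, (enc_form b ++ r); split=> //.
by split; [rewrite e -catA | apply: formula_nobit; exact: starts_enc_form].
Qed.

Lemma parses_Limp s phi r : parses (TLimp :: s) phi r <->
  exists a b r1, [/\ phi = Limp a b, parses s a r1 & parses r1 b r].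
Proof.
split=> [[]|[a [b [r1 [-> [-> _] [-> hr]]]]]]; last by split; rewrite //= -catA.
case: phi => //= a b [e] hr; exists a, b, (enc_form b ++ r); split=> //.
by split; [rewrite e -catA | apply: formula_nobit; exact: starts_enc_form].
Qed.

Lemma parses_Scale s phi r : parses (TScale :: s) phi r <->
  exists q a s2, [/\ phi = Scale q a, bit_run s = bits_N (fnum q),
    after_run s = TSlash :: s2, bit_run s2 = bits_pos (fden q) &
    parses (after_run s2) a r].
Proof.
split=> [[]|[q [a [s2 [-> h1 h2 h3 [h4 hr]]]]]].
  case: phi => //= q a [e] hr.
  exists q, a, (enc_bits (bits_pos (fden q)) ++ enc_form a ++ r).
  have hf : ~~ starts_bit (enc_form a ++ r).
    by apply: formula_nobit; exact: starts_enc_form.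
  move: e; rewrite -catA cat_cons -catA => e; split=> //.
  - by rewrite e bit_run_enc.
  - by rewrite e after_run_enc.
  - by rewrite bit_run_enc.
  - by rewrite after_run_enc.
split=> //=; congr cons; rewrite -catA cat_cons -catA -h1 -h3 -h4.
by rewrite -bit_run_cat -h2 -bit_run_cat.
Qed.

Lemma parses_inj s phi r phi' r' :
  parses s phi r -> parses s phi' r' -> phi = phi' /\ r = r'.
Proof.
elim: phi s r phi' r' => [p|||a IHa b IHb|a IHa b IHb|q a IHa] [|c s] r phi' r' h;
  try by have := parses_formula h.
- have ec : c = TVar by case: h => -[].
  subst c; move/parses_Var: h => [p1 [[<-] h1 <-]].
  move/parses_Var => [p' [-> h1' <-]]; split=> //.
  congr (Var _); apply: (can_inj bin_of_natK); apply: bits_N_inj.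
  by rewrite -h1 -h1'.
- have ec : c = TBot by case: h => -[].
  subst c; move/parses_Bot: h => [_ <- _].
  by move/parses_Bot => [-> <- _].
- have ec : c = TOne by case: h => -[].
  subst c; move/parses_One: h => [_ <- _].
  by move/parses_One => [-> <- _].
- have ec : c = TTensor by case: h => -[].
  subst c.
  move/parses_Tensor: h => [a1 [b1 [r1 [[<- <-] ha hb]]]].
  move/parses_Tensor => [a' [b' [r1' [-> ha' hb']]]].
  have [<- e1] := IHa _ _ _ _ ha ha'; subst r1'.
  by have [<- <-] := IHb _ _ _ _ hb hb'.
- have ec : c = TLimp by case: h => -[].
  subst c.
  move/parses_Limp: h => [a1 [b1 [r1 [[<- <-] ha hb]]]].
  move/parses_Limp => [a' [b' [r1' [-> ha' hb']]]].
  have [<- e1] := IHa _ _ _ _ ha ha'; subst r1'.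
  by have [<- <-] := IHb _ _ _ _ hb hb'.
- have ec : c = TScale by case: h => -[].
  subst c.
  move/parses_Scale: h => [q1 [a1 [s2 [[<- <-] h1 h2 h3 ha]]]].
  move/parses_Scale => [q' [a' [s2' [-> h1' h2' h3' ha']]]].
  move: h2'; rewrite h2 => -[es2]; subst s2'.
  have [<- <-] := IHa _ _ _ _ ha ha'; split=> //; congr (Scale _ _).
  case: q q' h1 h3 h1' h3' => [n d] [n' d'] /= -> -> /bits_N_inj -> /bits_pos_inj ->.
  by [].
Qed.

Definition parse (s : seq token) : option (form frac * seq token) :=
  if pselect (exists pr : form frac * seq token, parses s pr.1 pr.2) is left h
  then Some (projT1 (cid h)) else None.

Lemma parseP s phi r : parse s = Some (phi, r) <-> parses s phi r.
Proof.
rewrite /parse; case: pselect => [h|h]; last first.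
  by split=> // hp; case: h; exists (phi, r).
case: (cid h) => -[phi' r'] /= hp; split=> [[<- <-] //|h'].
by have [-> ->] := parses_inj hp h'.
Qed.

Lemma parse_None s : ~~ starts_formula s -> parse s = None.
Proof.
case e : (parse s) => [[phi r]|] // /negP[].
by move/parseP: e => /parses_formula.
Qed.

Definition is_slash (c : token) : bool := if c is TSlash then true else false.
Definition is_comma (c : token) : bool := if c is TComma then true else false.
Definition is_semi (c : token) : bool := if c is TSemi then true else false.
Definition is_vdash (c : token) : bool := if c is TVdash then true else false.

(* What remains after the leading formula, or after the formula behind the
   coefficient digits at the front: this makes it computable token by token from
   the right. *)
Fixpoint rest (s : seq token) : option (seq token) :=
  match s with
  | TBit _ :: s1 => rest s1
  | TSlash :: s1 =>
      if head false (bit_run s1) && ~~ starts is_slash (after_run s1) then rest s1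
      else None
  | _ => omap snd (parse s)
  end.

Lemma rest_formula s : starts_formula s -> rest s = omap snd (parse s).
Proof. by case: s => [|[]]. Qed.

Lemma rest_run s : rest s = rest (after_run s).
Proof. by elim: s => [|[]]. Qed.

Lemma rest_other s : ~~ starts_formula s -> ~~ starts_bit s -> ~~ starts is_slash s ->
  rest s = None.
Proof. by case: s => [|[] s] //= _ _ _; rewrite parse_None. Qed.

Lemma restP s r : starts_formula s -> rest s = Some r <-> exists phi, parses s phi r.
Proof.
move=> hs; rewrite rest_formula //; split=> [|[phi /parseP -> //]].
case e : (parse s) => [[phi r']|] //= [<-]; exists phi; exact/parseP.
Qed.

Lemma option_ext (T : Type) (x y : option T) :
  (forall z, x = Some z <-> y = Some z) -> x = y.
Proof.
case: x => [x|] h; first by have [/(_ erefl) -> _] := h x.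
by case: y h => // y h; have [_ /(_ erefl)] := h y.
Qed.

Lemma rest_Var s :
  rest (TVar :: s) = if valid_N (bit_run s) then Some (after_run s) else None.
Proof.
apply: option_ext => r; rewrite restP //; split=> [[phi /parses_Var[p [_ -> ->]]]|].
  by rewrite valid_bits_N.
case: ifP => // /valid_NP[n hn] [<-]; exists (Var (nat_of_bin n)).
by apply/parses_Var; exists (nat_of_bin n); split=> //; rewrite nat_of_binK.
Qed.

Lemma rest_Bot s : rest (TBot :: s) = if starts_bit s then None else Some s.
Proof.
apply: option_ext => r; rewrite restP //; split=> [[phi /parses_Bot[_ -> /negbTE ->]] //|].
by case: ifP => // /negbT hs [<-]; exists Bot; apply/parses_Bot.
Qed.

Lemma rest_One s : rest (TOne :: s) = if starts_bit s then None else Some s.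
Proof.
apply: option_ext => r; rewrite restP //; split=> [[phi /parses_One[_ -> /negbTE ->]] //|].
by case: ifP => // /negbT hs [<-]; exists One; apply/parses_One.
Qed.

Definition rest2 (s : seq token) : option (seq token) :=
  if starts_formula s then
    if rest s is Some r then if starts_formula r then rest r else None else None
  else None.

Lemma rest2P s r : rest2 s = Some r <->
  exists a b r1, parses s a r1 /\ parses r1 b r.
Proof.
rewrite /rest2; split=> [|[a [b [r1 [ha hb]]]]].
  case: ifP => // hs; case e : (rest s) => [r1|] //; case: ifP => // hr e'.
  have [/(_ e)[a ha] _] := restP r1 hs; have [/(_ e')[b hb] _] := restP r hr.
  by exists a, b, r1.
rewrite (parses_formula ha) (_ : rest s = Some r1); last first.
  by apply/(restP _ (parses_formula ha)); exists a.
by rewrite (parses_formula hb); apply/(restP _ (parses_formula hb)); exists b.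
Qed.

Lemma rest_Tensor s : rest (TTensor :: s) = rest2 s.
Proof.
apply: option_ext => r; rewrite restP // rest2P; split.
  by case=> phi /parses_Tensor[a [b [r1 [_ ha hb]]]]; exists a, b, r1.
case=> a [b [r1 [ha hb]]]; exists (Tensor a b).
by apply/parses_Tensor; exists a, b, r1.
Qed.

Lemma rest_Limp s : rest (TLimp :: s) = rest2 s.
Proof.
apply: option_ext => r; rewrite restP // rest2P; split.
  by case=> phi /parses_Limp[a [b [r1 [_ ha hb]]]]; exists a, b, r1.
case=> a [b [r1 [ha hb]]]; exists (Limp a b).
by apply/parses_Limp; exists a, b, r1.
Qed.

(** The work is divided between two tokens: [TScale] checks the numerator and the presence of a
    slash, and the slash checks that the denominator starts with 1 and is not followed by another
    slash. *)
Lemma rest_Scale s :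
  rest (TScale :: s) =
  if valid_N (bit_run s) && starts is_slash (after_run s) then rest s else None.
Proof.
(* Behind the digits of the denominator [rest] agrees with parsing even if no formula starts there,
   since then both fail. *)
have hd s2 : ~~ starts is_slash s2 -> ~~ starts_bit s2 -> forall r,
   rest s2 = Some r <-> exists a, parses s2 a r.
  move=> h1 h2 r; case h3 : (starts_formula s2); first exact: restP.
  rewrite rest_other ?h3 //; split=> // -[a ha].
  by rewrite (parses_formula ha) in h3.
apply: option_ext => r; rewrite restP // [rest s]rest_run; split.
  case=> phi /parses_Scale[q [a [s2 [_ -> -> h3 h4]]]].
  rewrite valid_bits_N /= h3 head_bits_pos.
  have h5 : ~~ starts is_slash (after_run s2).
    by have := parses_formula h4; case: (after_run s2) => [|[]].
  by rewrite h5 /= rest_run; apply/hd; [|exact: after_run_nobit|exists a].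
case: andP => // -[/valid_NP[n hn]].
case e : (after_run s) => [|[] s2] //= _.
case: andP => // -[/head_bits_posP[d hd'] h5]; rewrite rest_run => h6.
have [/(_ h6)[a ha] _] := hd _ h5 (after_run_nobit s2) r.
exists (Scale (Frac n d) a); apply/parses_Scale.
by exists (Frac n d), a, s2.
Qed.

(** * Judgements *)

Definition judgement_start (s : seq token) : bool :=
  starts_formula s || starts is_vdash s.
Definition judgement_end (s : seq token) : bool := nilp s || starts is_semi s.

(* Suffixes of encodings, delimited at the top level. *)
Inductive wf_suffix : seq token -> Prop :=
| wf_nil : wf_suffix [::]
| wf_semi s : wf_suffix s -> judgement_start s -> wf_suffix (TSemi :: s)
| wf_comma s : wf_suffix s -> judgement_start s -> wf_suffix (TComma :: s)
| wf_vdash s phi r :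
    parses s phi r -> wf_suffix r -> judgement_end r -> wf_suffix (TVdash :: s)
| wf_formula s phi r :
    parses s phi r -> wf_suffix r -> starts is_comma r -> wf_suffix s.

Lemma wf_enc_judgement j r : wf_suffix r -> judgement_end r ->
  wf_suffix (enc_judgement j ++ r) /\ judgement_start (enc_judgement j ++ r).
Proof.
move=> hr he; have nobit : ~~ starts_bit r by case: (r) he => [|[]].
case: j => fs psi; rewrite /enc_judgement /=.
elim: fs => [|phi fs [IH1 IH2]] /=.
  by split=> //; apply: (wf_vdash (phi := psi)) hr he; split.
rewrite -!catA; move: IH1 IH2; rewrite -catA.
set s := flatten _ ++ _ => IH1 IH2; rewrite cat_rcons.
split; last by rewrite /judgement_start starts_enc_form.
by apply: (wf_formula (phi := phi) (r := TComma :: s)) => //; exact: wf_comma.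
Qed.

Lemma wf_encode x : wf_suffix (encode x) /\ judgement_start (encode x).
Proof.
case: x => S g; rewrite /encode /=.
elim: S => [|j S [IH1 IH2]] /=.
  by have := wf_enc_judgement g wf_nil isT; rewrite cats0.
rewrite -catA cat_rcons; apply: wf_enc_judgement => //; exact: wf_semi.
Qed.

Lemma enc_judgement_cons phi fs psi : enc_judgement (Judgement (phi :: fs) psi) =
  enc_form phi ++ TComma :: enc_judgement (Judgement fs psi).
Proof. by rewrite /enc_judgement /= -catA cat_rcons. Qed.

Lemma encode_cons j S g :
  encode (Instance (j :: S) g) = enc_judgement j ++ TSemi :: encode (Instance S g).
Proof. by rewrite /encode /= -catA cat_rcons. Qed.

Lemma wf_decode w : wf_suffix w -> judgement_start w -> exists x, w = encode x.
Proof.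
(* The inductive predicate mixes three kinds of suffixes: those at the start of a judgement, behind
   a succedent, and behind an antecedent. The induction needs a decoding for each. *)
pose P w := [/\ judgement_start w -> exists x, w = encode x,
  (judgement_end w -> w = [::] \/ exists x, w = TSemi :: encode x) &
  (starts is_comma w -> exists x, w = TComma :: encode x)].
suff main w' : wf_suffix w' -> P w' by move=> /main[].
elim=> {w'} [|s _ [IH _ _] hs|s _ [IH _ _] hs|s phi r h _ [_ IH _] he|
  s phi r h _ [_ _ IH] hc].
- by split=> //; left.
- by split=> // _; right; have [x ->] := IH hs; exists x.
- by split=> // _; have [x ->] := IH hs; exists x.
- split=> // _; case: h => -> _; have [->|[x ->]] := IH he.
    by exists (Instance [::] (Judgement [::] phi)); rewrite cats0.
  exists (Instance (Judgement [::] phi :: premises x) (conclusion x)).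
  by rewrite encode_cons; case: (x).
- have hs := parses_formula h; split=> [_|he|hc'].
  + case: h => -> _; have [[[|[fs psi] S] [gs g]] ->] := IH hc.
      exists (Instance [::] (Judgement (phi :: gs) g)).
      by rewrite [RHS]/encode /= enc_judgement_cons.
    exists (Instance (Judgement (phi :: fs) psi :: S) (Judgement gs g)).
    by rewrite !encode_cons enc_judgement_cons -catA.
  + by case: (s) hs he => [|[]].
  + by case: (s) hs hc' => [|[]].
Qed.

(** * Conditions on the rows *)

(* The registers of the row of a suffix [s]. A primed register repeats the
   register without prime of the row whose [r_pos] is the [r_rest] of this row;
   [r_pos] is [2 ^ size s - 1], which identifies the row. [r_after], [r_code],
   [r_validN] and [r_slash] describe the run of digits at the front of [s].
   [r_gap] is the truncated difference between the succedent of the current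
   judgement and the antecedents that are still ahead. Division by a scalar
   [num/den] is avoided by guessing the result [r_quot] and comparing
   [den * r_quot], accumulated in [r_prod] over the digits of [den] and kept in
   [r_dprod], with the value of the argument times [num], accumulated likewise;
   [r_shift] is the multiplicand shifted by the digits read so far. *)
Definition r_tok := 0.
Definition r_pos := 1.
Definition r_code := 2.
Definition r_validN := 3.
Definition r_after := 4.
Definition r_slash := 5.
Definition r_parses := 6.
Definition r_rest := 7.
Definition r_tok' := 8.
Definition r_wf' := 9.
Definition r_parses' := 10.
Definition r_rest' := 11.
Definition r_val' := 12.
Definition r_gap' := 13.
Definition r_wf := 14.
Definition r_name := 15.
Definition r_val := 16.
Definition r_quot := 17.
Definition r_prod := 18.
Definition r_shift := 19.
Definition r_dprod := 20.
Definition r_unit := 21.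
Definition r_good := 22.
Definition r_gap := 23.
Definition r_semi := 24.
Definition nregs := 25.

Definition token_index (c : token) : nat :=
  match c with
  | TVar => 1 | TBot => 2 | TOne => 3 | TTensor => 4 | TLimp => 5 | TScale => 6
  | TSlash => 7 | TComma => 8 | TVdash => 9 | TSemi => 10
  | TBit b => if b then 12 else 11
  end.

Definition heads : seq nat := [:: 1; 2; 3; 4; 5; 6].
Definition bits : seq nat := [:: 11; 12].

Definition on (x : label) (k : nat) : bool := x k == 1.

(* Codes of values in [0, +oo]: 0 stands for +oo, and [n.+1] for the fraction
   with numerator [n] over the common denominator [r_unit]. *)
Definition add_code (a b c : nat) : bool :=
  (((a == 0) || (b == 0)) ==> (c == 0)) &&
  (((a != 0) && (b != 0)) ==> (a + b + 0 == c + 1)).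

Definition sub_code (b a c : nat) : bool :=
  [&& (a == 0) ==> (c == 1),
      ((a != 0) && (b == 0)) ==> (c == 0) &
      ((a != 0) && (b != 0)) ==>
        ((b <= a) ==> (c == 1)) && ((a <= b) ==> (c + a + 0 == b + 1))].

Definition starts_judgement (x : label) : bool := x r_tok \in 9 :: heads.

(** Outside a run of digits the multiplicand is initialised: at a slash with the numerator coded by
    [r_val], for the digits of the numerator on its left, and otherwise with [r_quot], for the
    digits of a denominator. *)
Definition row_cond (x : label) : bool :=
  [&& (x r_tok \notin bits) ==>
        [&& x r_code == 1, x r_after == x r_pos,
            on x r_slash == (x r_tok == 7), ~~ on x r_validN, x r_prod == 0,
            ((x r_tok == 7) && (x r_val != 0)) ==>
              (x r_shift + 0 + 1 == x r_val + 0) &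
            (x r_tok != 7) ==> (x r_shift == x r_quot)] &
      on x r_good ==> (x r_unit != 0)].

Definition link_cond (x y : label) : bool :=
  (on x r_parses && (x r_rest == y r_pos)) ==>
    [&& x r_tok' == y r_tok, x r_wf' == y r_wf, x r_parses' == y r_parses,
        x r_rest' == y r_rest, x r_val' == y r_val & x r_gap' == y r_gap].

Definition letter_cond (x y : label) : bool :=
  [&& on x r_good, on y r_good, x r_tok == 1, y r_tok == 1 & x r_name == y r_name] ==>
    (x r_val == y r_val).

Definition pair_cond (x y : label) : bool :=
  [&& row_cond x, link_cond x y & letter_cond x y].

Definition common_cond (c : token) (x y : label) : bool :=
  [&& y r_tok == token_index c, x r_pos + x r_pos + 1 == y r_pos + 0,
      on y r_semi == is_semi c || on x r_semi,
      y r_good == x r_good & y r_unit == x r_unit].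

Definition parse_cond (c : token) (x y : label) : bool :=
  match c with
  | TBit b =>
      [&& x r_code + x r_code + b == y r_code + 0,
          on y r_validN == b || (x r_tok \notin bits),
          y r_after == x r_after, on y r_slash == on x r_slash,
          on y r_parses == on x r_parses & y r_rest == x r_rest]
  | TSlash =>
      (on y r_parses == [&& x r_tok == 12, ~~ on x r_slash & on x r_parses]) &&
      (on y r_parses ==> (y r_rest == x r_rest))
  | TScale =>
      (on y r_parses == [&& on x r_validN, on x r_slash & on x r_parses]) &&
      (on y r_parses ==> (y r_rest == x r_rest))
  | TVar =>
      [&& on y r_parses == on x r_validN,
          on y r_parses ==> (y r_rest == x r_after) & y r_name == x r_code]
  | TBot | TOne =>
      (on y r_parses == (x r_tok \notin bits)) &&
      (on y r_parses ==> (y r_rest == x r_pos))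
  | TTensor | TLimp =>
      (on y r_parses == [&& x r_tok \in heads, on x r_parses,
                            x r_tok' \in heads & on x r_parses']) &&
      (on y r_parses ==> (y r_rest == x r_rest'))
  | TComma | TSemi | TVdash => ~~ on y r_parses
  end.

Definition wf_cond (c : token) (x y : label) : bool :=
  on y r_wf ==
  match c with
  | TBit _ | TSlash => false
  | TComma | TSemi => on x r_wf && starts_judgement x
  | TVdash => [&& x r_tok \in heads, on x r_parses, on x r_wf' &
                  x r_tok' \in [:: 0; 10]]
  | _ => [&& on y r_parses, on y r_wf' & y r_tok' == 8]
  end.

(* A judgement with a semicolon somewhere behind it is a premise and must hold;
   the last one is the conclusion and must fail. *)
Definition judgement_cond (x : label) : bool :=
  (on x r_semi ==> (x r_gap == 1)) && (~~ on x r_semi ==> (x r_gap != 1)).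

(** Letters are free here and tied together only by [letter_cond]. In the case of [TScale], token 12
    is the digit 1, so the first two lines distinguish nonzero and zero coefficients of an infinite
    argument. *)
Definition value_cond (c : token) (x y : label) : bool :=
  match c with
  | TBit b =>
      [&& y r_val == x r_val, y r_quot == x r_quot, y r_dprod == x r_dprod,
          x r_prod + (if b then x r_shift else 0) + 0 == y r_prod + 0 &
          x r_shift + x r_shift + 0 == y r_shift + 0]
  | TSlash =>
      on y r_parses ==>
      [&& y r_val == x r_val, y r_quot == x r_quot & y r_dprod == x r_prod]
  | TScale =>
      on y r_parses ==>
      [&& ((x r_val == 0) && (x r_tok == 12)) ==> (y r_val == 0),
          ((x r_val == 0) && (x r_tok != 12)) ==> (y r_val == 1),
          (x r_val != 0) ==> (x r_quot + 0 + 1 == y r_val + 0) &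
          (x r_val != 0) ==> (x r_prod == x r_dprod)]
  | TVar => true
  | TBot => on y r_parses ==> (y r_val == 0)
  | TOne => on y r_parses ==> (y r_unit + 0 + 1 == y r_val + 0)
  | TTensor => on y r_parses ==> add_code (x r_val) (x r_val') (y r_val)
  | TLimp => on y r_parses ==> sub_code (x r_val') (x r_val) (y r_val)
  | TComma => y r_gap == x r_gap
  | TVdash => on y r_wf ==> (y r_gap == x r_val)
  | TSemi => on y r_wf ==> judgement_cond x
  end.

Definition gap_cond (c : token) (y : label) : bool :=
  (formula_head c && on y r_wf) ==> sub_code (y r_gap') (y r_val) (y r_gap).

Definition base_cond (x : label) : bool :=
  [&& x r_tok == 0, ~~ on x r_parses, on x r_wf & ~~ on x r_semi].

(** The equality, rather than an implication, prevents a certificate from declaring a well-formed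
    instance malformed in order to escape the conditions on values. *)
Definition final_cond (x : label) : bool :=
  (on x r_good == (on x r_wf && starts_judgement x)) &&
  (on x r_good ==> judgement_cond x).

Definition adj_cond (first : bool) (a : option token) (x y : label) : bool :=
  (first ==> base_cond x) &&
  (if a is Some c then
     [&& common_cond c x y, parse_cond c x y, wf_cond c x y &
         on y r_good ==> value_cond c x y && gap_cond c y]
   else final_cond x).

Ltac regular :=
  rewrite /row_cond /link_cond /letter_cond /common_cond /parse_cond /wf_cond
    /value_cond /gap_cond /judgement_cond /base_cond /final_cond
    /add_code /sub_code /starts_judgement /on /=;
  repeat first
    [ exact: regular_const | exact: bit_terml | exact: bit_termr | exact: bit_term0
    | apply: regularI | apply: regularU | apply: regular_implb | apply: regularN
    | apply: regular_mem | apply: regular_bool_eq | apply: regular_le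
    | apply: regular_linear | apply: regular_eqc | apply: regular_eq ].

Lemma regular_pair_cond : regular nregs pair_cond.
Proof. by rewrite /pair_cond; regular. Qed.

Lemma regular_adj_cond f a : regular nregs (adj_cond f a).
Proof.
rewrite /adj_cond; case: a => [c|]; last by case: f; regular.
apply: regularI; first by case: f; regular.
by case: c => [||||||||||[]]; regular.
Qed.

(** * Soundness *)

Section Decode.
Variable R : realType.
Implicit Types a b c : nat.
Local Open Scope ereal_scope.

Lemma tsub_fin (a b : R) : tsub a%:E b%:E = (Num.max 0 (a - b))%:E.
Proof.
rewrite /tsub lee_fin; case: leP => ab /=; congr EFin.
  by rewrite max_l // subr_le0.
by rewrite max_r // subr_ge0 ltW.
Qed.

Lemma tsub_yr (a : \bar R) : tsub a +oo = 0.
Proof. by rewrite /tsub leey. Qed.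

Lemma tsub_yl (b : R) : tsub +oo b%:E = +oo.
Proof. by []. Qed.

Lemma tsub_ge0 (a b : \bar R) : 0 <= a -> 0 <= b -> 0 <= tsub a b.
Proof.
case: b => [b| |] // a0 b0; last by rewrite tsub_yr.
case: a a0 => [a| |] // a0.
by rewrite tsub_fin lee_fin le_max lexx.
Qed.

Lemma tsub0 (a : \bar R) : 0 <= a -> tsub a 0 = a.
Proof.
by case: a => [a| |] // a0; rewrite tsub_fin subr0 max_r.
Qed.

Lemma tsub_eq0 (a b : \bar R) : 0 <= a -> 0 <= b -> (tsub a b == 0) = (a <= b).
Proof.
case: b => [b| |] // a0 b0; last by rewrite tsub_yr leey eqxx.
case: a a0 => [a| |] // a0; rewrite tsub_fin eqe lee_fin.
by rewrite eq_maxl subr_le0.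
Qed.

(** Justifies the register [r_gap]: removing the antecedents one at a time, with truncation, amounts
    to removing their sum. *)
Lemma tsub_tsub (a b c : \bar R) : 0 <= a -> 0 <= b -> 0 <= c ->
  tsub (tsub a b) c = tsub a (b + c).
Proof.
case: b => [b| |] // a0 b0 c0; last first.
  have -> : +oo + c = +oo by case: c c0.
  by rewrite !tsub_yr; apply/eqP; rewrite tsub_eq0.
case: c c0 => [c| |] // c0; last by rewrite addey // !tsub_yr.
case: a a0 => [a| |] // a0.
rewrite !tsub_fin; congr EFin; move: b0 c0; rewrite !lee_fin => b0 c0.
by rewrite !maxEle; repeat case: ifP; lra.
Qed.

Lemma eval_ge0 (M : model R) (phi : form {nonneg R}%R) : 0 <= eval M phi.
Proof.
elim: phi => [p|||a IHa b IHb|a IHa b IHb|k a IHa] //=.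
- exact: valuation_ge0.
- exact: adde_ge0.
- exact: tsub_ge0.
- by apply: mule_ge0 => //; rewrite lee_fin.
Qed.

Definition decode (q c : nat) : \bar R :=
  if c == 0%N then +oo else (c.-1%:R / q%:R)%:E.

Variable q : nat.
Hypothesis q0 : (0 < q)%N.

Let qR : (0 < q%:R :> R)%R. Proof. by rewrite ltr0n. Qed.

Lemma decode_ge0 c : 0 <= decode q c.
Proof. by rewrite /decode; case: eqP => // _; rewrite lee_fin divr_ge0. Qed.

Lemma decodeS n : decode q n.+1 = (n%:R / q%:R)%:E.
Proof. by []. Qed.

Lemma decode_add a b c : add_code a b c -> decode q c = decode q a + decode q b.
Proof.
move=> /andP[]; case: a => [|a]; first by move=> /eqP -> _; case: b.
case: b => [|b]; first by move=> /eqP ->.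
move=> _ /=; rewrite addn0 => /eqP e.
have -> : c = (a + b).+1 by lia.
by rewrite !decodeS -EFinD -mulrDl natrD.
Qed.

Lemma decode_le a b : decode q a.+1 <= decode q b.+1 = (a <= b)%N.
Proof. by rewrite !decodeS lee_fin ler_pM2r ?invr_gt0 // ler_nat. Qed.

Lemma decode_sub b a c : sub_code b a c -> decode q c = tsub (decode q b) (decode q a).
Proof.
rewrite /sub_code /tsub; case: a => [|a] /=.
  by rewrite leey => /andP[/eqP ->] _; rewrite decodeS mul0r.
case: b => [|b] /=.
  by move=> /andP[/eqP -> _].
rewrite decode_le ltnS addn0 addn1 => /andP[h1 h2].
case: (leqP b a) h1 h2 => ba /= h1 h2.
  by rewrite (eqP h1) decodeS mul0r.
have /eqP e : (c + a.+1 == b.+2)%N by apply: implyP h2 _; lia.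
have -> : c = (b - a).+1 by lia.
by rewrite !decodeS /= -EFinB -mulrBl natrB // ltnW.
Qed.

Lemma decode_eq0 c : (decode q c == 0) = (c == 1%N).
Proof.
case: c => [|c]; first by [].
by rewrite decodeS eqe mulf_eq0 invr_eq0 (gt_eqF qR) orbF pnatr_eq0.
Qed.

Lemma decode_one : decode q q.+1 = 1.
Proof. by rewrite decodeS divff ?gt_eqF. Qed.

Lemma decode_scale (n d a c : nat) : (0 < d)%N -> (n * a = d * c)%N ->
  (n%:R / d%:R)%:E * decode q a.+1 = decode q c.+1.
Proof.
move=> d0 e; rewrite !decodeS -EFinM; congr EFin.
have dR : (d%:R != 0 :> R)%R by rewrite pnatr_eq0 -lt0n.
rewrite mulrA; congr (_ * _)%R; apply: (mulfI dR).
by rewrite mulrA mulrCA mulfV // mulr1 -!natrM e.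
Qed.

(** The truth value of [n == 0] doubles as a code: 1 is the code of the value 0, and 0 is the code
    of [+oo]. *)
Lemma decode_scale_oo (n d : nat) : (0 < d)%N ->
  (n%:R / d%:R)%:E * decode q 0 = decode q (n == 0%N).
Proof.
move=> d0; case: eqP => [->|/eqP n0]; rewrite {1}/decode /=.
  by rewrite mul0r mul0e decodeS mul0r.
by rewrite gt0_muley // lte_fin divr_gt0 ?ltr0n // lt0n.
Qed.

End Decode.

(** * What an accepted certificate says about the input word *)

Section Labelled.
Variables (w : seq token) (m : nat) (x : nat -> label).
Hypothesis wm : (size w).+1 < m.
Hypothesis adj : forall i, i.+1 < m ->
  adj_cond (i == 0%N) (onth (rev w) i) (x i) (x i.+1).
Hypothesis pair : forall i j, i < m -> j < m -> pair_cond (x i) (x j).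

Notation lab s := (x (size s)).
Definition is_suffix (s : seq token) : Prop := exists p, w = p ++ s.

Lemma is_suffix_cat p s : is_suffix (p ++ s) -> is_suffix s.
Proof. by case=> p' e; exists (p' ++ p); rewrite -catA -e. Qed.

Lemma is_suffix_cons c s : is_suffix (c :: s) -> is_suffix s.
Proof. exact: (@is_suffix_cat [:: c]). Qed.

Lemma is_suffix_size s : is_suffix s -> size s < m.
Proof. by case=> p e; move: wm; rewrite e size_cat; lia. Qed.

Lemma is_suffix_parses s phi r : is_suffix s -> parses s phi r -> is_suffix r.
Proof. by move=> hs [e _]; move: hs; rewrite e => /is_suffix_cat. Qed.

Lemma is_suffix_run s : is_suffix s -> is_suffix (after_run s).
Proof. by rewrite {1}[s]bit_run_cat => /is_suffix_cat. Qed.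

Lemma adj_suffix c s : is_suffix (c :: s) ->
  adj_cond (size s == 0%N) (Some c) (lab s) (lab (c :: s)).
Proof.
move=> hs; have := adj (is_suffix_size hs).
have -> // : onth (rev w) (size s) = Some c.
case: hs => p ->; rewrite rev_cat rev_cons cat_rcons -(size_rev s).
by elim: (rev s).
Qed.

Lemma common_suffix c s : is_suffix (c :: s) -> common_cond c (lab s) (lab (c :: s)).
Proof. by move/adj_suffix => /andP[_ /and4P[]]. Qed.
Lemma parse_suffix c s : is_suffix (c :: s) -> parse_cond c (lab s) (lab (c :: s)).
Proof. by move/adj_suffix => /andP[_ /and4P[]]. Qed.
Lemma wf_suffix_cond c s : is_suffix (c :: s) -> wf_cond c (lab s) (lab (c :: s)).
Proof. by move/adj_suffix => /andP[_ /and4P[]]. Qed.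

Lemma base_suffix : base_cond (x 0).
Proof. by have /andP[] := @adj 0 (leq_ltn_trans (ltn0Sn _) wm). Qed.

Lemma final_suffix : final_cond (lab w).
Proof.
have := adj wm; rewrite (_ : onth _ _ = None); first by case/andP.
by rewrite -size_rev; elim: (rev w).
Qed.

Lemma tok_suffix s : is_suffix s ->
  lab s r_tok = if s is c :: _ then token_index c else 0%N.
Proof.
case: s => [_|c s /common_suffix /and5P[/eqP //]].
by case/and4P: base_suffix => /eqP.
Qed.

Lemma tok_bits s : is_suffix s -> (lab s r_tok \in bits) = starts is_bit s.
Proof. by move=> /tok_suffix ->; case: s => [|[||||||||||[]]]. Qed.

Lemma tok_heads s : is_suffix s -> (lab s r_tok \in heads) = starts formula_head s.
Proof. by move=> /tok_suffix ->; case: s => [|[||||||||||[]]]. Qed.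

Lemma tok_slash s : is_suffix s -> (lab s r_tok == 7%N) = starts is_slash s.
Proof. by move=> /tok_suffix ->; case: s => [|[||||||||||[]]]. Qed.

Lemma tok_judgement s : is_suffix s -> starts_judgement (lab s) = judgement_start s.
Proof. by rewrite /starts_judgement => /tok_suffix ->; case: s => [|[||||||||||[]]]. Qed.

Lemma tok_bit1 s : is_suffix s -> (lab s r_tok == 12%N) = head false (bit_run s).
Proof. by move=> /tok_suffix ->; case: s => [|[||||||||||[]]]. Qed.

Fixpoint run_code (bs : seq bool) : nat :=
  if bs is b :: bs' then (2 * run_code bs' + b)%N else 1%N.

Lemma run_struct s : is_suffix s ->
  [/\ lab s r_after = lab (after_run s) r_pos,
      on (lab s) r_slash = starts is_slash (after_run s),
      (on (lab s) r_parses = on (lab (after_run s)) r_parses /\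
       lab s r_rest = lab (after_run s) r_rest),
      lab s r_code = run_code (bit_run s) &
      on (lab s) r_validN = valid_N (bit_run s)].
Proof.
elim: s => [|c s IH] hs.
  have /and3P[/andP[+ _] _ _] := pair (is_suffix_size hs) (is_suffix_size hs).
  rewrite tok_bits //= => /and5P[/eqP -> /eqP -> /eqP -> /negbTE -> _].
  by rewrite (@tok_slash [::]).
have [hb|hb] := boolP (is_bit c); last first.
  have hn : ~~ starts is_bit (c :: s) by [].
  have /and3P[/andP[+ _] _ _] := pair (is_suffix_size hs) (is_suffix_size hs).
  rewrite tok_bits // hn => /and5P[/eqP -> /eqP -> /eqP -> /negbTE -> _].
  by rewrite after_run_id // bit_run_nil // tok_slash.
case: c hb hs => // b _ hs.
have hs' := is_suffix_cons hs; have [h1 h2 [h3 h4] h5 h6] := IH hs'.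
have /and5P[/eqP e1 /eqP e2 /eqP -> /eqP -> /andP[/eqP -> /eqP ->]] := parse_suffix hs.
rewrite h1 h2 h3 h4 e2 tok_bits //.
split=> //; first by move: e1; rewrite h5 /=; lia.
by rewrite /valid_N /=; case: b {e1 e2 hs} => //=; case: (s) => [|[]].
Qed.

Lemma link_suffix s r : is_suffix s -> is_suffix r ->
  on (lab s) r_parses -> lab s r_rest = lab r r_pos ->
  [/\ lab s r_tok' = lab r r_tok, lab s r_wf' = lab r r_wf,
      (lab s r_parses' = lab r r_parses /\ lab s r_rest' = lab r r_rest),
      lab s r_val' = lab r r_val & lab s r_gap' = lab r r_gap].
Proof.
move=> hs hr hp e; have /and3P[_ + _] := pair (is_suffix_size hs) (is_suffix_size hr).
rewrite /link_cond hp e eqxx /=.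
by move=> /and5P[/eqP -> /eqP -> /eqP -> /eqP -> /andP[/eqP -> /eqP ->]].
Qed.

(** Only this direction is needed for soundness: an accepted word is assumed to be an encoding, and
    its rows must then acknowledge the actual parse. *)
Lemma parses_struct s phi r : is_suffix s -> parses s phi r ->
  on (lab s) r_parses /\ lab s r_rest = lab r r_pos.
Proof.
have bin c s1 a b r1 r' :
    (if c is (TTensor | TLimp) then true else false) -> is_suffix (c :: s1) ->
    parses s1 a r1 -> parses r1 b r' ->
    (on (lab s1) r_parses /\ lab s1 r_rest = lab r1 r_pos) ->
    (on (lab r1) r_parses /\ lab r1 r_rest = lab r' r_pos) ->
    on (lab (c :: s1)) r_parses /\ lab (c :: s1) r_rest = lab r' r_pos.
  move=> hc hs ha hb [h1 h2] [h3 h4]; have hs1 := is_suffix_cons hs.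
  have hr1 := is_suffix_parses hs1 ha.
  have [e1 _ [e2 e3] _ _] := link_suffix hs1 hr1 h1 h2.
  have : (on (lab (c :: s1)) r_parses == [&& lab s1 r_tok \in heads, on (lab s1) r_parses,
       lab s1 r_tok' \in heads & on (lab s1) r_parses']) &&
      (on (lab (c :: s1)) r_parses ==> (lab (c :: s1) r_rest == lab s1 r_rest')).
    by have := parse_suffix hs; case: (c) hc.
  rewrite tok_heads // (parses_formula ha) h1 e1 tok_heads // (parses_formula hb).
  rewrite /= {2}/on e2 -/(on _ _) h3 => /andP[/eqP -> /eqP ->].
  by rewrite e3.
elim: phi s r => [p|||a IHa b IHb|a IHa b IHb|k a IHa] [|c s] r hs h;
  try by have := parses_formula h.
- have ec : c = TVar by case: h => -[].
  subst c; have hs' := is_suffix_cons hs.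
  have /and3P[/eqP -> + _] := parse_suffix hs.
  have [-> _ _ _ ->] := run_struct hs'.
  by have [p' [_ -> ->]] := (parses_Var s (Var p) r).1 h; rewrite valid_bits_N => /eqP.
- have ec : c = TBot by case: h => -[].
  subst c; have hs' := is_suffix_cons hs.
  have /andP[/eqP ->] := parse_suffix hs.
  have [_ es hr] := (parses_Bot s Bot r).1 h.
  by rewrite tok_bits // es hr => /eqP.
- have ec : c = TOne by case: h => -[].
  subst c; have hs' := is_suffix_cons hs.
  have /andP[/eqP ->] := parse_suffix hs.
  have [_ es hr] := (parses_One s One r).1 h.
  by rewrite tok_bits // es hr => /eqP.
- have ec : c = TTensor by case: h => -[].
  subst c; have [a' [b' [r1 [[<- <-] ha hb]]]] := (parses_Tensor s (Tensor a b) r).1 h.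
  have hs' := is_suffix_cons hs; have hr1 := is_suffix_parses hs' ha.
  by apply: (bin _ _ a b r1) => //; [exact: IHa | exact: IHb].
- have ec : c = TLimp by case: h => -[].
  subst c; have [a' [b' [r1 [[<- <-] ha hb]]]] := (parses_Limp s (Limp a b) r).1 h.
  have hs' := is_suffix_cons hs; have hr1 := is_suffix_parses hs' ha.
  by apply: (bin _ _ a b r1) => //; [exact: IHa | exact: IHb].
- have ec : c = TScale by case: h => -[].
  subst c.
  have [k' [a' [s2 [[<- <-] h1 h2 h3 ha]]]] := (parses_Scale s (Scale k a) r).1 h.
  have hs' := is_suffix_cons hs.
  have hs2 := is_suffix_run hs'; rewrite h2 in hs2.
  have hs3 := is_suffix_cons hs2; have hs4 := is_suffix_run hs3.
  have [_ e1 [e2 e3] _ e4] := run_struct hs'.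
  have [_ e5 [e6 e7] _ _] := run_struct hs3.
  have [e8 e9] := IHa _ _ hs4 ha.
  have := parse_suffix hs2; rewrite /parse_cond tok_bit1 // h3 head_bits_pos e5 e6 e7 e8 e9.
  have -> : starts is_slash (after_run s2) = false.
    by have := parses_formula ha; case: (after_run s2) => [|[]].
  case/andP => /eqP e10; rewrite e10 => /eqP e11.
  have := parse_suffix hs; rewrite /parse_cond e1 e2 e3 e4 h1 valid_bits_N h2 e10 e11.
  by case/andP => /eqP -> /eqP ->.
Qed.

Lemma wf_struct s : wf_suffix s -> is_suffix s -> on (lab s) r_wf.
Proof.
elim=> {s} [_|s _ IH hj hs|s _ IH hj hs|s phi r h _ IH he hs|s phi r h _ IH hc hs].
- by case/and4P: base_suffix.
- have hs' := is_suffix_cons hs; have /eqP -> := wf_suffix_cond hs.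
  by rewrite IH // tok_judgement.
- have hs' := is_suffix_cons hs; have /eqP -> := wf_suffix_cond hs.
  by rewrite IH // tok_judgement.
- have hs' := is_suffix_cons hs; have /eqP -> := wf_suffix_cond hs.
  have [h1 h2] := parses_struct hs' h; have hr := is_suffix_parses hs' h.
  have [-> e _ _ _] := link_suffix hs' hr h1 h2.
  rewrite tok_heads // (parses_formula h) h1 /= {1}/on e -/(on _ _) IH //=.
  by rewrite tok_suffix //; case: (r) he => [|[]].
- have [h1 h2] := parses_struct hs h; have hr := is_suffix_parses hs h.
  have [e1 e2 _ _ _] := link_suffix hs hr h1 h2.
  have := parses_formula h.
  case: s h hs h1 h2 e1 e2 => [|c s] // h hs h1 h2 e1 e2 hf.
  have : on (lab (c :: s)) r_wf = [&& on (lab (c :: s)) r_parses,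
      on (lab (c :: s)) r_wf' & lab (c :: s) r_tok' == 8%N].
    by have /eqP := wf_suffix_cond hs; case: (c) hf.
  rewrite h1 e1 {2}/on e2 -/(on _ _) IH // => ->.
  by rewrite tok_suffix //; case: (r) hc => [|[]].
Qed.

Lemma semi_suffix s : is_suffix s -> on (lab s) r_semi = has is_semi s.
Proof.
elim: s => [_|c s IH hs]; first by case/and4P: base_suffix => _ _ _ /negbTE.
by have /and5P[_ _ /eqP -> _ _] := common_suffix hs; rewrite IH //; exact: is_suffix_cons hs.
Qed.

Lemma const_suffix s : is_suffix s ->
  lab s r_good = x 0 r_good /\ lab s r_unit = x 0 r_unit.
Proof.
elim: s => [_|c s IH hs] //.
have /and5P[_ _ _ /eqP -> /eqP ->] := common_suffix hs.
exact: IH (is_suffix_cons hs).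
Qed.

Section Values.
Hypothesis good : on (lab w) r_good.

Let q := lab w r_unit.

Lemma is_suffix_self : is_suffix w. Proof. by exists [::]. Qed.

Lemma good_suffix s : is_suffix s -> on (lab s) r_good.
Proof.
move=> hs; have [e _] := const_suffix hs; have [e' _] := const_suffix is_suffix_self.
by rewrite /on e -e'.
Qed.

Lemma unit_suffix s : is_suffix s -> lab s r_unit = q.
Proof.
move=> hs; have [_ e] := const_suffix hs; have [_ e'] := const_suffix is_suffix_self.
by rewrite e -e'.
Qed.

Lemma unit_gt0 : (0 < q)%N.
Proof.
have hw := is_suffix_size is_suffix_self.
have /and3P[/andP[_ +] _ _] := pair hw hw.
by rewrite good lt0n.
Qed.

Lemma value_suffix c s : is_suffix (c :: s) -> value_cond c (lab s) (lab (c :: s)).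
Proof.
move=> hs; have /andP[_ /and4P[_ _ _]] := adj_suffix hs.
by rewrite good_suffix // => /andP[].
Qed.

Lemma gap_suffix c s : is_suffix (c :: s) -> gap_cond c (lab (c :: s)).
Proof.
move=> hs; have /andP[_ /and4P[_ _ _]] := adj_suffix hs.
by rewrite good_suffix // => /andP[].
Qed.

Lemma run_value s : is_suffix s -> let r := after_run s in
  [/\ lab s r_val = lab r r_val, lab s r_quot = lab r r_quot,
      lab s r_dprod = lab r r_dprod,
      lab s r_prod = (bits_val (bit_run s) * lab r r_shift)%N &
      lab s r_shift = (2 ^ size (bit_run s) * lab r r_shift)%N].
Proof.
elim: s => [hs|c s IH hs] /=.
  split=> //; last by rewrite mul1n.
  have /and3P[/andP[+ _] _ _] := pair (is_suffix_size hs) (is_suffix_size hs).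
  by rewrite tok_bits // => /and5P[_ _ _ _ /andP[/eqP]].
have [hb|hb] := boolP (is_bit c); last first.
  have hn : ~~ starts is_bit (c :: s) by [].
  have := after_run_id hn; rewrite /= => ->; have := bit_run_nil hn; rewrite /= => ->.
  split=> //; last by rewrite mul1n.
  have /and3P[/andP[+ _] _ _] := pair (is_suffix_size hs) (is_suffix_size hs).
  by rewrite tok_bits // hn => /and5P[_ _ _ _ /andP[/eqP]].
case: c hb hs => // b _ hs; have [h1 h2 h3 h4 h5] := IH (is_suffix_cons hs).
have /and5P[/eqP e1 /eqP e2 /eqP e3 /eqP e4 /eqP e5] := value_suffix hs.
rewrite e1 e2 e3 h1 h2 h3; split=> //.
  by move: e4; rewrite h4 h5 bits_val_cons mulnDl; case: (b) => /=; lia.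
by move: e5; rewrite h5 /= expnS; lia.
Qed.

Variable R : realType.

Definition letter_suffix (p : nat) (s : seq token) : Prop :=
  is_suffix (TVar :: s) /\ bit_run s = bits_N (bin_of_nat p).

(** Reads the value from an arbitrarily chosen occurrence of the letter; [letter_cond] makes the
    choice immaterial. Letters that do not occur get 0. *)
Definition letter_val (p : nat) : \bar R :=
  if pselect (exists s, letter_suffix p s) is left h
  then decode R q (lab (TVar :: projT1 (cid h)) r_val) else 0%E.

Lemma letter_val_ge0 p : (0 <= letter_val p)%E.
Proof. by rewrite /letter_val; case: pselect => // h; exact: decode_ge0. Qed.

Definition row_model : model R := Model letter_val_ge0.

Lemma letter_valE p s : letter_suffix p s ->
  letter_val p = decode R q (lab (TVar :: s) r_val).
Proof.
move=> hs; rewrite /letter_val; case: pselect => [h|[]]; last by exists s.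
case: (cid h) => s' [h1 h2] /=; case: hs => h3 h4.
have /and3P[_ _] := pair (is_suffix_size h1) (is_suffix_size h3).
rewrite /letter_cond !good_suffix // !tok_suffix //.
have /and3P[_ _ /eqP ->] := parse_suffix h1.
have /and3P[_ _ /eqP ->] := parse_suffix h3.
have [_ _ _ -> _] := run_struct (is_suffix_cons h1).
have [_ _ _ -> _] := run_struct (is_suffix_cons h3).
by rewrite h2 h4 eqxx /= => /eqP ->.
Qed.

Notation ev phi := (eval row_model (map_form (frac_val R) phi)).

Lemma eval_suffix s phi r : is_suffix s -> parses s phi r ->
  ev phi = decode R q (lab s r_val).
Proof.
elim: phi s r => [p|||a IHa b IHb|a IHa b IHb|k a IHa] [|c s] r hs h;
  try by have := parses_formula h.
- have ec : c = TVar by case: h => -[].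
  subst c; have [p' [[<-] e _]] := (parses_Var s (Var p) r).1 h.
  exact: letter_valE.
- have ec : c = TBot by case: h => -[].
  subst c; have [hp _] := parses_struct hs h.
  by have := value_suffix hs; rewrite /value_cond hp => /eqP ->.
- have ec : c = TOne by case: h => -[].
  subst c; have [hp _] := parses_struct hs h.
  have := value_suffix hs; rewrite /value_cond hp !addn0 addn1 => /eqP <-.
  by rewrite unit_suffix // decode_one // unit_gt0.
- have ec : c = TTensor by case: h => -[].
  subst c; have [hp _] := parses_struct hs h.
  have [a' [b' [r1 [[<- <-] ha hb]]]] := (parses_Tensor s (Tensor a b) r).1 h.
  have hs' := is_suffix_cons hs; have hr1 := is_suffix_parses hs' ha.
  have [h1 h2] := parses_struct hs' ha; have [_ _ _ e _] := link_suffix hs' hr1 h1 h2.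
  have := value_suffix hs; rewrite /value_cond hp e /=.
  move=> /decode_add -> //; last exact: unit_gt0.
  by rewrite -(IHa _ _ hs' ha) -(IHb _ _ hr1 hb).
- have ec : c = TLimp by case: h => -[].
  subst c; have [hp _] := parses_struct hs h.
  have [a' [b' [r1 [[<- <-] ha hb]]]] := (parses_Limp s (Limp a b) r).1 h.
  have hs' := is_suffix_cons hs; have hr1 := is_suffix_parses hs' ha.
  have [h1 h2] := parses_struct hs' ha; have [_ _ _ e _] := link_suffix hs' hr1 h1 h2.
  have := value_suffix hs; rewrite /value_cond hp e /=.
  move=> /decode_sub -> //; last exact: unit_gt0.
  by rewrite -(IHa _ _ hs' ha) -(IHb _ _ hr1 hb).
- have ec : c = TScale by case: h => -[].
  subst c; have [hp _] := parses_struct hs h.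
  have [k' [a' [s2 [[<- <-] h1 h2 h3 ha]]]] := (parses_Scale s (Scale k a) r).1 h.
  have hs' := is_suffix_cons hs.
  have hs2 := is_suffix_run hs'; rewrite h2 in hs2.
  have hs3 := is_suffix_cons hs2; have hs4 := is_suffix_run hs3.
  have hp2 : on (lab (TSlash :: s2)) r_parses.
    have [h4 _] := parses_struct hs4 ha.
    have /andP[/eqP -> _] := parse_suffix hs2.
    have [_ -> [-> _] _ _] := run_struct hs3; rewrite tok_bit1 // h3 head_bits_pos h4 /=.
    by have := parses_formula ha; case: (after_run s2) => [|[]].
  have [v1 c1 d1 p1 _] := run_value hs'; rewrite h2 in v1 c1 d1 p1.
  have [v3 c3 _ p3 _] := run_value hs3.
  have := value_suffix hs2; rewrite /value_cond hp2 => /and3P[/eqP v2 /eqP c2 /eqP d2].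
  (* The two starting multiplicands: the argument's numerator at the slash, and, in [sh4], the
     guessed quotient at the argument itself. *)
  have sh2 : lab (TSlash :: s2) r_val != 0%N ->
      (lab (TSlash :: s2) r_shift).+1 = lab (TSlash :: s2) r_val.
    move=> v0; have /and3P[/andP[+ _] _ _] := pair (is_suffix_size hs2) (is_suffix_size hs2).
    rewrite tok_bits // tok_slash // => /and5P[_ _ _ _ /and3P[_ + _]].
    by rewrite /= v0 !addn0 addn1 => /eqP.
  have sh4 : lab (after_run s2) r_shift = lab (after_run s2) r_quot.
    have /and3P[/andP[+ _] _ _] := pair (is_suffix_size hs4) (is_suffix_size hs4).
    rewrite tok_bits // after_run_nobit tok_slash // => /and5P[_ _ _ _ /and3P[_ _ +]].
    by have := parses_formula ha; case: (after_run s2) => [|[]] //= ? _ /eqP.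
  have den0 : (0 < nat_of_bin (Npos (fden k)))%N.
    by rewrite lt0n -(bits_N_neq0 (Npos (fden k))) /= head_bits_pos.
  have := value_suffix hs; rewrite /value_cond hp => /and4P[].
  rewrite tok_bit1 // h1 bits_N_neq0 v1 => i1 i2 i3 i4.
  have eva : ev a = decode R q (lab (TSlash :: s2) r_val) by rewrite v2 v3; exact: IHa hs4 ha.
  rewrite [LHS]/= eva.
  rewrite -[(_ / _)%R]/((nat_of_bin (fnum k))%:R / (nat_of_bin (Npos (fden k)))%:R)%R.
  have [v0|v0] := eqVneq (lab (TSlash :: s2) r_val) 0%N.
    rewrite v0 decode_scale_oo //; move: i1 i2; rewrite v0 /=.
    by case: eqP => _ /=; rewrite ?implybT => h4 h5; rewrite ?(eqP h4) ?(eqP h5).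
  move: i3 i4 (sh2 v0); rewrite v0 /= !addn0 addn1 => /eqP <- /eqP i4 <-.
  apply: decode_scale => //.
  (* Unfolding both accumulated products along their digit runs turns the comparison at [TScale]
     into numerator times argument equals denominator times quotient. *)
  move: i4; rewrite p1 d1 d2 p3 sh4 h1 h3 c1 c2 c3.
  by rewrite bits_val_N bits_val_pos.
Qed.

Definition judgement_gap (j : judgement frac) : \bar R :=
  foldr (fun phi acc => tsub acc (ev phi)) (ev (succedent j)) (antecedents j).

Lemma judgement_gapE j : (judgement_gap j == 0%E) <->
  satisfies row_model (map_judgement (frac_val R) j).
Proof.
case: j => fs psi; rewrite /judgement_gap /satisfies /=.
have sum_ge0 l : (0 <= \sum_(phi <- map (map_form (frac_val R)) l) eval row_model phi)%E.
  by apply: sume_ge0 => phi _; exact: eval_ge0.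
have -> : foldr (fun phi acc => tsub acc (ev phi)) (ev psi) fs =
    tsub (ev psi) (\sum_(phi <- map (map_form (frac_val R)) fs) eval row_model phi)%E.
  elim: fs => [|phi fs IH] /=; first by rewrite big_nil tsub0 // eval_ge0.
  by rewrite IH big_cons tsub_tsub ?eval_ge0 // addeC.
by rewrite tsub_eq0 // eval_ge0.
Qed.

Lemma gap_judgement j r : is_suffix (enc_judgement j ++ r) -> wf_suffix r ->
  judgement_end r ->
  judgement_gap j = decode R q (lab (enc_judgement j ++ r) r_gap).
Proof.
case: j => fs psi hs hr he; rewrite /judgement_gap /=.
have nobit : ~~ starts is_bit r by case: (r) he => [|[]].
elim: fs hs => [|phi fs IH] hs /=.
  have h : parses (enc_form psi ++ r) psi r by [].
  rewrite (eval_suffix (is_suffix_cons hs) h).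
  have := value_suffix hs; rewrite /value_cond wf_struct //; last exact: wf_vdash h hr he.
  by move=> /eqP ->.
set s := enc_judgement (Judgement fs psi) ++ r.
have es : enc_judgement (Judgement (phi :: fs) psi) ++ r = enc_form phi ++ TComma :: s.
  by rewrite enc_judgement_cons -catA.
rewrite es in hs *; have hs1 : is_suffix (TComma :: s) := is_suffix_cat hs.
have hs2 := is_suffix_cons hs1; rewrite (IH hs2).
have h : parses (enc_form phi ++ TComma :: s) phi (TComma :: s) by [].
have [hp1 hp2] := parses_struct hs h.
have [_ _ _ _ eg] := link_suffix hs hs1 hp1 hp2.
rewrite (eval_suffix hs h); apply/esym/decode_sub; first exact: unit_gt0.
have [hw1 hw2] := wf_enc_judgement (Judgement fs psi) hr he.
have hw : wf_suffix (enc_form phi ++ TComma :: s).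
  by apply: wf_formula h _ _ => //; exact: wf_comma.
have := wf_struct hw hs; have := parses_formula h.
have /eqP <- : lab (TComma :: s) r_gap == lab s r_gap := value_suffix hs1.
rewrite -eg; case: (enc_form phi ++ TComma :: s) hs => [|c s'] // hs hc hw'.
by have := gap_suffix hs; rewrite /gap_cond (hc : formula_head c = true) hw'.
Qed.

Lemma no_semi_form phi : has is_semi (enc_form phi) = false.
Proof.
have nb bs : has is_semi (enc_bits bs) = false by elim: bs.
by elim: phi => [p|||a IHa b IHb|a IHa b IHb|k a IHa] //=;
  rewrite ?has_cat /= ?has_cat ?nb ?IHa ?IHb.
Qed.

Lemma no_semi_judgement j : has is_semi (enc_judgement j) = false.
Proof.
case: j => fs psi; elim: fs => [|phi fs IH]; first by rewrite /= no_semi_form.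
by rewrite enc_judgement_cons has_cat no_semi_form /= IH.
Qed.

Lemma judgement_satisfied j r : is_suffix (enc_judgement j ++ r) -> wf_suffix r ->
  judgement_end r ->
  satisfies row_model (map_judgement (frac_val R) j) <->
  lab (enc_judgement j ++ r) r_gap == 1%N.
Proof.
move=> hs hr he.
by rewrite -judgement_gapE (gap_judgement hs hr he) decode_eq0 // unit_gt0.
Qed.

(** A semicolon imposes [judgement_cond] on the judgement behind it, so the conditions on all
    judgements but the first come from the rows, and that on the first is a hypothesis. *)
Lemma instance_refuted S g : is_suffix (encode (Instance S g)) ->
  judgement_cond (lab (encode (Instance S g))) ->
  (forall j, List.In j S -> satisfies row_model (map_judgement (frac_val R) j)) /\
  ~ satisfies row_model (map_judgement (frac_val R) g).
Proof.
elim: S => [|j S IH] hs; rewrite /judgement_cond semi_suffix //.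
  have -> : encode (Instance [::] g) = enc_judgement g ++ [::] by rewrite cats0.
  rewrite cats0 no_semi_judgement /= => hg; split=> //.
  have := @judgement_satisfied g [::]; rewrite cats0 => hj.
  by move/(hj hs wf_nil isT); apply/negP.
rewrite encode_cons in hs *; rewrite has_cat /= orbT /= andbT => hj.
have [hw1 hw2] := wf_encode (Instance S g).
have hs1 : is_suffix (TSemi :: encode (Instance S g)) := is_suffix_cat hs.
have hw3 : wf_suffix (TSemi :: encode (Instance S g)) := wf_semi hw1 hw2.
have [h1 h2] := IH (is_suffix_cons hs1) (implyP (value_suffix hs1) (wf_struct hw3 hs1)).
split=> // j' [<-|]; last exact: h1.
exact/(judgement_satisfied hs hw3 isT).
Qed.

End Values.

Lemma labelled_refutes (R : realType) : ~ AL_consequence R w.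
Proof.
case=> inst [ew hval].
have hs := is_suffix_self; have /andP[/eqP hg hj] := final_suffix.
have [hw1 hw2] := wf_encode inst; rewrite -ew in hw1 hw2.
have good : on (lab w) r_good by rewrite hg wf_struct // tok_judgement.
move: hj; rewrite good /= => hj.
case: inst ew hval {hw1 hw2} => S g ew hval.
rewrite ew in hs hj; have [h1 h2] := instance_refuted good R hs hj.
apply: h2; apply: hval; rewrite /=.
elim: S h1 {ew hs hj} => [|j0 S IH] h1 //= j [<-|hj]; first by apply: h1; left.
by apply: IH hj => j' hj'; apply: h1; right.
Qed.

End Labelled.

(** * Rows computed from an input word *)

Lemma wf_suffixE s : wf_suffix s <->
  match s with
  | [::] => True
  | TSemi :: s1 | TComma :: s1 => wf_suffix s1 /\ judgement_start s1
  | TVdash :: s1 => exists phi r, [/\ parses s1 phi r, wf_suffix r & judgement_end r]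
  | _ => exists phi r, [/\ parses s phi r, wf_suffix r & starts is_comma r]
  end.
Proof.
split.
- case=> {s} [|s h1 h2|s h1 h2|s phi r h1 h2 h3|s phi r h1 h2 h3] //.
    by exists phi, r.
  have := parses_formula h1; case: s h1 => [|[] s] // h1 _; by exists phi, r.
- case: s => [_|[||||||||||b] s];
    try (by case=> phi [r [h1 h2 h3]]; exact: wf_formula h1 h2 h3).
  + exact: wf_nil.
  + by case; exact: wf_comma.
  + by case=> phi [r [h1 h2 h3]]; exact: wf_vdash h1 h2 h3.
  + by case; exact: wf_semi.
Qed.

Lemma run_code_gt0 bs : (0 < run_code bs)%N.
Proof. by elim: bs => [|b bs IH] //=; lia. Qed.

Lemma run_code_inj : injective run_code.
Proof.
elim=> [|b bs IH] [|c cs] //=.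
- by have := run_code_gt0 cs; lia.
- by have := run_code_gt0 bs; lia.
move=> e; have [-> /IH ->] : b = c /\ run_code bs = run_code cs.
  by case: b c e => -[]; lia.
by [].
Qed.

Lemma run_code_lt bs : (run_code bs < 2 ^ (size bs).+1)%N.
Proof. by elim: bs => [|b bs IH] //=; move: IH; rewrite !expnS; case: b; lia. Qed.

Lemma rest_suffix s r : rest s = Some r -> exists p, s = p ++ r.
Proof.
elim: s => [|c s IH]; first by rewrite rest_other.
case hc : (formula_head c).
  have [+ _] := restP r (hc : starts formula_head (c :: s)).
  by move=> h /h [phi [-> _]]; exists (enc_form phi).
case: c hc => //= [_|_|_|_|b _]; rewrite ?parse_None //.
  by case: ifP => // _ /IH[p ->]; exists (TSlash :: p).
by move/IH => [p ->]; exists (TBit b :: p).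
Qed.

(** * Rows that meet the structural conditions for arbitrary value functions *)

Section Reference.
Variables (val gap quot : seq token -> nat) (unit good : nat).

Definition tok_of (s : seq token) : nat :=
  if s is c :: _ then token_index c else 0.

Definition pos_of (s : seq token) : nat := (2 ^ size s).-1.

Definition name_of (s : seq token) : nat :=
  if s is TVar :: s1 then run_code (bit_run s1) else 0.

Definition base_of (r : seq token) : nat :=
  if starts is_slash r then (val r).-1 else quot r.

Definition shift_of (s : seq token) : nat :=
  (2 ^ size (bit_run s) * base_of (after_run s))%N.

Definition prod_of (s : seq token) : nat :=
  (bits_val (bit_run s) * base_of (after_run s))%N.

Definition dprod_of (s : seq token) : nat :=
  if after_run s is TSlash :: s2 then prod_of s2 else 0.

Definition at_rest (s : seq token) (f : seq token -> nat) : nat :=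
  if rest s is Some r then f r else 0.

Definition wf_bool (s : seq token) : bool := `[< wf_suffix s >].

Definition registers (s : seq token) : seq nat :=
  [:: tok_of s; pos_of s; run_code (bit_run s); nat_of_bool (valid_N (bit_run s));
    pos_of (after_run s); nat_of_bool (starts is_slash (after_run s));
    nat_of_bool (rest s != None); at_rest s pos_of;
    at_rest s tok_of; at_rest s (fun r => wf_bool r); at_rest s (fun r => rest r != None);
    at_rest s (fun r => at_rest r pos_of); at_rest s val; at_rest s gap;
    nat_of_bool (wf_bool s); name_of s; val s; quot s; prod_of s; shift_of s; dprod_of s;
    unit; good; gap s; nat_of_bool (has is_semi s)].

Definition label_of (s : seq token) : label := nth 0 (registers s).

Lemma label_ofE s :
  ((label_of s r_tok = tok_of s) * (label_of s r_pos = pos_of s) *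
   (label_of s r_code = run_code (bit_run s)) *
   (label_of s r_validN = valid_N (bit_run s)) *
   (label_of s r_after = pos_of (after_run s)) *
   (label_of s r_slash = starts is_slash (after_run s)) *
   (label_of s r_parses = (rest s != None)) * (label_of s r_rest = at_rest s pos_of) *
   (label_of s r_tok' = at_rest s tok_of) *
   (label_of s r_wf' = at_rest s (fun r => wf_bool r)) *
   (label_of s r_parses' = at_rest s (fun r => rest r != None)) *
   (label_of s r_rest' = at_rest s (fun r => at_rest r pos_of)) *
   (label_of s r_val' = at_rest s val) * (label_of s r_gap' = at_rest s gap) *
   (label_of s r_wf = wf_bool s) * (label_of s r_name = name_of s) *
   (label_of s r_val = val s) * (label_of s r_quot = quot s) *
   (label_of s r_prod = prod_of s) * (label_of s r_shift = shift_of s) *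
   (label_of s r_dprod = dprod_of s) * (label_of s r_unit = unit) *
   (label_of s r_good = good) * (label_of s r_gap = gap s) *
   (label_of s r_semi = has is_semi s))%type.
Proof. by []. Qed.

Lemma on_bool (x : label) k (b : bool) : x k = b -> on x k = b.
Proof. by rewrite /on => ->; case: b. Qed.

Lemma tok_of_bits s : (tok_of s \in bits) = starts is_bit s.
Proof. by case: s => [|[||||||||||[]]]. Qed.

Lemma tok_of_heads s : (tok_of s \in heads) = starts formula_head s.
Proof. by case: s => [|[||||||||||[]]]. Qed.

Lemma tok_of_slash s : (tok_of s == 7) = starts is_slash s.
Proof. by case: s => [|[||||||||||[]]]. Qed.

Lemma tok_of_comma s : (tok_of s == 8) = starts is_comma s.
Proof. by case: s => [|[||||||||||[]]]. Qed.

Lemma tok_of_end s : (tok_of s \in [:: 0; 10]) = judgement_end s.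
Proof. by case: s => [|[||||||||||[]]]. Qed.

Lemma tok_of_judgement s : (tok_of s \in 9 :: heads) = judgement_start s.
Proof. by case: s => [|[||||||||||[]]]. Qed.

Lemma tok_of_bit1 s : (tok_of s == 12) = head false (bit_run s).
Proof. by case: s => [|[||||||||||[]]]. Qed.

Lemma on_parses s : on (label_of s) r_parses = (rest s != None).
Proof. exact: on_bool. Qed.

Lemma on_validN s : on (label_of s) r_validN = valid_N (bit_run s).
Proof. exact: on_bool. Qed.

Lemma on_slash s : on (label_of s) r_slash = starts is_slash (after_run s).
Proof. exact: on_bool. Qed.

Lemma on_wf s : on (label_of s) r_wf = wf_bool s.
Proof. exact: on_bool. Qed.

Lemma on_semi s : on (label_of s) r_semi = has is_semi s.
Proof. exact: on_bool. Qed.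

Lemma on_wf' s : on (label_of s) r_wf' = if rest s is Some r then wf_bool r else false.
Proof. by apply: on_bool; rewrite label_ofE /at_rest; case: (rest s). Qed.

Lemma on_parses' s :
  on (label_of s) r_parses' = if rest s is Some r then rest r != None else false.
Proof. by apply: on_bool; rewrite label_ofE /at_rest; case: (rest s). Qed.

Definition on_labels :=
  (on_parses, on_validN, on_slash, on_wf, on_semi, on_wf', on_parses').

Lemma row_cond_of s : (good = 1 -> unit != 0) -> row_cond (label_of s).
Proof.
move=> hu; rewrite /row_cond !on_labels.
rewrite !label_ofE tok_of_bits tok_of_slash.
apply/andP; split; last by apply/implyP => /eqP /hu.
apply/implyP => nb; rewrite /prod_of /shift_of after_run_id // bit_run_nil //=.
rewrite !eqxx /= mul1n /base_of; case: ifP => hs /=; last by rewrite eqxx.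
by rewrite andbT; apply/implyP => v0; rewrite !addn0 addn1 prednK // lt0n.
Qed.

Lemma common_cond_of c s : common_cond c (label_of s) (label_of (c :: s)).
Proof.
rewrite /common_cond !on_labels !label_ofE /= !eqxx /= ?andbT.
by rewrite /pos_of /= expnS; have := expn_gt0 2 (size s); lia.
Qed.

Lemma rest_none_other c s : ~~ formula_head c -> ~~ is_bit c -> ~~ is_slash c ->
  rest (c :: s) = None.
Proof. by move=> h1 h2 h3; apply: rest_other. Qed.

Lemma parse_cond_of c s : parse_cond c (label_of s) (label_of (c :: s)).
Proof.
have bin : (rest2 s != None) == [&& starts formula_head s, rest s != None,
      tok_of (odflt [::] (rest s)) \in heads &
      if rest s is Some r then rest r != None else false].
  rewrite /rest2; case: ifP => //= _; case: (rest s) => //= r.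
  by rewrite tok_of_heads; case: ifP.
have tok' : at_rest s tok_of = tok_of (odflt [::] (rest s)).
  by rewrite /at_rest; case: (rest s).
have rest2_pos : rest2 s != None ->
    (if rest2 s is Some r then pos_of r else 0) = at_rest s (fun r => at_rest r pos_of).
  rewrite /rest2 /at_rest; case: ifP => // _; case: (rest s) => // r; by case: ifP.
case: c => /=; rewrite ?on_labels ?label_ofE ?[rest (TVar :: _)]rest_Var ?rest_Bot
  ?rest_One ?rest_Tensor ?rest_Limp ?rest_Scale.
- rewrite /at_rest rest_Var eqxx andbT.
  by case: ifP => //= _; rewrite eqxx.
- rewrite tok_of_bits /at_rest rest_Bot.
  by case: ifP => //= _; rewrite eqxx.
- rewrite tok_of_bits /at_rest rest_One.
  by case: ifP => //= _; rewrite eqxx.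
- rewrite tok' tok_of_heads bin /=.
  rewrite /at_rest rest_Tensor; apply/implyP => /rest2_pos ->; exact: eqxx.
- rewrite tok' tok_of_heads bin /=.
  rewrite /at_rest rest_Limp; apply/implyP => /rest2_pos ->; exact: eqxx.
- rewrite /at_rest rest_Scale.
  by case: (valid_N _); case: (starts _ _) => //=; rewrite !eqxx ?implybT.
- rewrite tok_of_bit1 /at_rest /=.
  by case: (head _ _); case: (starts _ _) => //=; rewrite !eqxx ?implybT.
- by rewrite rest_none_other.
- by rewrite rest_none_other.
- by rewrite rest_none_other.
- move=> b; rewrite !on_labels !label_ofE tok_of_bits /= !eqxx /= andbT.
  apply/andP; split; first by rewrite addn0 mul2n addnn.
  by rewrite /valid_N /=; case: b => //=; case: (s) => [|[]].
Qed.

Lemma wf_cond_of c s : wf_cond c (label_of s) (label_of (c :: s)).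
Proof.
rewrite /wf_cond !on_labels; apply/eqP.
have iff (b : bool) : (wf_suffix (c :: s) <-> b) -> wf_bool (c :: s) = b.
  by move=> h; apply/asboolP/idP => /h.
have head : formula_head c -> wf_bool (c :: s) =
  [&& rest (c :: s) != None,
      (if rest (c :: s) is Some r then wf_bool r else false) &
      label_of (c :: s) r_tok' == 8%N].
  move=> hc; apply: iff; rewrite !label_ofE /at_rest.
  have hs : starts formula_head (c :: s) by [].
  split=> [/wf_suffixE h|].
    have {h} [phi [r [h1 h2 h3]]] : exists phi r,
        [/\ parses (c :: s) phi r, wf_suffix r & starts is_comma r].
      by case: c hc h {hs}.
    rewrite (_ : rest (c :: s) = Some r) /=; last by apply/(restP r hs); exists phi.
    by rewrite tok_of_comma h3 andbT; apply/asboolP.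
  case e : (rest (c :: s)) => [r|] //= /andP[/asboolP hr]; rewrite tok_of_comma => hc'.
  have [/(_ e)[phi hphi] _] := restP r hs.
  exact: wf_formula hphi hr hc'.
case: c iff head => [||||||||||b] iff head; try exact: head.
- by apply: iff; split=> // /wf_suffixE[phi [r [/parses_formula]]].
- apply: iff; rewrite /starts_judgement label_ofE tok_of_judgement.
  split=> [/wf_suffixE[h1 h2]|/andP[/asboolP h1 h2]]; last exact: wf_comma.
  by rewrite h2 andbT; apply/asboolP.
- apply: iff; rewrite !label_ofE tok_of_heads /at_rest.
  split=> [/wf_suffixE[phi [r [h1 h2 h3]]]|/and4P[hs]].
    have hs := parses_formula h1; rewrite hs.
    rewrite (_ : rest s = Some r) /=; last by apply/(restP r hs); exists phi.
    by rewrite tok_of_end h3 andbT; apply/asboolP.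
  case e : (rest s) => [r|] //= _ /asboolP hr; rewrite tok_of_end => he.
  have [/(_ e)[phi hphi] _] := restP r hs.
  exact: wf_vdash hphi hr he.
- apply: iff; rewrite /starts_judgement label_ofE tok_of_judgement.
  split=> [/wf_suffixE[h1 h2]|/andP[/asboolP h1 h2]]; last exact: wf_semi.
  by rewrite h2 andbT; apply/asboolP.
- by apply: iff; split=> // /wf_suffixE[phi [r [/parses_formula]]].
Qed.

Variable w : seq token.
Local Notation L := label_of.

Definition suffix_at (t : nat) : seq token := drop (size w - t) w.

Lemma suffix_atE s : is_suffix w s -> suffix_at (size s) = s.
Proof.
by case=> p e; rewrite /suffix_at e size_cat addnK drop_size_cat.
Qed.

Lemma size_suffix_at t : t <= size w -> size (suffix_at t) = t.
Proof. by move=> tw; rewrite size_drop subKn. Qed.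

Lemma is_suffix_at t : is_suffix w (suffix_at t).
Proof. by exists (take (size w - t) w); rewrite cat_take_drop. Qed.

Lemma suffix_atS t : t < size w -> exists2 c,
  suffix_at t.+1 = c :: suffix_at t & onth (rev w) t = Some c.
Proof.
move=> tw; have [p e] := is_suffix_at t.+1.
have := size_suffix_at tw; case es : (suffix_at t.+1) => [|c s] //= [hs].
have hsuf : is_suffix w s by exists (rcons p c); rewrite cat_rcons -es.
exists c; first by rewrite -hs suffix_atE.
rewrite e es rev_cat rev_cons cat_rcons -hs -(size_rev s).
by elim: (rev s).
Qed.

(* The condition on the complete word is read off the row of [w] only if another
   row follows; nothing points to this one. *)
Definition last_row : label :=
  nth 0 [:: 0; (2 ^ (size w).+1).-1; 1; 0; (2 ^ (size w).+1).-1].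

Definition reference (t : nat) : label :=
  if t <= size w then L (suffix_at t) else last_row.

Lemma pos_of_inj s s' : pos_of s = pos_of s' -> size s = size s'.
Proof.
rewrite /pos_of => e; apply/eqP; rewrite -(@eqn_exp2l 2) //.
by have := expn_gt0 2 (size s); have := expn_gt0 2 (size s'); lia.
Qed.

Section Bound.
Variable e : nat.
Hypothesis val_le : forall s, val s <= 2 ^ e.
Hypothesis gap_le : forall s, gap s <= 2 ^ e.
Hypothesis quot_le : forall s, quot s <= 2 ^ e.
Hypothesis unit_le : unit <= 2 ^ e.
Hypothesis good_le : good <= 1.

(** The largest registers are products of a run of digits with a number up to [2 ^ e]. The extra 4
    bits accommodate token indices, which stay below 16, and the end marker of [run_code]. *)
Lemma label_of_bound s j : size s <= size w -> label_of s j < 2 ^ (size w + e + 4).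
Proof.
move=> hs; set B := 2 ^ _.
have B16 : 16 <= B by rewrite -[16]/(2 ^ 4) leq_exp2l //; lia.
have powB k : k <= size w + e + 3 -> 2 ^ k < B by move=> hk; rewrite ltn_exp2l //; lia.
have leB v : v <= 2 ^ e -> v < B by move=> h; apply: leq_ltn_trans h (powB _ _); lia.
have boolB (b : bool) : b < B by apply: leq_trans B16; case: b.
have tokB r : tok_of r < B by apply: leq_trans B16; case: r => [|[||||||||||[]]].
have posB r : size r <= size w -> pos_of r < B.
  move=> hr; apply: leq_ltn_trans (powB (size r) _); last by lia.
  by rewrite /pos_of leq_pred.
have runS r : size (bit_run r) + size (after_run r) = size r.
  by rewrite [in RHS](bit_run_cat r) size_cat size_map.
have codeB r : size r <= size w -> run_code (bit_run r) < B.
  move=> hr; apply: ltn_trans (run_code_lt _) (powB _ _).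
  by have := runS r; lia.
have atB r (f : seq token -> nat) :
    (forall r', size r' <= size r -> f r' < B) -> at_rest r f < B.
  rewrite /at_rest; case h : (rest r) => [r'|] hf; last exact: (boolB false).
  by apply: hf; have [p ->] := rest_suffix h; rewrite size_cat leq_addl.
have baseB r : base_of r <= 2 ^ e.
  by rewrite /base_of; case: ifP => // _; apply: leq_trans (leq_pred _) _.
have mulB k l r : l <= 2 ^ k -> k <= size w -> l * base_of r < B.
  move=> hl hk; apply: (@leq_ltn_trans (2 ^ (k + e))); last by apply: powB; lia.
  by rewrite expnD leq_mul.
have prodB r : size r <= size w -> prod_of r < B.
  move=> hr; apply: (mulB (size (bit_run r))); first exact: ltnW (bits_val_lt _).
  by have := runS r; lia.
suff /allP h : all (fun v => v < B) (registers s).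
  have [jl|jl] := ltnP j (size (registers s)); first by apply: h; rewrite mem_nth.
  by rewrite /label_of nth_default //; exact: (boolB false).
have le_run : size (after_run s) <= size w by have := runS s; lia.
have goodB : good < B by apply: leq_trans B16; move: good_le; lia.
have nestB : at_rest s (at_rest^~ pos_of) < B.
  by apply: (atB s) => r hr; apply: (atB r) => r' hr'; apply: posB; lia.
have shiftB : shift_of s < B.
  by apply: (mulB (size (bit_run s))) => //; have := runS s; lia.
have dprodB : dprod_of s < B.
  rewrite /dprod_of; case h : (after_run s) => [|[] s2]; try exact: (boolB false).
  by apply: prodB; rewrite h in le_run; apply: leq_trans le_run; exact: leqnSn.
have nameB : name_of s < B.
  rewrite /name_of; case: s hs {le_run nestB shiftB dprodB} => [|[||||||||||b] s'] hs;
    try exact: (boolB false).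
  by apply: codeB; apply: leq_trans hs; exact: leqnSn.
rewrite /= !boolB tokB codeB // !posB // goodB nestB shiftB dprodB nameB prodB //.
rewrite !atB ?leB // => r hr;
  first [exact: boolB | exact: posB (leq_trans hr hs) | exact: leB].
Qed.

Lemma reference_bound t : t < (size w).+2 ->
  (forall j, reference t j < 2 ^ (size w + e + 4)) /\
  (forall j, nregs <= j -> reference t j = 0).
Proof.
move=> ht; rewrite /reference; case: ifP => [tw|_].
  split=> [j|j hj]; last by rewrite /label_of nth_default.
  by apply: label_of_bound; rewrite size_suffix_at.
have h k : k <= size w + e + 3 -> 2 ^ k < 2 ^ (size w + e + 4).
  by move=> hk; rewrite ltn_exp2l //; lia.
have hp : (2 ^ (size w).+1).-1 < 2 ^ (size w + e + 4).
  by apply: leq_ltn_trans (leq_pred _) (h _ _); lia.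
have h0 := expn_gt0 2 (size w + e + 4).
split=> [j|j hj]; last by rewrite /last_row nth_default // (leq_trans _ hj).
case: j => [|[|[|[|[|j]]]]] //; last by rewrite /last_row nth_default.
exact: (h 0 (leq0n _)).
Qed.

End Bound.

Hypothesis unit_ok : good = 1 -> unit != 0.
Hypothesis value_ok : forall c s, is_suffix w (c :: s) -> good = 1 ->
  value_cond c (L s) (L (c :: s)) && gap_cond c (L (c :: s)).
Hypothesis letter_ok : forall s s', is_suffix w (TVar :: s) ->
  is_suffix w (TVar :: s') -> bit_run s = bit_run s' ->
  val (TVar :: s) = val (TVar :: s').
Hypothesis good_ok : good = wf_bool w && judgement_start w.
Hypothesis final_ok : good = 1 -> judgement_cond (L w).

Lemma row_cond_last : row_cond last_row.
Proof. by rewrite /row_cond /last_row /= !eqxx. Qed.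

(** A matching pointer determines the length of the target, and a suffix of [w] is determined by its
    length. *)
Lemma link_cond_of s s' : is_suffix w s -> is_suffix w s' -> link_cond (L s) (L s').
Proof.
move=> hs hs'; rewrite /link_cond on_parses !label_ofE /at_rest.
case e : (rest s) => [r|] //=; apply/implyP => /eqP /pos_of_inj er.
have hr : is_suffix w r.
  have [p ep] := rest_suffix e; case: hs => p' ew.
  by exists (p' ++ p); rewrite -catA -ep -ew.
have <- : r = s' by rewrite -(suffix_atE hr) er suffix_atE.
by rewrite /at_rest !eqxx.
Qed.

Lemma link_cond_last s : link_cond (L s) last_row \/ size w < size s.
Proof.
have [hs|hs] := leqP (size s) (size w); last by right.
left; rewrite /link_cond on_parses label_ofE /at_rest.
case e : (rest s) => [r|] //=; apply/implyP => /eqP er; exfalso.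
have [p ep] := rest_suffix e; move: hs er; rewrite ep size_cat /pos_of => hs.
have : 2 ^ size r < 2 ^ (size w).+1 by rewrite ltn_exp2l //; lia.
by rewrite -[last_row r_pos]/((2 ^ (size w).+1).-1); have := expn_gt0 2 (size r); lia.
Qed.

Lemma letter_cond_of s s' :
  is_suffix w s -> is_suffix w s' -> letter_cond (L s) (L s').
Proof.
move=> hs hs'; rewrite /letter_cond !label_ofE; apply/implyP => /and5P[_ _].
case: s hs => [|[||||||||||[]] s] //= hs _.
case: s' hs' => [|[||||||||||[]] s'] //= hs' _.
by move=> /eqP /run_code_inj h; rewrite (letter_ok hs hs' h).
Qed.

Lemma reference_labelled : labelled adj_cond pair_cond w (size w).+2 reference.
Proof.
split=> [t ht|t t' ht ht'].
  rewrite /reference; have tw : t <= size w by lia.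
  rewrite tw; apply/andP; split.
    apply/implyP => /eqP ->; rewrite (_ : suffix_at 0 = [::]).
      rewrite /base_cond !on_labels label_ofE rest_other //= andbT.
      by apply/asboolP; exact: wf_nil.
    by rewrite /suffix_at subn0 drop_size.
  have [lt|ge] := ltnP t (size w).
    have [c ec ->] := suffix_atS lt; rewrite ec.
    rewrite common_cond_of parse_cond_of wf_cond_of /=.
    apply/implyP; rewrite /on !label_ofE => /eqP g1; apply: value_ok => //.
    by rewrite -ec; exact: is_suffix_at.
  have -> : onth (rev w) t = None.
    have -> : t = size (rev w) by rewrite size_rev; lia.
    by elim: (rev w).
  have -> : suffix_at t = w by rewrite /suffix_at (_ : size w - t = 0) ?drop0 //; lia.
  rewrite /final_cond on_wf /starts_judgement !label_ofE tok_of_judgement.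
  rewrite (on_bool (b := wf_bool w && judgement_start w)) ?label_ofE // eqxx /=.
  by apply/implyP => hg; apply: final_ok; rewrite good_ok hg.
rewrite /reference; case: ifP => tw; case: ifP => tw'; apply/and3P; split.
- exact: row_cond_of.
- by apply: link_cond_of; exact: is_suffix_at.
- by apply: letter_cond_of; exact: is_suffix_at.
- exact: row_cond_of.
- have [//|] := link_cond_last (suffix_at t).
  by rewrite size_suffix_at // ltnNge tw.
- by rewrite /letter_cond [on last_row _]/= andbF.
- exact: row_cond_last.
- by [].
- by [].
- exact: row_cond_last.
- by [].
- by [].
Qed.

End Reference.

(** * Completeness *)

Section Codes.
Variables (R : realType) (D : Type) (v : D -> \bar R) (p : D -> nat).
Hypothesis v_ge0 : forall u, (0 <= v u)%E.
Hypothesis p_add : forall u u' u'', (fine (v u) + fine (v u') = fine (v u''))%R ->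
  p u + p u' = p u''.
Hypothesis p_le : forall u u', (fine (v u) <= fine (v u'))%R -> p u <= p u'.
Hypothesis p_pos : forall u, (0 < fine (v u))%R -> 0 < p u.

(** Since [fine] maps [+oo] to 0, infinite values take part in the linear system as zeros and [p] is
    meaningless for them; infinity is therefore read off [v]. *)
Definition code (u : D) : nat := if v u == +oo%E then 0 else (p u).+1.

Variant code_spec u : \bar R -> nat -> Prop :=
| CodeInf of v u = +oo%E : code_spec u +oo%E 0
| CodeFin r of v u = r%:E & fine (v u) = r & (0 <= r)%R : code_spec u r%:E (p u).+1.

Lemma codeP u : code_spec u (v u) (code u).
Proof.
rewrite /code; case h : (v u) => [r| |] /=.
- by apply: CodeFin => //; [rewrite h | have := v_ge0 u; rewrite h lee_fin].
- exact: CodeInf.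
- by have := v_ge0 u; rewrite h.
Qed.

Lemma p_eq0 u : (fine (v u) = 0)%R -> p u = 0.
Proof. by move=> h; have := @p_add u u u; rewrite h addr0 => /(_ erefl); lia. Qed.

Lemma code_eq u u' : v u = v u' -> code u = code u'.
Proof.
rewrite /code => h; rewrite h; case: ifP => // _; congr S.
by apply/eqP; rewrite eqn_leq !p_le // h.
Qed.

Lemma code_eq0 u : (code u == 0) = (v u == +oo%E).
Proof. by case: codeP. Qed.

Lemma code_eq1 u : (code u == 1) = (v u == 0%E).
Proof.
case: codeP => // r _ h r0; rewrite eqe eqSS.
apply/eqP/eqP => [h1|h1]; last by apply: p_eq0; rewrite h.
apply/eqP; rewrite eq_le r0 andbT leNgt; apply/negP => h2.
by have := @p_pos u; rewrite h h1 => /(_ h2).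
Qed.

Lemma code_add u u' u'' : v u'' = (v u + v u')%E ->
  add_code (code u) (code u') (code u'').
Proof.
rewrite /add_code => h; case: (codeP u) h => [_|r _ h1 r0] h /=.
  rewrite andbT code_eq0 h; by have := v_ge0 u'; case: (v u').
case: (codeP u') h => [_|r' _ h2 r'0] h /=; first by rewrite andbT code_eq0 h.
case: (codeP u'') h => [_ //|r'' _ h3 _] /= [e].
by rewrite addn0 addn1 addSn addnS !eqSS (@p_add u u' u'') // h1 h2 h3 e.
Qed.

(** The branch in [sub_code] is selected by comparing codes, not values. If the difference is
    truncated, order is preserved and [p u''] vanishes; otherwise [p u'' + p u = p u'] yields the
    required equation in whichever branch the codes select. *)
Lemma code_sub u u' u'' : v u'' = tsub (v u') (v u) ->
  sub_code (code u') (code u) (code u'').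
Proof.
rewrite /sub_code => h; case: codeP h => [_|r _ h1 r0] /= h.
  by rewrite andbT code_eq1 h tsub_yr.
case: codeP h => [_|r' _ h2 r'0] /= h.
  by rewrite andbT code_eq0 h tsub_yl.
rewrite tsub_fin in h; move: h; case: codeP => [_ //|r'' _ h3 r''0] /= [h].
rewrite !ltnS !addn0 addn1; apply/andP; split; apply/implyP => le.
  rewrite eqSS; apply/eqP; have [le'|gt] := leP r' r.
    by apply: p_eq0; rewrite h3 h max_l // subr_le0.
  have : p u'' + p u = p u'.
    by apply: p_add; rewrite h1 h2 h3 h max_r ?subrK // subr_ge0 ltW.
  by lia.
have [le'|gt] := leP r' r.
  have e1 : p u'' = 0 by apply: p_eq0; rewrite h3 h max_l // subr_le0.
  have : p u' <= p u by apply: p_le; rewrite h1 h2.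
  by rewrite e1; lia.
have : p u'' + p u = p u'.
  by apply: p_add; rewrite h1 h2 h3 h max_r ?subrK // subr_ge0 ltW.
by lia.
Qed.

End Codes.

(** Rows inside a coefficient carry the value of the formula that the coefficient multiplies. *)
Fixpoint core (s : seq token) : seq token :=
  match s with TBit _ :: s1 | TSlash :: s1 => core s1 | _ => s end.

Lemma core_formula s : starts formula_head s -> core s = s.
Proof. by case: s => [|[]]. Qed.

Lemma core_suffix s : exists p, s = p ++ core s.
Proof.
elim: s => [|c s [p ep]]; first by exists [::].
case: c => [||||||||||b] /=; try (by exists [::]).
  by exists (TSlash :: p); rewrite {1}ep.
by exists (TBit b :: p); rewrite {1}ep.
Qed.

Lemma core_run s : core s = core (after_run s).
Proof. by elim: s => [|[]]. Qed.

(* The length of the suffix that starts with the scaling whose coefficient is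
   being read: [rp] is the reversed prefix and [t] the length of the rest. *)
Fixpoint scale_above_num (rp : seq token) (t : nat) : option nat :=
  match rp with
  | TBit _ :: rp' => scale_above_num rp' t.+1
  | TScale :: _ => Some t.+1
  | _ => None
  end.

Fixpoint scale_above_den (rp : seq token) (t : nat) : option nat :=
  match rp with
  | TBit _ :: rp' => scale_above_den rp' t.+1
  | TSlash :: rp' => scale_above_num rp' t.+1
  | _ => None
  end.

(** * Registers filled from a refuting model *)

Section Values.
Variables (R : realType) (M : model R) (w : seq token).

Notation ev phi := (eval M (map_form (frac_val R) phi)).

Definition rho (s : seq token) : \bar R :=
  if parse (core s) is Some (phi, _) then ev phi else 0%E.

Lemma rho_ge0 s : (0 <= rho s)%E.
Proof. by rewrite /rho; case: parse => // -[phi _]; exact: eval_ge0. Qed.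

Lemma rho_parses s phi r : parses s phi r -> rho s = ev phi.
Proof.
move=> h; rewrite /rho core_formula ?(parses_formula h) //.
by move/parseP: h => ->.
Qed.

(** The intended value of [r_gap]. The fuel [k] is there because the recursion continues behind a
    whole formula and is not structural. *)
Fixpoint chi_rec (k : nat) (s : seq token) : \bar R :=
  if k is k'.+1 then
    match s with
    | TComma :: s1 => chi_rec k' s1
    | TVdash :: s1 => rho s1
    | _ => if parse s is Some (_, r) then tsub (chi_rec k' r) (rho s) else 0%E
    end
  else 0%E.

Definition chi (s : seq token) : \bar R := chi_rec (size s).+1 s.

Lemma chi_recE k k' s : size s < k -> size s < k' -> chi_rec k s = chi_rec k' s.
Proof.
elim: k k' s => [|k IH] [|k'] s //=; rewrite !ltnS => h h'.
have rec : (if parse s is Some (_, r) then tsub (chi_rec k r) (rho s) else 0%E) =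
           (if parse s is Some (_, r) then tsub (chi_rec k' r) (rho s) else 0%E).
  case e : (parse s) => [[phi r]|] //; congr tsub; apply: IH.
    by have /parseP /parses_size := e; lia.
  by have /parseP /parses_size := e; lia.
by case: s h h' rec => [|[] s] //= h h' rec; apply: IH.
Qed.

Lemma chi_comma s : chi (TComma :: s) = chi s.
Proof. by []. Qed.

Lemma chi_vdash s : chi (TVdash :: s) = rho s.
Proof. by []. Qed.

Lemma chi_parses s phi r : parses s phi r -> chi s = tsub (chi r) (rho s).
Proof.
move=> h; have hs := parses_formula h; have sr := parses_size h.
have /parseP e := h; rewrite {1}/chi.
have -> : chi_rec (size s).+1 s =
    if parse s is Some (_, r) then tsub (chi_rec (size s) r) (rho s) else 0%E.
  by case: s hs {h sr e} => [|[] s].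
by rewrite e (@chi_recE _ (size r).+1).
Qed.

Lemma chi_ge0 s : (0 <= chi s)%E.
Proof.
rewrite /chi; move: (size s).+1 => k; elim: k s => [|k IH] s //=.
have rec : (0 <= if parse s is Some (_, r) then tsub (chi_rec k r) (rho s) else 0)%E.
  by case: parse => // -[_ r]; apply: tsub_ge0 => //; exact: rho_ge0.
by case: s rec => [|[] s] //= _; exact: rho_ge0.
Qed.

Lemma chi_judgement j r : ~~ starts is_bit r ->
  (chi (enc_judgement j ++ r) == 0%E) <-> satisfies M (map_judgement (frac_val R) j).
Proof.
case: j => fs psi hr; rewrite /satisfies /=.
have sum_ge0 l : (0 <= \sum_(phi <- map (map_form (frac_val R)) l) eval M phi)%E.
  by apply: sume_ge0 => phi _; exact: eval_ge0.
have -> : chi (enc_judgement (Judgement fs psi) ++ r) =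
    tsub (ev psi) (\sum_(phi <- map (map_form (frac_val R)) fs) eval M phi)%E.
  elim: fs => [|phi fs IH].
    rewrite /= big_nil tsub0 ?eval_ge0 // chi_vdash.
    by apply: (@rho_parses _ psi r).
  rewrite enc_judgement_cons -catA /=.
  set s := enc_form phi ++ _.
  have h : parses s phi (TComma :: enc_judgement (Judgement fs psi) ++ r) by [].
  rewrite (chi_parses h) chi_comma IH (rho_parses h) big_cons.
  by rewrite tsub_tsub ?eval_ge0 // addeC.
by rewrite tsub_eq0 ?eval_ge0.
Qed.

Local Notation n := (size w).
(** The coordinates of the linear system: [None] is the unit, and each suffix length has one
    coordinate for the value ([false]) and one for the gap ([true]). *)
Let D : finType := option ('I_n.+1 * bool)%type.

Definition real_val (u : D) : \bar R :=
  if u is Some (t, b) then (if b then chi else rho) (suffix_at w t) else 1%E.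

Lemma real_val_ge0 u : (0 <= real_val u)%E.
Proof. by case: u => [[t []]|] //=; [exact: chi_ge0 | exact: rho_ge0]. Qed.

Definition val_ix (s : seq token) : D := Some (inord (size s), false).
Definition gap_ix (s : seq token) : D := Some (inord (size s), true).

Lemma inord_suffix s : is_suffix w s -> suffix_at w (inord (size s) : 'I_n.+1) = s.
Proof.
move=> hs; rewrite inordK ?suffix_atE //.
by case: hs => p ->; rewrite size_cat; lia.
Qed.

Lemma real_val_ix s : is_suffix w s -> real_val (val_ix s) = rho s.
Proof. by move=> hs; rewrite /= inord_suffix. Qed.

Lemma real_gap_ix s : is_suffix w s -> real_val (gap_ix s) = chi s.
Proof. by move=> hs; rewrite /= inord_suffix. Qed.

(** Clears the denominator of a scaling: [den] times its value is [num] times the value of its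
    argument. Positions without a scaling, and infinite arguments, for which the finite parts need
    not be proportional, get the trivial relation [0 = 0]. *)
Definition scale_relation (t : 'I_n.+1) : nat * D * (nat * D) :=
  if suffix_at w t is TScale :: s1 then
    if after_run s1 is TSlash :: s2 then
      if (rest (TScale :: s1) != None) && (rho s1 != +oo%E) then
        (bits_val (bit_run s2), Some (t, false),
         (bits_val (bit_run s1), val_ix (core s1)))
      else (0, None, (0, None))
    else (0, None, (0, None))
  else (0, None, (0, None)).

Lemma rest_scale s1 : rest (TScale :: s1) != None ->
  exists k a s2 r, [/\ parses (TScale :: s1) (Scale k a) r,
    bit_run s1 = bits_N (fnum k), after_run s1 = TSlash :: s2,
    bit_run s2 = bits_pos (fden k) & parses (after_run s2) a r].
Proof.
case e : (rest (TScale :: s1)) => [r|] // _.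
have [/(_ e)[phi h] _] := @restP (TScale :: s1) r isT.
have [k [a [s2 [ephi h1 h2 h3 h4]]]] := (parses_Scale s1 phi r).1 h.
by exists k, a, s2, r; split=> //; rewrite -ephi.
Qed.

Lemma core_scale s1 s2 a r : after_run s1 = TSlash :: s2 ->
  parses (after_run s2) a r -> core s1 = after_run s2.
Proof.
move=> h1 h2; rewrite core_run h1 /= core_run core_formula //.
exact: parses_formula h2.
Qed.

Lemma rho_scale s1 k a s2 r : parses (TScale :: s1) (Scale k a) r ->
  after_run s1 = TSlash :: s2 -> parses (after_run s2) a r ->
  rho (TScale :: s1) =
  (((nat_of_bin (fnum k))%:R / (nat_of_bin (Npos (fden k)))%:R)%:E * rho s1)%E.
Proof.
move=> h h1 h2; rewrite (rho_parses h) /=; congr (_ * _)%E.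
rewrite -(rho_parses h2) /rho (core_scale h1 h2) core_formula //.
exact: parses_formula h2.
Qed.

Lemma den_gt0 k : (0 < nat_of_bin (Npos (fden k)))%N.
Proof. by rewrite lt0n -(bits_N_neq0 (Npos (fden k))) /= head_bits_pos. Qed.

Lemma scale_relation_true t :
  ((scale_relation t).1.1%:R * fine (real_val (scale_relation t).1.2) =
   (scale_relation t).2.1%:R * fine (real_val (scale_relation t).2.2))%R.
Proof.
rewrite /scale_relation; case es : (suffix_at w t) => [|[] s1]; rewrite ?mul0r //.
case ea : (after_run s1) => [|[] s2]; rewrite ?mul0r //.
case: andP => [[hr hfin]|_]; last by rewrite !mul0r.
have [k [a [s2' [r [h h1 h2 h3 h4]]]]] := rest_scale hr.
move: ea; rewrite h2 => -[e2]; subst s2'.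
have hs : is_suffix w (core s1).
  have [p ep] := core_suffix s1; have [p' ew] := is_suffix_at w t.
  by exists (p' ++ TScale :: p); rewrite -catA cat_cons -ep -es.
rewrite [(_, _).1.1]/= [(_, _).2.1]/= [(_, _).2.2]/= real_val_ix //.
rewrite [real_val _]/= es (rho_scale h h2 h4) h1 h3 bits_val_N bits_val_pos.
have -> : rho (core s1) = rho s1.
  by rewrite /rho (core_scale h2 h4) core_formula // (parses_formula h4).
case e : (rho s1) hfin (rho_ge0 s1) => [x| |] //= _ _.
by rewrite mulrA mulrCA mulfV ?mulr1 // pnatr_eq0 -lt0n den_gt0.
Qed.

Lemma scale_relation_le t :
  ((scale_relation t).1.1 <= 2 ^ n /\ (scale_relation t).2.1 <= 2 ^ n)%N.
Proof.
have le s : (size s <= n)%N -> (bits_val (bit_run s) <= 2 ^ n)%N.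
  move=> hs; apply: ltnW; apply: leq_trans (bits_val_lt _) _; rewrite leq_exp2l //.
  apply: leq_trans hs; rewrite [leqRHS](_ : _ = size (enc_bits (bit_run s) ++ after_run s)).
    by rewrite size_cat size_map leq_addr.
  by rewrite -bit_run_cat.
rewrite /scale_relation; case es : (suffix_at w t) => [|[] s1] //.
case ea : (after_run s1) => [|[] s2] //; case: andP => // _ /=.
have [p ew] := is_suffix_at w t.
have sz : (size s1 <= n)%N by rewrite ew es size_cat /=; lia.
split; apply: le => //; apply: leq_trans sz.
by rewrite [in leqRHS](bit_run_cat s1) ea size_cat /=; lia.
Qed.

Let c_bits : nat := (9 * #|D| ^ 3 + 2 * #|{: 'I_n.+1}| * (n + 2))%N.

Lemma integer_values : exists p : D -> nat,
  [/\ forall u u' u'', (fine (real_val u) + fine (real_val u') = fine (real_val u''))%R ->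
        (p u + p u' = p u'')%N,
      forall u u', (fine (real_val u) <= fine (real_val u'))%R -> (p u <= p u')%N,
      forall u, (0 < fine (real_val u))%R -> (0 < p u)%N,
      forall t, ((scale_relation t).1.1 * p (scale_relation t).1.2 =
                 (scale_relation t).2.1 * p (scale_relation t).2.2)%N &
      forall u, (p u <= 2 ^ c_bits)%N].
Proof.
apply: integer_copy; [|exact: scale_relation_true|exact: scale_relation_le].
by move=> u; apply: fine_ge0; exact: real_val_ge0.
Qed.


Lemma semi_split (s1 s2 p s : seq token) : has is_semi s1 = false ->
  s1 ++ TSemi :: s2 = p ++ TSemi :: s ->
  s2 = s \/ exists p', s2 = p' ++ TSemi :: s.
Proof.
elim: s1 p => [|c s1 IH] [|d p] /=.
- by move=> _ []; left.
- by move=> _ [_ ->]; right; exists p.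
- by case: c.
- by move=> /norP[_ /negbTE h] [_ /(IH _ h)].
Qed.

(** What follows a semicolon is again an encoding, with the same conclusion and some of the
    premises, so that [chi_encode] applies at every semicolon. *)
Lemma premise_suffix S g s : is_suffix (encode (Instance S g)) (TSemi :: s) ->
  exists2 S', s = encode (Instance S' g) & forall j, List.In j S' -> List.In j S.
Proof.
elim: S => [|j S IH] [p].
  have := no_semi_judgement g; rewrite /encode /= => h e.
  by move: h; rewrite e has_cat /= orbT.
rewrite encode_cons => /semi_split[|e|[p' e]].
- exact: no_semi_judgement.
- by exists S => // j' hj; right.
- have [|S' h1 h2] := IH; first by exists p'.
  by exists S' => // j' /h2; right.
Qed.

Variables (S0 : seq (judgement frac)) (g0 : judgement frac).
Hypothesis w_encode : w = encode (Instance S0 g0).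
Hypothesis premises_hold :
  forall j, List.In j S0 -> satisfies M (map_judgement (frac_val R) j).
Hypothesis conclusion_fails : ~ satisfies M (map_judgement (frac_val R) g0).

Lemma chi_encode S : (forall j, List.In j S -> List.In j S0) ->
  let s := encode (Instance S g0) in (chi s == 0%E) = has is_semi s.
Proof.
case: S => [|j S] hS.
  rewrite /= /encode /= no_semi_judgement; apply/negP.
  by have := chi_judgement g0 (r := [::]) isT; rewrite cats0 => -> .
rewrite /= encode_cons has_cat /= orbT.
by apply/chi_judgement => //; apply: premises_hold; apply: hS; left.
Qed.

Variable p : D -> nat.
Hypothesis p_add : forall u u' u'',
  (fine (real_val u) + fine (real_val u') = fine (real_val u''))%R ->
  (p u + p u' = p u'')%N.
Hypothesis p_le : forall u u',
  (fine (real_val u) <= fine (real_val u'))%R -> (p u <= p u')%N.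
Hypothesis p_pos : forall u, (0 < fine (real_val u))%R -> (0 < p u)%N.
Hypothesis p_scale : forall t, ((scale_relation t).1.1 * p (scale_relation t).1.2 =
                 (scale_relation t).2.1 * p (scale_relation t).2.2)%N.

Definition val_code (s : seq token) : nat := code real_val p (val_ix (core s)).
Definition gap_code (s : seq token) : nat := code real_val p (gap_ix s).

Definition scale_above (s : seq token) : option nat :=
  (if starts is_slash (after_run s) then scale_above_num else scale_above_den)
    (rev (take (n - size s) w)) (size s).

(** The quotient to be guessed is the numerator of the value of the enclosing scaling, found by
    looking to the left of [s]. *)
Definition quot_num (s : seq token) : nat :=
  if scale_above s is Some t then p (Some (inord t, false)) else 0.

Local Notation L := (label_of val_code gap_code quot_num (p None) 1).

Lemma is_suffix_core s : is_suffix w s -> is_suffix w (core s).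
Proof.
by case=> q ->; have [q' e] := core_suffix s; exists (q ++ q'); rewrite -catA -e.
Qed.

Lemma rho_core s : rho (core s) = rho s.
Proof. by rewrite /rho; congr (if parse _ is Some _ then _ else _); elim: s => [|[]]. Qed.

Lemma real_val_core s : is_suffix w s -> real_val (val_ix (core s)) = rho s.
Proof. by move=> /is_suffix_core /real_val_ix ->; rewrite rho_core. Qed.

Lemma scale_above_cons c s : is_suffix w (c :: s) ->
  rev (take (n - size s) w) = c :: rev (take (n - size (c :: s)) w).
Proof.
case=> q e; have -> : n - size s = size (rcons q c).
  by rewrite e size_cat size_rcons /=; lia.
have -> : n - size (c :: s) = size q by rewrite e size_cat addnK.
by rewrite e -{1}cat_rcons !take_size_cat // rev_rcons.
Qed.

Lemma quot_bit b s : is_suffix w (TBit b :: s) -> quot_num (TBit b :: s) = quot_num s.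
Proof.
move=> hs; rewrite /quot_num /scale_above (scale_above_cons hs) /=.
by case: ifP.
Qed.

Lemma quot_slash s : is_suffix w (TSlash :: s) -> ~~ starts is_slash (after_run s) ->
  quot_num (TSlash :: s) = quot_num s.
Proof.
by move=> hs /negbTE h; rewrite /quot_num /scale_above (scale_above_cons hs) /= h.
Qed.

Lemma quot_scale s : is_suffix w (TScale :: s) -> starts is_slash (after_run s) ->
  quot_num s = p (val_ix (TScale :: s)).
Proof. by move=> hs h; rewrite /quot_num /scale_above (scale_above_cons hs) /= h. Qed.

Lemma quot_run s : is_suffix w s -> quot_num s = quot_num (after_run s).
Proof.
elim: s => // c s IH hs; case: c hs => // b hs.
by rewrite quot_bit //= IH //; exact: is_suffix_cons hs.
Qed.

Lemma val_code_formula s : starts formula_head s ->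
  val_code s = code real_val p (val_ix s).
Proof. by move=> h; rewrite /val_code core_formula. Qed.

Lemma rest2_children s : rest2 s != None -> is_suffix w s -> exists a b r1 r,
    [/\ parses s a r1, parses r1 b r, rest s = Some r1, is_suffix w r1 & rest2 s = Some r].
Proof.
case e : (rest2 s) => [r|] // _ hs; have [a [b [r1 [h1 h2]]]] := (rest2P s r).1 e.
exists a, b, r1, r; split=> //; last exact: is_suffix_parses hs h1.
by apply/(restP r1 (parses_formula h1)); exists a.
Qed.

Lemma code0 u : (code real_val p u == 0) = (real_val u == +oo%E).
Proof. by rewrite code_eq0 //; exact: real_val_ge0. Qed.

Lemma code1 u : (code real_val p u == 1) = (real_val u == 0%E).
Proof. by rewrite code_eq1 //; exact: real_val_ge0. Qed.

Lemma value_scale s : is_suffix w (TScale :: s) -> rest (TScale :: s) != None ->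
  [&& ((val_code s == 0) && (tok_of s == 12)) ==> (val_code (TScale :: s) == 0),
      ((val_code s == 0) && (tok_of s != 12)) ==> (val_code (TScale :: s) == 1),
      (val_code s != 0) ==> (quot_num s + 0 + 1 == val_code (TScale :: s) + 0) &
      (val_code s != 0) ==>
        (prod_of val_code quot_num s == dprod_of val_code quot_num s)].
Proof.
move=> hs hr; have hs' := is_suffix_cons hs.
have [k [a [s2 [r [h h1 h2 h3 h4]]]]] := rest_scale hr.
have rs := rho_scale h h2 h4; have d0 := den_gt0 k.
rewrite tok_of_bit1 h1 bits_N_neq0 [val_code (TScale :: s)]val_code_formula //.
rewrite code0 code1.
rewrite real_val_ix // {1 2 3 4}/val_code !code0 real_val_core // rs.
have q0 : (0 < (nat_of_bin (Npos (fden k)))%:R :> R)%R by rewrite ltr0n.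
apply/and4P; split; apply/implyP.
- move=> /andP[/eqP -> k0]; rewrite gt0_muley // lte_fin divr_gt0 // ltr0n lt0n //.
- by move=> /andP[/eqP -> /negbNE /eqP ->]; rewrite mul0r mul0e.
- move=> hfin; rewrite !addn0 addn1 (quot_scale hs) ?h2 //.
  rewrite /code real_val_ix // rs; case: ifP => // /eqP.
  by case: (rho s) hfin (rho_ge0 s).
move=> hfin; rewrite /prod_of /dprod_of h2 /= /prod_of h1 h3 /base_of /=.
have hs3 : is_suffix w (TSlash :: s2) by have := is_suffix_run hs'; rewrite h2.
have hs2 := is_suffix_cons hs3.
have -> : starts is_slash (after_run s2) = false.
  by have := parses_formula h4; case: (after_run s2) => [|[]].
rewrite -quot_run // -quot_slash //; last first.
  by have := parses_formula h4; case: (after_run s2) => [|[]].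
have -> : quot_num (TSlash :: s2) = p (val_ix (TScale :: s)).
  by rewrite -(quot_scale hs) ?h2 // (quot_run hs') h2.
have -> : val_code (TSlash :: s2) = val_code s.
  by rewrite /val_code (core_scale h2 h4) /= core_run core_formula // (parses_formula h4).
rewrite /val_code /code real_val_core // (negbTE hfin) /=.
(* After unfolding the registers, equality of the two products is the proportion that was put into
   the linear system for this scaling. *)
have := p_scale (inord (size (TScale :: s))).
rewrite /scale_relation inord_suffix // h2 hr hfin /= h1 h3 => e.
rewrite eq_sym; apply/eqP; exact: e.
Qed.

Lemma value_cond_refutation c s : is_suffix w (c :: s) -> value_cond c (L s) (L (c :: s)).
Proof.
move=> hs; have hs' := is_suffix_cons hs.
case: c hs => [||||||||||b] hs; rewrite /value_cond ?on_labels ?label_ofE //.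
- apply/implyP; rewrite rest_Bot; case: ifP => // /negbT hb _.
  rewrite val_code_formula // code0 real_val_ix //.
  by rewrite (@rho_parses (TBot :: s) Bot s) //; apply/parses_Bot.
- apply/implyP; rewrite rest_One; case: ifP => // /negbT hb _.
  rewrite val_code_formula // !addn0 addn1.
  have <- : code real_val p None = (p None).+1 by [].
  apply/eqP; apply: code_eq => //; rewrite real_val_ix //.
  by rewrite (@rho_parses (TOne :: s) One s) //; apply/parses_One.
- apply/implyP; rewrite rest_Tensor => /rest2_children/(_ hs')[a [b [r1 [r [h1 h2 h3 h4 _]]]]].
  rewrite /at_rest h3 !val_code_formula ?(parses_formula h1) ?(parses_formula h2) //.
  apply: code_add => //; first exact: real_val_ge0.
  rewrite !real_val_ix // (rho_parses h1) (rho_parses h2).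
  by apply: (@rho_parses _ (Tensor a b) r); apply/parses_Tensor; exists a, b, r1.
- apply/implyP; rewrite rest_Limp => /rest2_children/(_ hs')[a [b [r1 [r [h1 h2 h3 h4 _]]]]].
  rewrite /at_rest h3 !val_code_formula ?(parses_formula h1) ?(parses_formula h2) //.
  apply: code_sub => //; first exact: real_val_ge0.
  rewrite !real_val_ix // (rho_parses h1) (rho_parses h2).
  by apply: (@rho_parses _ (Limp a b) r); apply/parses_Limp; exists a, b, r1.
- by apply/implyP => hr; exact: value_scale.
- apply/implyP; rewrite /=; case: andP => // -[_ h] _.
  by rewrite quot_slash // !eqxx.
- apply/eqP; apply: code_eq => //; rewrite !real_gap_ix //; exact: chi_comma.
- apply/implyP => /asboolP /wf_suffixE [phi [r [h _ _]]].
  rewrite val_code_formula ?(parses_formula h) //; apply/eqP; apply: code_eq => //.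
  by rewrite real_gap_ix // real_val_ix // chi_vdash.
- apply/implyP => _.
  have [S' es hS'] := @premise_suffix S0 g0 s (eq_ind w (fun u => is_suffix u _) hs _ w_encode).
  rewrite /judgement_cond on_semi label_ofE code1.
  rewrite real_gap_ix // {2 4}es chi_encode // -es.
  by case: (has _ _).
- rewrite quot_bit // !eqxx /= /prod_of /dprod_of /shift_of /= expnS.
  apply/andP; split; last by apply/eqP; rewrite -mulnA; lia.
  by rewrite bits_val_cons mulnDl; case: (b) => /=; apply/eqP; lia.
Qed.

Lemma gap_cond_refutation c s : is_suffix w (c :: s) -> gap_cond c (L (c :: s)).
Proof.
move=> hs; rewrite /gap_cond on_wf !label_ofE; apply/implyP => /andP[hc /asboolP hw].
have [phi [r [h _ _]]] : exists phi r,
    [/\ parses (c :: s) phi r, wf_suffix r & starts is_comma r].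
  by move/wf_suffixE: hw; case: (c) hc.
have hr := is_suffix_parses hs h.
rewrite /at_rest (_ : rest (c :: s) = Some r); last by apply/restP => //; exists phi.
rewrite val_code_formula //; apply: code_sub => //; first exact: real_val_ge0.
by rewrite !real_gap_ix // real_val_ix // (chi_parses h).
Qed.

Lemma letter_refutation s s' : is_suffix w (TVar :: s) -> is_suffix w (TVar :: s') ->
  bit_run s = bit_run s' -> val_code (TVar :: s) = val_code (TVar :: s').
Proof.
move=> hs hs' e; apply: code_eq => //; rewrite !real_val_ix //.
have rhoV u : rho (TVar :: u) =
    if pselect (exists p, bit_run u = bits_N (bin_of_nat p)) is left h
    then M (projT1 (cid h)) else 0%E.
  case: pselect => [h|h].
    case: (cid h) => q eq /=; apply: (@rho_parses _ (Var q) (after_run u)).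
    by apply/parses_Var; exists q.
  rewrite /rho /=; case eu : (parse _) => [[phi r]|] //.
  by move/parseP: eu => /parses_Var[q [_ hq _]]; case: h; exists q.
by rewrite !rhoV e.
Qed.

Lemma final_refutation : judgement_cond (L w).
Proof.
have hw : is_suffix w w by exists [::].
rewrite /judgement_cond on_semi label_ofE code1.
rewrite real_gap_ix // {2 4}w_encode chi_encode // -w_encode.
by case: (has _ _).
Qed.

End Values.

(** * Membership in co-NP *)

Lemma not_entails (R : realType) S g : ~ valid_instance R (Instance S g) ->
  exists M : model R,
    (forall j, List.In j S -> satisfies M (map_judgement (frac_val R) j)) /\
    ~ satisfies M (map_judgement (frac_val R) g).
Proof.
move=> /existsNP[M /not_implyP[hS hg]]; exists M; split=> //= j hj.
apply: hS => /=; elim: (S) hj => //= j' S' IH [->|/IH]; [by left | by right].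
Qed.

(** The exponent of [integer_copy] for [2 * n.+1] values and gaps with the unit, [n.+1] proportions
    and coefficients of at most [n] bits. One more bit is needed because codes exceed numerators by
    1. *)
Definition value_bits (n : nat) : nat :=
  (9 * (n.+1 * 2).+1 ^ 3 + 2 * n.+1 * (n + 2)).+1.

Lemma value_bits_le n : (n + value_bits n + 4 <= 100 * n.+2 ^ 3)%N.
Proof. by rewrite /value_bits !expnS expn0 !muln1; nia. Qed.

Lemma refuted_labelled (R : realType) w : ~ AL_consequence R w ->
  exists2 x : nat -> label, labelled adj_cond pair_cond w (size w).+2 x &
    forall t, (t < (size w).+2)%N ->
      (forall j, x t j < 2 ^ (100 * (size w).+2 ^ 3))%N /\
      (forall j, nregs <= j -> x t j = 0)%N.
Proof.
move=> hw; have le2 := value_bits_le (size w).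
have weaken x : (forall t, (t < (size w).+2)%N ->
      (forall j, x t j < 2 ^ (size w + value_bits (size w) + 4))%N /\
      (forall j, nregs <= j -> x t j = 0)%N) ->
    forall t, (t < (size w).+2)%N ->
      (forall j, x t j < 2 ^ (100 * (size w).+2 ^ 3))%N /\
      (forall j, nregs <= j -> x t j = 0)%N.
  move=> hx t /hx[h1 h2]; split=> // j; apply: leq_trans (h1 j) _.
  by rewrite leq_exp2l.
case hwf : (wf_bool w && judgement_start w); last first.
  (* The word encodes nothing: [r_good] is 0, which voids all conditions on values, and only the
     structural registers matter. *)
  pose z (_ : seq token) := 0%N.
  exists (reference z z z 0 0 w).
    by apply: reference_labelled; rewrite ?hwf.
  by apply: weaken; exact: reference_bound.
have /andP[/asboolP hwf1 hwf2] := hwf.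
have [[S g] ew] := wf_decode hwf1 hwf2.
have [M [hS hg]] : exists M : model R,
    (forall j, List.In j S -> satisfies M (map_judgement (frac_val R) j)) /\
    ~ satisfies M (map_judgement (frac_val R) g).
  by apply: not_entails => hv; apply: hw; exists (Instance S g).
have [p [p_add p_le p_pos p_scale p_bound]] := integer_values M w.
have cardD : #|{: option ('I_(size w).+1 * bool)}| = ((size w).+1 * 2).+1.
  by rewrite card_option card_prod card_ord card_bool.
rewrite cardD card_ord in p_bound.
have p_bound1 u : (p u < 2 ^ value_bits (size w))%N.
  by apply: leq_ltn_trans (p_bound u) _; rewrite ltn_exp2l.
pose V := val_code M p; pose X := gap_code M p; pose Q := quot_num p.
exists (reference V X Q (p None) 1 w).
  apply: reference_labelled.
  - by move=> _; rewrite -lt0n; apply: p_pos; rewrite /= Num.Theory.ltr01.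
  - move=> c s hs _; apply/andP; split.
      exact: (value_cond_refutation ew hS hg p_add p_le p_pos p_scale hs).
    exact: gap_cond_refutation.
  - by move=> s s'; exact: letter_refutation.
  - by rewrite hwf.
  - by move=> _; exact: (final_refutation ew hS hg p_add p_pos).
apply: weaken; apply: reference_bound => // [s|s|s|].
- by rewrite /V /val_code /code; case: ifP.
- by rewrite /X /gap_code /code; case: ifP.
- by rewrite /Q /quot_num; case: scale_above => // t; exact: ltnW.
- exact: ltnW.
Qed.

Theorem theorem7p5 (R : realType) : in_coNP (AL_consequence R).
Proof.
apply: (labelled_inNP (K := nregs) (Padj := adj_cond) (Pall := pair_cond)
  (c := 100) (k := 3)).
- exact: regular_adj_cond.
- exact: regular_pair_cond.
- by move=> w m x wm [adj pair]; exact: (labelled_refutes wm adj pair (R := R)).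
- exact: refuted_labelled.
Qed.
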